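(* Let $F$ be a field of characteristic $\ne2,3$ with separable closure $F_s$, let $\mathcal{B}$ be a Brown $F$-algebra, and identify $\mathcal{B}\otimes_FF_s$ with $\mathcal{B}(J,F_s\times F_s)$ for $J$ the split Albert algebra over $F_s$. If a proper inner ideal $I$ of $\mathcal{B}$ contains a singular element, then (after extending scalars to $F_s$) it is in the $\mathrm{Inv}(\mathcal{B})(F_s)$-orbit of an inner ideal of one of the following two forms: (a) $\begin{pmatrix}F_s&0\\ V&0\end{pmatrix}$, where $V$ is a totally singular subspace of $J$; or (b) $\begin{pmatrix}F_s&F_sd\\ d\times J&0\end{pmatrix}$, where $0\ne d\in J$ satisfies $d^{\#}=0$. In particular, $I$ has dimension $\le7$ and is singular, or $I$ is $12$-dimensional and is not singular.
   Context: An Albert $F$-algebra $J$ is a 27-dimensional central simple exceptional Jordan algebra over $F$, with cubic norm $N$, linear trace $T$ and nondegenerate form $T(x,y):=T(xy)$; $x^{\#}$ is defined by requiring that $T(x^{\#},y)$ be the coefficient of $t$ in $N(x+ty)$; $x\times y:=(x+y)^{\#}-x^{\#}-y^{\#}$. The split Albert algebra $J^d$ is the space of Hermitian $3\times3$ matrices over the split Cayley (octonion) algebra with product $\frac12(ab+ba)$. A subspace $V\subseteq J$ is totally singular if $v^{\#}=0$ for all $v\in V$. $\mathcal{B}(J,F\times F)$ is the $F$-algebra with involution on $\begin{pmatrix}F&J\\ J&F\end{pmatrix}$ with product $$\begin{pmatrix}\alpha_1&j_1\\ j_1'&\beta_1\end{pmatrix}\begin{pmatrix}\alpha_2&j_2\\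 j_2'&\beta_2\end{pmatrix}=\begin{pmatrix}\alpha_1\alpha_2+T(j_1,j_2')&\alpha_1j_2+\beta_2j_1+j_1'\times j_2'\\ \alpha_2j_1'+\beta_1j_2'+j_1\times j_2&\beta_1\beta_2+T(j_2,j_1')\end{pmatrix}$$ and involution $\overline{\begin{pmatrix}\alpha&j\\ j'&\beta\end{pmatrix}}=\begin{pmatrix}\beta&j\\ j'&\alpha\end{pmatrix}$. A Brown $F$-algebra is an $F$-algebra with involution $(B,{-})$ such that $(B,{-})\otimes_FF_s\cong\mathcal{B}(J^d,F\times F)\otimes_FF_s$. Its skew-symmetric elements form a line $Fs_0$. Put $\{x,y,z\}:=(x\overline y)z+(z\overline y)x-(z\overline x)y$ and $U_e\,x:=\{e,x,e\}$. An element $e\in B$ is singular if $e\ne0$ and $U_eB\subseteq Fe$. A subspace $I\subseteq B$ is an inner ideal if $U_e(B)\subseteq I$ for all $e\in I$; it is proper if $I\ne B$; it is singular if all its nonzero elements are singular. With $b(x,y):=(x\overline y-y\overline x)s_0\in F$ and $t(y,z,w):=2\{y,s_0z,w\}-b(z,w)y-b(z,y)w-b(y,w)z$, $\mathrm{Inv}(\mathcal{B})$ is the algebraic group whose points are the linear maps $f$ of $B$ with $b(f(x),f(y))=b(x,y)$ and $t(f(x),f(y),f(z))=f(t(x,y,z))$. *)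

(* Defs.v *)
From HB Require Import structures.
From mathcomp Require Import all_boot all_order all_algebra all_field.
From mathcomp Require Import boolp classical_sets ring.

Set Implicit Arguments.
Unset Strict Implicit.
Unset Printing Implicit Defensive.

Import GRing.Theory.
Local Open Scope ring_scope.

(* The split Cayley algebra, as the Cayley-Dickson double of the 2 x 2
   matrices.  Everything that does not need division is defined over a
   commutative ring, so that the norm of x + t y below makes sense over F[t]. *)

Notation oct R := ('M[R]_2 * 'M[R]_2)%type.

Section Octonions.
Variable R : comNzRingType.

(* the adjugate of a 2 x 2 matrix *)
Definition mconj (A : 'M[R]_2) : 'M[R]_2 := (\tr A)%:M - A.

Definition omul (a b : oct R) : oct R :=
  (a.1 *m b.1 + mconj b.2 *m a.2, b.2 *m a.1 + a.2 *m mconj b.1).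

Definition oconj (a : oct R) : oct R := (mconj a.1, - a.2).

Definition oscal (c : R) : oct R := (c%:M, 0).

(* a + oconj a = oscal (otr a) and omul a (oconj a) = oscal (onorm a) *)
Definition otr (a : oct R) : R := \tr a.1.
Definition onorm (a : oct R) : R := \det a.1 - \det a.2.

End Octonions.

(* Hermitian 3 x 3 matrices over the octonions.  (x, a) stands for
     | x_0       a_2       oconj a_1 |
     | oconj a_2 x_1       a_0       |
     | a_1       oconj a_0 x_2       |
   so that the indices are cyclic mod 3. *)

Notation albert R := ('rV[R]_3 * {ffun 'I_3 -> oct R})%type.

Section Albert.
Variable R : comNzRingType.

Definition herm (x : albert R) : 'M[oct R]_3 :=
  \matrix_(i, j)
    if i == j then oscal (x.1 0 i)
    else if j == i + 1 then x.2 (j + 1) else oconj (x.2 (i + 1)).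

Definition amul_mx (A B : 'M[oct R]_3) : 'M[oct R]_3 :=
  \matrix_(i, j) \sum_k omul (A i k) (B k j).

Definition atr (x : albert R) : R := \sum_i x.1 0 i.

Definition anorm (x : albert R) : R :=
  \prod_i x.1 0 i - \sum_i x.1 0 i * onorm (x.2 i)
  + otr (omul (omul (x.2 0) (x.2 1)) (x.2 (1 + 1))).

End Albert.

Definition albert_map (R S : comNzRingType) (f : R -> S) (x : albert R) :
  albert S :=
  (map_mx f x.1, [ffun i => (map_mx f (x.2 i).1, map_mx f (x.2 i).2)]).

Section AlbertField.
Variable F : fieldType.

(* The Hermitian matrix (XY + YX) / 2, see herm_jmul. *)
Definition jmul (x y : albert F) : albert F :=
  let M := amul_mx (herm x) (herm y) + amul_mx (herm y) (herm x) in
  (\row_i (2^-1 * (2^-1 * otr (M i i))),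
   [ffun k => 2^-1 *: M (k + 1) (k + 1 + 1)]).

Definition atrform (x y : albert F) : F := atr (jmul x y).

(* the coefficient of t in N(x + t y) *)
Definition anorm_lin (x y : albert F) : F :=
  (anorm (albert_map polyC x + 'X *: albert_map polyC y))`_1.

(* the element v with atrform v y = anorm_lin x y for all y, see sharpP
   and sharp_unique *)
Definition sharp (x : albert F) : albert F :=
  xget 0 (fun v => forall y, atrform v y = anorm_lin x y).

Definition across (x y : albert F) : albert F :=
  sharp (x + y) - sharp x - sharp y.

Definition totally_singular (V : {vspace albert F}) : Prop :=
  forall v, v \in V -> sharp v = 0.

End AlbertField.

(* Coordinates for 'M_2 and the octonions, then: jmul is the Jordan product
   (herm_jmul), the trace form is nondegenerate (atrform_nd), so that sharp is
   well defined (sharpP, sharp_unique), and its explicit formula (sharpE). *)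

Lemma sum2 (V : nmodType) (f : 'I_2 -> V) : \sum_i f i = f 0 + f 1.
Proof. by rewrite 2!big_ord_recl big_ord0 addr0; congr (_ + f _); apply/val_inj. Qed.

Lemma sum3 (V : nmodType) (f : 'I_3 -> V) : \sum_i f i = f 0 + f 1 + f (1+1).
Proof. by rewrite 3!big_ord_recl big_ord0 addr0 addrA; congr (_ + f _ + f _); apply/val_inj. Qed.

Lemma prod3 (R : comNzRingType) (f : 'I_3 -> R) : \prod_i f i = f 0 * f 1 * f (1+1).
Proof. by rewrite 3!big_ord_recl big_ord0 mulr1 mulrA; congr (_ * f _ * f _); apply/val_inj. Qed.

Lemma I2P (i : 'I_2) : i = 0 \/ i = 1.
Proof. by case: i => [[|[|n]] h] //; [left|right]; apply/val_inj. Qed.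

Section Mx2.
Variable R : comNzRingType.
Lemma tr2 (A : 'M[R]_2) : \tr A = A 0 0 + A 1 1.
Proof. by rewrite /mxtrace sum2. Qed.

Lemma det2 (A : 'M[R]_2) : \det A = A 0 0 * A 1 1 - A 0 1 * A 1 0.
Proof.
rewrite (expand_det_row _ 0) sum2 /cofactor !det_mx11 !mxE /= -signr_odd /= -[(-1) ^+ (0 + _)]signr_odd /=.
have ->: lift (0:'I_2) (0 : 'I_1) = 1 by apply/val_inj.
have ->: lift (1:'I_2) (0 : 'I_1) = 0 by apply/val_inj.
by rewrite expr0 expr1 mul1r mulN1r mulrN.
Qed.

Definition mx2 (a b c d : R) : 'M[R]_2 :=
 \matrix_(i, j) if i == 0 then if j == 0 then a else b else if j == 0 then c else d.
Lemma mx2P (A : 'M[R]_2) : A = mx2 (A 0 0) (A 0 1) (A 1 0) (A 1 1).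
Proof.
by apply/matrixP=> i j; rewrite mxE; have [-> | ->] := I2P i; have [-> | ->] := I2P j.
Qed.

Lemma mx2M a b c d a' b' c' d' : mx2 a b c d *m mx2 a' b' c' d' =
  mx2 (a*a'+b*c') (a*b'+b*d') (c*a'+d*c') (c*b'+d*d').
Proof. by rewrite [LHS]mx2P !mxE !sum2 !mxE. Qed.

Lemma mx2D a b c d a' b' c' d' : mx2 a b c d + mx2 a' b' c' d' =
  mx2 (a+a') (b+b') (c+c') (d+d').
Proof. by rewrite [LHS]mx2P !mxE. Qed.

Lemma mx2N a b c d : - mx2 a b c d  = mx2 (-a) (-b) (-c) (-d).
Proof. by rewrite [LHS]mx2P !mxE. Qed.

Lemma mx2Z k a b c d : k *: mx2 a b c d  = mx2 (k*a) (k*b) (k*c) (k*d).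
Proof. by rewrite [LHS]mx2P !mxE. Qed.

Lemma mx20 : 0 = mx2 0 0 0 0.
Proof. by rewrite [LHS]mx2P !mxE. Qed.

Lemma mx2s k : k%:M = mx2 k 0 0 k.
Proof. by rewrite [LHS]mx2P !mxE. Qed.

Lemma mx2C a b c d : mconj (mx2 a b c d) = mx2 d (-b) (-c) a.
Proof.
rewrite [LHS]mx2P /mconj !mxE !tr2 !mxE /= !mulr0n !mulr1n !sub0r.
by congr mx2; ring.
Qed.

Lemma mx2t a b c d : \tr (mx2 a b c d) = a + d.
Proof. by rewrite tr2 !mxE. Qed.

Lemma mx2d a b c d : \det (mx2 a b c d) = a * d - b * c.
Proof. by rewrite det2 !mxE. Qed.

Definition mx2E := (mx2M, mx2D, mx2N, mx2Z, mx2C, mx20, mx2s, mx2t, mx2d).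
End Mx2.
Lemma mx2_map (R S : comNzRingType) (f : R -> S) a b c d : map_mx f (mx2 a b c d) = mx2 (f a) (f b) (f c) (f d).
Proof. by rewrite [LHS]mx2P !mxE. Qed.

Ltac mx2v A := let a := fresh "x" in let b := fresh "x" in let c := fresh "x" in let d := fresh "x" in
  rewrite (mx2P A); move: (A 0 0) (A 0 1) (A 1 0) (A 1 1) => a b c d; try clear A.
Ltac octv a := let A := fresh in let B := fresh in case: a => A B; mx2v A; mx2v B.
Ltac oc := rewrite /omul /oconj /oscal /otr /onorm /= ?mx2E /=.
Ltac oring := oc; try (congr (mx2 _ _ _ _, mx2 _ _ _ _)); ring.

Section OctonionTheory.
Variable R : comNzRingType.
Implicit Types a b : oct R.

Lemma oct_add a b : a + b = (a.1 + b.1, a.2 + b.2). Proof. by []. Qed.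

Lemma oct_scale (c : R) a : c *: a = (c *: a.1, c *: a.2). Proof. by []. Qed.

Lemma oconjP a : a + oconj a = oscal (otr a).
Proof. by octv a; rewrite oct_add; oring. Qed.

Lemma onormP a : omul a (oconj a) = oscal (onorm a).
Proof. by octv a; oring. Qed.

Lemma oconjM a b : oconj (omul a b) = omul (oconj b) (oconj a).
Proof. by octv a; octv b; oring. Qed.

End OctonionTheory.

Lemma I3P (i : 'I_3) : [\/ i = 0, i = 1 | i = 1 + 1].
Proof. by case: i => [[|[|[|n]]] h] //; [constructor 1|constructor 2|constructor 3]; apply/val_inj. Qed.

Lemma ord3_1 : (1:'I_3) + 1 + 1 = 0. Proof. exact/val_inj. Qed.

Lemma ord3_2 : (0:'I_3) + 1 = 1. Proof. exact/val_inj. Qed.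

Lemma ord3_3 (i:'I_3) : i + 1 + 1 + 1 = i. Proof. by case: (I3P i) => ->; apply/val_inj. Qed.

Definition ord3E := (ord3_3, ord3_1, ord3_2).
Lemma sum3i (V : nmodType) i (f : 'I_3 -> V) : \sum_k f k = f i + f (i+1) + f (i+1+1).
Proof.
rewrite sum3; case: (I3P i) => ->; rewrite ?ord3E //; first by rewrite -addrA addrC.
by rewrite addrC addrA.
Qed.

Section AlbertTheory.
Variable F : fieldType.
Hypothesis F2 : 2%:R != 0 :> F.
Implicit Types (x y : albert F) (a b : oct F).

Lemma hermE x :
 (forall i, herm x i i = oscal (x.1 0 i)) * (forall i, herm x i (i+1) = x.2 (i+1+1))
 * (forall i, herm x i (i+1+1) = oconj (x.2 (i+1)))
 * (forall i, herm x (i+1) i = oconj (x.2 (i+1+1)))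
 * (forall i, herm x (i+1+1) i = (x.2 (i+1))).
Proof.
by repeat split; move=> i; rewrite mxE; case: (I3P i) => ->.
Qed.

Lemma oscalD (c d : F) : oscal c + oscal d = oscal (c + d).
Proof. by rewrite oct_add /oscal /= raddfD addr0. Qed.

Lemma opolar a b : omul a (oconj b) + omul b (oconj a) = oscal (otr (omul a (oconj b))).
Proof. by octv a; octv b; rewrite oct_add; oring. Qed.

Lemma opolar' a b : omul (oconj a) b + omul (oconj b) a = oscal (otr (omul a (oconj b))).
Proof. by octv a; octv b; rewrite oct_add; oring. Qed.

Lemma oscalM (c d : F) : omul (oscal c) (oscal d) = oscal (c * d).
Proof. by oring. Qed.

Lemma otr_scal (c : F) : otr (oscal c) = 2 * c.
Proof. by oring. Qed.

Definition jm x y := amul_mx (herm x) (herm y) + amul_mx (herm y) (herm x).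
Lemma jm_diag x y i : jm x y i i = oscal (2 * (x.1 0 i * y.1 0 i) +
    (otr (omul (x.2 (i+1)) (oconj (y.2 (i+1)))) + otr (omul (x.2 (i+1+1)) (oconj (y.2 (i+1+1)))))).
Proof.
rewrite !mxE !(sum3i i) !hermE ?ord3E addrACA [X in X + _]addrACA opolar opolar'.
by rewrite !oscalM !oscalD; congr oscal; ring.
Qed.

Lemma oconjK a : oconj (oconj a) = a.
Proof. by octv a; oring. Qed.

Lemma oconj_scal (c : F) : oconj (oscal c) = oscal c.
Proof. by oring. Qed.

Lemma herm_conj (z : albert F) k l : herm z l k = oconj (herm z k l).
Proof.
by rewrite !mxE; case: (I3P k) => ->; case: (I3P l) => ->; rewrite /= ?oconjK ?oconj_scal.
Qed.

Lemma oconjD a b : oconj (a + b) = oconj a + oconj b.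
Proof. by octv a; octv b; rewrite !oct_add; oring. Qed.

Lemma oconj0 : oconj 0 = 0 :> oct F.
Proof. by apply: (addrI (oconj 0)); rewrite -oconjD !addr0. Qed.

Lemma jm_sym x y i j : jm x y j i = oconj (jm x y i j).
Proof.
have E (X Y : albert F) : amul_mx (herm X) (herm Y) j i = oconj (amul_mx (herm Y) (herm X) i j).
  rewrite !mxE !sum3 !oconjD !oconjM.
  by congr (_ + _ + _); congr omul; apply: herm_conj.
rewrite /jm; set A := amul_mx _ _; set B := amul_mx _ _.
have mxD i' j' : (A + B) i' j' = A i' j' + B i' j' by rewrite mxE.
by rewrite !mxD oconjD !E addrC.
Qed.

Lemma oconjZ (c : F) a : oconj (c *: a) = c *: oconj a.
Proof. by octv a; rewrite !oct_scale; oring. Qed.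

Lemma herm_jmul x y i j : herm (jmul x y) i j = 2^-1 *: jm x y i j.
Proof.
have D i' : herm (jmul x y) i' i' = 2^-1 *: jm x y i' i'.
  rewrite hermE mxE -/(jm x y) jm_diag.
  by move: (_ + _) => c; rewrite otr_scal mulKf // oct_scale /oscal /= scale_scalar_mx scaler0.
have O i' : herm (jmul x y) i' (i'+1) = 2^-1 *: jm x y i' (i'+1).
  by rewrite hermE /jmul /= ffunE !ord3_3 -/(jm x y).
have O' i' : herm (jmul x y) (i'+1) i' = 2^-1 *: jm x y (i'+1) i'.
  by rewrite herm_conj O oconjZ -jm_sym.
case: (I3P i) (D i) (O i) (O' j) (O i) (O' i) => -> ; case: (I3P j) => ->; rewrite ?ord3E //.
Qed.

Lemma atrformE (x y : albert F) :
  atrform x y = \sum_i (x.1 0 i * y.1 0 i + otr (omul (x.2 i) (oconj (y.2 i)))).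
Proof.
rewrite /atrform /atr /jmul /=.
under eq_bigr do rewrite mxE -/(jm x y) jm_diag otr_scal.
rewrite !sum3 ?ord3E.
move: (otr _) (otr _) (otr _) => a b c.
by field.
Qed.

Definition adj_mx x : albert F :=
  (\row_i (x.1 0 (i+1) * x.1 0 (i+1+1) - onorm (x.2 i)),
  [ffun i => oconj (omul (x.2 (i+1)) (x.2 (i+1+1))) - x.1 0 i *: x.2 i]).

Lemma anorm_expand x y :
  anorm (albert_map polyC x + 'X *: albert_map polyC y)
  = (anorm x)%:P + 'X * (atrform (adj_mx x) y)%:P + 'X ^+ 2 * (atrform (adj_mx y) x)%:P + 'X ^+ 3 * (anorm y)%:P.
Proof.
rewrite !atrformE /anorm !prod3 !sum3 /= !mxE !ffunE /= ?ord3E.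
move: (x.1 0 0) (x.1 0 1) (x.1 0 (1+1)) (x.2 0) (x.2 1) (x.2 (1+1)) => r s t a b c.
move: (y.1 0 0) (y.1 0 1) (y.1 0 (1+1)) (y.2 0) (y.2 1) (y.2 (1+1)) => u v w d e f.
octv a; octv b; octv c; octv d; octv e; octv f; rewrite !mx2_map; oc.
ring.
Qed.

Lemma anorm_linE x y : anorm_lin x y = atrform (adj_mx x) y.
Proof.
rewrite /anorm_lin anorm_expand.
move: (anorm x) (atrform _ y) (atrform _ x) (anorm y) => a b c d.
by rewrite !coefD !coefMC coefX !coefXn coefC /= mul1r !mul0r !addr0 add0r.
Qed.

Lemma sharpP x y : atrform (sharp x) y = anorm_lin x y.
Proof.
rewrite /sharp; move: y; apply: (@xgetPex _ 0 (fun v => forall y, atrform v y = anorm_lin x y)).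
by exists (adj_mx x) => y; rewrite anorm_linE.
Qed.

Lemma oform_nd a : (forall b, otr (omul a (oconj b)) = 0) -> a = 0.
Proof.
case: a => A B; rewrite (mx2P A) (mx2P B); move: (A 0 0) (A 0 1) (A 1 0) (A 1 1) (B 0 0) (B 0 1) (B 1 0) (B 1 1) => a1 a2 a3 a4 b1 b2 b3 b4 H.
have {}H c1 c2 c3 c4 d1 d2 d3 d4 := H (mx2 c1 c2 c3 c4, mx2 d1 d2 d3 d4).
have {}H c1 c2 c3 c4 d1 d2 d3 d4 : a1 * c4 - a2 * c3 - a3 * c2 + a4 * c1 - (b1 * d4 - b2 * d3 - b3 * d2 + b4 * d1) = 0.
  by rewrite -(H c1 c2 c3 c4 d1 d2 d3 d4); oc; ring.
congr pair; rewrite mx20; congr mx2.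
- by rewrite -(H 0 0 0 1 0 0 0 0); ring.
- by rewrite -(H 0 0 (-1) 0 0 0 0 0); ring.
- by rewrite -(H 0 (-1) 0 0 0 0 0 0); ring.
- by rewrite -(H 1 0 0 0 0 0 0 0); ring.
- by rewrite -(H 0 0 0 0 0 0 0 (-1)); ring.
- by rewrite -(H 0 0 0 0 0 0 1 0); ring.
- by rewrite -(H 0 0 0 0 0 1 0 0); ring.
- by rewrite -(H 0 0 0 0 (-1) 0 0 0); ring.
Qed.

Lemma oform0 a : otr (omul a (oconj 0)) = 0.
Proof. by rewrite [X in oconj X](_ : 0 = (0, 0)) //; octv a; oring. Qed.

Lemma atrform_nd x : (forall y, atrform x y = 0) -> x = 0.
Proof.
move=> H.
have N1 i : (i + 1 == i :> 'I_3) = false by case: (I3P i) => ->.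
have N2 i : (i + 1 + 1 == i :> 'I_3) = false by case: (I3P i) => ->.
case: x H => u a H; congr pair.
  apply/rowP=> i; rewrite mxE.
  have := H (delta_mx 0 i, 0); rewrite atrformE (sum3i i) /= !mxE !ffunE !eqxx /=.
  by rewrite !oform0 N1 N2 mulr1 !mulr0 !addr0.
apply/ffunP=> i; rewrite ffunE; apply: oform_nd => b.
have := H (0, [ffun j => if j == i then b else 0]).
rewrite atrformE (sum3i i) /= !mxE !ffunE !eqxx N1 N2.
by rewrite !oform0 !mulr0 !addr0 add0r.
Qed.

Lemma atrformB x x' y : atrform (x - x') y = atrform x y - atrform x' y.
Proof.
have oB a b c : otr (omul (a - b) c) = otr (omul a c) - otr (omul b c).
  by octv a; octv b; octv c; rewrite oct_add; oc; ring.
rewrite !atrformE -sumrB; apply: eq_bigr => i _.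
by rewrite !mxE !ffunE oB; ring.
Qed.

Lemma sharp_unique x v :
  (forall y, atrform v y = anorm_lin x y) -> v = sharp x.
Proof.
move=> vP; apply/eqP; rewrite -subr_eq0; apply/eqP; apply: atrform_nd => y.
by rewrite atrformB vP sharpP subrr.
Qed.

Lemma sharpE x : sharp x = adj_mx x.
Proof. by apply/esym/sharp_unique => y; rewrite anorm_linE. Qed.

End AlbertTheory.

(* Algebras with involution.  The record is the raw data; is_invAlg holds the
   axioms. *)

Record invAlg (F : fieldType) := InvAlg {
  inv_carrier :> vectType F;
  inv_mul : inv_carrier -> inv_carrier -> inv_carrier;
  inv_one : inv_carrier;
  inv_bar : inv_carrier -> inv_carrier }.

Section InvAlg.
Variables (F : fieldType) (A : invAlg F).
Local Notation "x *' y" := (inv_mul x y) (at level 40, left associativity).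
Local Notation bar := (@inv_bar F A).

Definition is_invAlg : Prop :=
  [/\ forall x : A, linear (inv_mul x),
      forall y : A, linear (fun x => x *' y),
      left_id (inv_one A) (@inv_mul F A) /\ right_id (inv_one A) (@inv_mul F A),
      linear bar &
      involutive bar /\ forall x y : A, bar (x *' y) = bar y *' bar x].

Definition triple (x y z : A) : A :=
  (x *' bar y) *' z + (z *' bar y) *' x - (z *' bar x) *' y.

Definition U_ (e x : A) : A := triple e x e.

Definition singular (e : A) : Prop :=
  e != 0 /\ forall x, U_ e x \in <[e]>%VS.

Definition inner_ideal (I : {vspace A}) : Prop :=
  forall e, e \in I -> forall x, U_ e x \in I.

Definition singular_ideal (I : {vspace A}) : Prop :=
  forall e, e \in I -> e != 0 -> singular e.

(* c, if x = c *: 1 *)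
Definition scalar_part (x : A) : F := coord [tuple inv_one A] ord0 x.

Definition bform (s0 x y : A) : F :=
  scalar_part ((x *' bar y - y *' bar x) *' s0).

Definition tform (s0 y z w : A) : A :=
  2 *: triple y (s0 *' z) w
  - bform s0 z w *: y - bform s0 z y *: w - bform s0 y w *: z.

(* For a Brown algebra bform is nondegenerate, so such f are invertible. *)
Definition in_Inv (s0 : A) (f : 'End(A)) : Prop :=
  (forall x y, bform s0 (f x) (f y) = bform s0 x y) /\
  (forall x y z, tform s0 (f x) (f y) (f z) = f (tform s0 x y z)).

End InvAlg.

Definition inv_iso (F : fieldType) (A B : invAlg F) (h : 'Hom(A, B)) : Prop :=
  [/\ bijective h, forall x y, h (inv_mul x y) = inv_mul (h x) (h y) &
      forall x, h (inv_bar x) = inv_bar (h x)].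

(* Extension of scalars along iota : F -> K: the vector space A (x)_F K is
   modelled as K^n, by means of a basis of A over F. *)

Section ScalarExtension.
Variables (F K : fieldType) (iota : {rmorphism F -> K}) (A : invAlg F).

Let n := \dim {:A}.
Let e (i : 'I_n) : A := (vbasis {:A})`_i.

(* a |-> a (x) 1 *)
Definition ext_elt (a : A) : 'rV[K]_n :=
  \row_i iota (coord (vbasis {:A}) i a).

Definition ext_alg : invAlg K :=
  @InvAlg K 'rV[K]_n
    (fun x y => \sum_i \sum_j
       (x 0 i * y 0 j) *: ext_elt (inv_mul (e i) (e j)))
    (ext_elt (inv_one A))
    (fun x => \sum_i x 0 i *: ext_elt (inv_bar (e i))).

Definition ext_sub (I : {vspace A}) : {vspace ext_alg} :=
  <<[seq (ext_elt a : ext_alg) | a <- vbasis I]>>%VS.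

End ScalarExtension.

(* iota makes K a separable closure of F. *)
Definition separable_closure (F K : fieldType) (iota : {rmorphism F -> K}) :
  Prop :=
  (forall x : K, exists2 p : {poly F},
     separable_poly p & root (map_poly iota p) x) /\
  (forall p : {poly K}, separable_poly p -> (1 < size p)%N ->
     exists x, root p x).

(* The algebra B(J^d, F x F); ((alpha, j), (j', beta)) stands for
     | alpha  j    |
     | j'     beta | *)

Notation brown_mx F :=
  ((F^o * albert F) * (albert F * F^o))%type.

Section Brown.
Variable F : fieldType.

Definition brown_mul (x y : brown_mx F) : brown_mx F :=
  let: ((a1, j1), (k1, b1)) := x in
  let: ((a2, j2), (k2, b2)) := y in
  ((a1 * a2 + atrform j1 k2, a1 *: j2 + b2 *: j1 + across k1 k2),
   (a2 *: k1 + b1 *: k2 + across j1 j2, b1 * b2 + atrform j2 k1)).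

Definition brown_bar (x : brown_mx F) : brown_mx F :=
  let: ((a, j), (k, b)) := x in ((b, j), (k, a)).

Definition brown_split : invAlg F :=
  @InvAlg F (brown_mx F) brown_mul ((1, 0), (0, 1)) brown_bar.

(* the subspaces of the form | F 0 |
                             | V 0 | *)
Definition form_a (W : {vspace brown_split}) : Prop :=
  exists2 V : {vspace albert F}, totally_singular V &
  forall (a : F) (j k : albert F) (b : F),
    (((a, j), (k, b)) : brown_split) \in W <-> [/\ j = 0, k \in V & b = 0].

(* the subspaces of the form | F        F d |
                             | d x J    0   | *)
Definition form_b (W : {vspace brown_split}) : Prop :=
  exists2 d : albert F, d != 0 /\ sharp d = 0 &
  forall (a : F) (j k : albert F) (b : F),
    (((a, j), (k, b)) : brown_split) \in W <->
    [/\ j \in <[d]>%VS, (exists y, k = across d y) & b = 0].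

End Brown.

Definition is_brown (F K : fieldType) (iota : {rmorphism F -> K})
  (B : invAlg F) : Prop :=
  is_invAlg B /\
  exists h : 'Hom(ext_alg iota B, ext_alg iota (brown_split F)), inv_iso h.

(* Main.v *)
From HB Require Import structures.
From mathcomp Require Import all_boot all_order all_algebra all_field.
From mathcomp Require Import boolp ring.
Require Import Defs.

Set Implicit Arguments.
Unset Strict Implicit.
Unset Printing Implicit Defensive.

Import Order.TTheory GRing.Theory Num.Theory.
Local Open Scope ring_scope.

(** Elements of the split Brown algebra over a field K of characteristic other
than 2 and 3 are written (a, j; k, c), with a, c in K and j, k in the Albert
algebra J, and E stands for (1, 0; 0, 0).

Reduction to E. If u# = 0, the map D sending (a, j; k, c) to
(0, u x k; a u, T(j, u)) has square zero, is skew for the symplectic form b, and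
is a derivation of the symmetric trilinear product t. Therefore 1 + D belongs to
Inv ([raising_aut]), and so does its conjugate under the exchange of the two
diagonal entries ([lowering_aut]). The elements with u# = 0 span J, and these
unipotent maps already carry every singular element to a multiple of E
([singular_orbit]). So it is enough to treat a proper inner ideal W that
contains E.

Shape. Linearizing U at E shows that W = (K, J1; V, 0) for subspaces J1 and V of
J with J1 x J inside V, V# inside J1, T(J1, V) = 0 and J1# = 0 ([inner_bE]).

Dimension. The space J has 27 coordinates in which T(x x y, z) is a signed sum of
monomials, one for each ordering of each of the 45 lines of the generalized
quadrangle of order (2, 4) ([across_coord]). A weight that is injective on the 27
points and has sum zero on every line attaches to a subspace of J a set of leading
coordinates, as many as its dimension ([leadJ_ex], [leadD_ex]), and leading
coordinates multiply along the lines ([lead_mul]). This leaves finite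
combinatorics.
If J1 = 0, then V is totally singular, its leading coordinates are pairwise not
collinear, and such a set has at most 6 points ([totally_singular_dim]): this is
form (a). If J1 is not 0, with leading points A, and B are the leading points of
V, then A and B are disjoint, B contains all points collinear with a point of A,
and A contains the third point of every line that has two points in B. This forces
A to be one point and B to be its 10 neighbours, whence J1 = K d and V = d x J
([point_ideal]): this is form (b), of dimension 1 + 1 + 10. It is not singular,
since otherwise V would be a totally singular subspace of dimension 10.

Descent. Extension of scalars preserves dimension, properness and inner ideals.
It also preserves singular ideals: on singular elements U_e z is L(e) e for
a linear form L depending on z ([singularU]), and an identity of degree two that
holds on a vector space still holds after extension of scalars
([ext_singular_ideal]). Finally, extending the split Brown algebra from F to F_s
gives the split Brown algebra over F_s ([brown_split_base_change]); combined with
the isomorphism in the definition of a Brown algebra, this provides an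
identification to which the above applies. *)

(** * Linear and multilinear algebra *)

(** For equations that follow linearly from others: after [apply], what remains is
an identity for [ring]. *)
Lemma lincomb1 (R : zmodType) (x y a b : R) : a = b -> x - y = a - b -> x = y.
Proof. by move=> ->; rewrite subrr => /eqP; rewrite subr_eq0 => /eqP. Qed.

Lemma lincomb2 (R : zmodType) (x y a b a' b' : R) :
  a = b -> a' = b' -> x - y = (a - b) + (a' - b') -> x = y.
Proof. by move=> -> ->; rewrite !subrr addr0 => /eqP; rewrite subr_eq0 => /eqP. Qed.

Lemma lincomb3 (R : zmodType) (x y a b a' b' a2 b2 : R) : a = b -> a' = b' ->
  a2 = b2 -> x - y = (a - b) + (a' - b') + (a2 - b2) -> x = y.
Proof. by move=> -> -> ->; rewrite !subrr !addr0 => /eqP; rewrite subr_eq0 => /eqP. Qed.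

Lemma scalar_partZ (K : fieldType) (A : invAlg K) (c : K) : inv_one A != 0 ->
  scalar_part (c *: inv_one A) = c.
Proof.
move=> n1; rewrite /scalar_part linearZ /=.
have /(coord_free ord0 ord0) -> : free [tuple inv_one A] by rewrite seq1_free.
by rewrite mulr1.
Qed.

(** Linear maps are mostly given by formulas here; images, kernels and preimages need
them as elements of 'Hom. *)
Lemma linfunP (K : fieldType) (U V : vectType K) (f : U -> V) : linear f -> {g : 'Hom(U, V) | g =1 f}.
Proof.
move=> lf; pose m := GRing.isLinear.Build K U V *:%R f lf.
pose F : {linear U -> V} := HB.pack f m.
by exists (linfun F) => x; rewrite lfunE.
Qed.

(** Expanding f (x + y) (x + y) (x + y) and f (x - y) (x - y) (x - y) gives
6 f x y y = 0; linearizing in y gives 2 f x y z = 0. *)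
Lemma polarization (K : fieldType) (V W : lmodType K) (f : V -> V -> V -> W) :
  2%:R != 0 :> K -> 3%:R != 0 :> K ->
  (forall x y z, f x y z = f y x z) -> (forall x y z, f x y z = f x z y) ->
  (forall x x' y z, f (x + x') y z = f x y z + f x' y z) ->
  (forall x, f x x x = 0) -> forall x y z, f x y z = 0.
Proof.
move=> K2 K3 f12 f23 fD f0.
have fD2 x y y' z : f x (y + y') z = f x y z + f x y' z by rewrite !(f12 x) fD.
have fD3 x y z z' : f x y (z + z') = f x y z + f x y z' by rewrite f23 fD2 !(f23 x _ y).
have fN x y z : f (- x) y z = - f x y z.
  apply/eqP; rewrite -addr_eq0 -fD addNr -[0]addr0; apply/eqP.
  by apply: (addrI (f 0 y z)); rewrite -fD !addr0.
have inj2 (v : W) : v *+ 2 = 0 -> v = 0.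
  by rewrite -scaler_nat => /eqP; rewrite scaler_eq0 (negPf K2) => /eqP.
have inj3 (v : W) : v *+ 3 = 0 -> v = 0.
  by rewrite -scaler_nat => /eqP; rewrite scaler_eq0 (negPf K3) => /eqP.
have f1 x y : f x y y = 0.
  have E u v : f v u u *+ 3 + f u v v *+ 3 = 0.
    have := f0 (u + v); rewrite !fD !fD2 !fD3 !f0 (f12 u v u) (f23 u u v) (f12 u v u).
    rewrite (f23 v v u) (f12 v u v) !add0r !addr0 => <-.
    by rewrite !mulrS !mulr0n !addr0 !addrA (addrAC _ (f u v v) (f v u u)).
  have := E y (- x); have fN2 u v w : f u (- v) w = - f u v w by rewrite !(f12 u) fN.
  rewrite fN fN2 f23 fN2 opprK mulNrn => /eqP; rewrite addrC subr_eq0 => /eqP E1.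
  by apply/inj3/inj2; rewrite mulr2n -{1}E1 addrC E.
move=> x y z; apply: inj2; rewrite mulr2n.
by have := f1 x (y + z); rewrite fD2 !fD3 !f1 add0r addr0 (f23 x z).
Qed.

(** By polarization D is a derivation of t. Applying D twice more to the derivation
rule kills the terms of t (x + D x) (y + D y) (z + D z) in which D occurs at least
twice, as D o D = 0 and 2 and 3 are invertible. *)
Lemma derivation_exp (K : fieldType) (V : vectType K) (t : V -> V -> V -> V) (D : 'End(V)) :
  2%:R != 0 :> K -> 3%:R != 0 :> K ->
  (forall x y z, t x y z = t y x z) -> (forall x y z, t x y z = t x z y) ->
  (forall x x' y z, t (x + x') y z = t x y z + t x' y z) ->
  (forall c x y z, t (c *: x) y z = c *: t x y z) ->
  (forall x, D (D x) = 0) -> (forall x, 3 *: t (D x) x x = D (t x x x)) ->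
  forall x y z, t (x + D x) (y + D y) (z + D z) = t x y z + D (t x y z).
Proof.
move=> K2 K3 t12 t23 tD tZ DD Dt.
have tD2 x y y' z : t x (y + y') z = t x y z + t x y' z by rewrite !(t12 x) tD.
have tD3 x y z z' : t x y (z + z') = t x y z + t x y z'.
  by rewrite t23 tD2 !(t23 x _ y).
have t0 y z : t 0 y z = 0 by rewrite -(scale0r (0 : V)) tZ !scale0r.
have t02 y z : t y 0 z = 0 by rewrite t12 t0.
have t03 y z : t y z 0 = 0 by rewrite t23 t02.
have Der x y z : t (D x) y z + t x (D y) z + t x y (D z) - D (t x y z) = 0.
  apply: (@polarization K V V (fun x y z =>
    t (D x) y z + t x (D y) z + t x y (D z) - D (t x y z)) K2 K3) => {x y z}.
  - by move=> x y z; rewrite (t12 (D x)) (t12 x (D y)) !(t12 x y) [t y (D x) z + _]addrC.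
  - move=> x y z; rewrite !(t23 (D x) y) (t23 x y (D z)) (t23 x (D y) z) !(t23 x y z).
    by rewrite (addrAC (t (D x) z y)).
  - move=> x x' y z; rewrite linearD /= !tD linearD /= opprD; apply/esym.
    by rewrite addrACA; congr (_ + _); rewrite addrACA; congr (_ + _); rewrite addrACA.
  - move=> x; rewrite (t12 x (D x)) (t23 x x) (t12 x (D x)) -Dt.
    by rewrite (_ : 3 = 1 + 1 + 1 :> K) ?scalerDl ?scale1r ?subrr //; ring.
have {}Der x y z : D (t x y z) = t (D x) y z + t x (D y) z + t x y (D z).
  by apply/esym/eqP; rewrite -subr_eq0 Der.
have z2 (v : V) : v + v = 0 -> v = 0.
  by rewrite -mulr2n -scaler_nat => /eqP; rewrite scaler_eq0 (negPf K2) => /eqP.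
have z3 (v : V) : v + v + v = 0 -> v = 0.
  rewrite -mulr2n -mulrSr -scaler_nat => /eqP.
  by rewrite scaler_eq0 (negPf K3) => /eqP.
have Der2 x y z : t (D x) (D y) z + t (D x) y (D z) + t x (D y) (D z) = 0.
  have := DD (t x y z); rewrite Der !linearD /= !Der !DD !t0 !t02 !t03 ?add0r ?addr0.
  move=> E; apply: z2; rewrite -E.
  have AC (p q r : V) : p + q + r + (p + q + r) = p + q + (p + r) + (q + r).
    by rewrite -[RHS]addrA [p + r + _]addrACA [LHS]addrACA -[LHS]addrA.
  exact: AC.
have Der3 x y z : t (D x) (D y) (D z) = 0.
  have := congr1 D (Der2 x y z).
  by rewrite !linearD /= !Der !DD !t0 !t02 !t03 ?add0r ?addr0 linear0 => /z3.
move=> x y z; rewrite !tD !tD2 !tD3 Der3 addr0 Der.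
have := Der2 x y z.
move: (t (D x) (D y) z) (t (D x) y (D z)) (t x (D y) (D z)) => p q r E.
move: (t x y z) (t (D x) y z) (t x (D y) z) (t x y (D z)) => s0 s1 s2 s3.
by rewrite [LHS](AC (2*2*3) ((1*(5*3*2))*(7*6*4))) /= E addr0.
Qed.

(** * Octonions and the trilinear form of the Albert algebra *)

Lemma oct_opp (R : comNzRingType) (a : oct R) : - a = (- a.1, - a.2).
Proof. by []. Qed.

Ltac octE := rewrite ?(oct_add, oct_opp, oct_scale) /=; oring.

Section OctonionForms.
Variable R : comNzRingType.
Implicit Types (a b d : oct R) (c : R).

Lemma omulDl a a' b : omul (a + a') b = omul a b + omul a' b.
Proof. by octv a; octv a'; octv b; octE. Qed.

Lemma omulDr a b b' : omul a (b + b') = omul a b + omul a b'.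
Proof. by octv a; octv b; octv b'; octE. Qed.

Lemma omulZl c a b : omul (c *: a) b = c *: omul a b.
Proof. by octv a; octv b; octE. Qed.

Lemma omulZr c a b : omul a (c *: b) = c *: omul a b.
Proof. by octv a; octv b; octE. Qed.

Lemma otrD a b : otr (a + b) = otr a + otr b.
Proof. by rewrite /otr mxtraceD. Qed.

Lemma otrZ c a : otr (c *: a) = c * otr a.
Proof. by rewrite /otr mxtraceZ. Qed.

Lemma otr_conj_mulC a b : otr (omul a (oconj b)) = otr (omul b (oconj a)).
Proof. by octv a; octv b; oring. Qed.

Lemma otr_mulCA a b d : otr (omul (omul a b) d) = otr (omul (omul b d) a).
Proof. by octv a; octv b; octv d; oc; ring. Qed.

Lemma otr_mul_conj a b : otr (omul (oconj a) (oconj b)) = otr (omul a b).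
Proof. by octv a; octv b; oc; ring. Qed.

Lemma onormD a b : onorm (a + b) = onorm a + onorm b + otr (omul a (oconj b)).
Proof. by octv a; octv b; rewrite ?oct_add /=; oc; ring. Qed.

Lemma onormZ c a : onorm (c *: a) = c ^+ 2 * onorm a.
Proof. by octv a; rewrite oct_scale; oc; ring. Qed.

Lemma onorm_conj a : onorm (oconj a) = onorm a.
Proof. by octv a; oc; ring. Qed.

Lemma onormM a b : onorm (omul a b) = onorm a * onorm b.
Proof. by octv a; octv b; oc; ring. Qed.

Lemma omulNl a b : omul (- a) b = - omul a b.
Proof. by rewrite -scaleN1r omulZl scaleN1r. Qed.

Lemma otrN a : otr (- a) = - otr a.
Proof. by rewrite -scaleN1r otrZ mulN1r. Qed.

Lemma omul_conj_cancel a b : oconj (omul (oconj (omul a b)) a) = onorm a *: b.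
Proof. by octv a; octv b; octE. Qed.

Lemma omul_conj_cancelr a b : oconj (omul b (oconj (omul a b))) = onorm b *: a.
Proof. by octv a; octv b; octE. Qed.

(** With the two cancellation rules above, the identities of alternative algebras on
which [sharp_sharp] rests. *)
Lemma omul_moufang a b d : oconj (omul (oconj (omul d a)) (oconj (omul a b))) =
  otr (omul (omul a b) d) *: a - onorm a *: oconj (omul b d).
Proof. by octv a; octv b; octv d; octE. Qed.

End OctonionForms.

Section AlbertIdentities.
Variable K : fieldType.
Hypothesis K2 : 2%:R != 0 :> K.
Implicit Types (x y z : albert K) (c : K).

Local Notation T := (@atrform K).

Lemma atrformC x y : T x y = T y x.
Proof.
rewrite !atrformE //; apply: eq_bigr => i _; rewrite mulrC; congr (_ + _).
by move: (x.2 i) (y.2 i) => a b; octv a; octv b; oring.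
Qed.

Lemma atrformDl x x' y : T (x + x') y = T x y + T x' y.
Proof.
have oD (a b c : oct K) : otr (omul (a + b) c) = otr (omul a c) + otr (omul b c).
  by octv a; octv b; octv c; rewrite oct_add; oc; ring.
rewrite !atrformE // -big_split; apply: eq_bigr => i _.
by rewrite !mxE !ffunE oD /=; ring.
Qed.

Lemma atrformZl c x y : T (c *: x) y = c * T x y.
Proof.
have oZ (a b : oct K) : otr (omul (c *: a) b) = c * otr (omul a b).
  by octv a; octv b; rewrite oct_scale; oc; ring.
rewrite !atrformE // big_distrr; apply: eq_bigr => i _.
by rewrite !mxE !ffunE oZ /=; ring.
Qed.

Lemma acrossE x y : across x y =
  (\row_i (x.1 0 (i+1) * y.1 0 (i+1+1) + y.1 0 (i+1) * x.1 0 (i+1+1)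
           - otr (omul (x.2 i) (oconj (y.2 i)))),
   [ffun i => oconj (omul (x.2 (i+1)) (y.2 (i+1+1)) + omul (y.2 (i+1)) (x.2 (i+1+1)))
              - x.1 0 i *: y.2 i - y.1 0 i *: x.2 i]).
Proof.
rewrite /across !sharpE //; congr pair.
  by apply/rowP=> i; rewrite !mxE !ffunE onormD; ring.
apply/ffunP=> i; rewrite !ffunE !mxE.
move: (x.2 i) (x.2 (i+1)) (x.2 (i+1+1)) (y.2 i) (y.2 (i+1)) (y.2 (i+1+1)).
move: (x.1 0 i) (y.1 0 i) => r s a b c d e f.
rewrite omulDl !omulDr !oconjD //.
move: (omul b c) (omul b f) (omul e c) (omul e f) => p q p' q'.
by octv p; octv q; octv p'; octv q'; octv a; octv d; octE.
Qed.

#[local] Opaque otr omul oconj onorm.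

(** The full polarization of the norm, with the octonion products moved into the
cyclic trilinear form otr (ab)c. *)
Lemma across_form x y z : T (across x y) z =
  \sum_i (x.1 0 i * (y.1 0 (i+1) * z.1 0 (i+1+1) + z.1 0 (i+1) * y.1 0 (i+1+1)
                     - otr (omul (y.2 i) (oconj (z.2 i))))
        - y.1 0 i * otr (omul (z.2 i) (oconj (x.2 i)))
        - z.1 0 i * otr (omul (x.2 i) (oconj (y.2 i)))
        + otr (omul (omul (x.2 i) (y.2 (i+1))) (z.2 (i+1+1)))
        + otr (omul (omul (x.2 i) (z.2 (i+1))) (y.2 (i+1+1)))).
Proof.
rewrite atrformE // acrossE !sum3 /= !mxE !ffunE ?ord3E.
move: (x.1 0 0) (x.1 0 1) (x.1 0 (1+1)) (y.1 0 0) (y.1 0 1) (y.1 0 (1+1)) => x0 x1 x2 y0 y1 y2.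
move: (z.1 0 0) (z.1 0 1) (z.1 0 (1+1)) => z0 z1 z2.
move: (x.2 0) (x.2 1) (x.2 (1+1)) (y.2 0) (y.2 1) (y.2 (1+1)) => a0 a1 a2 b0 b1 b2.
move: (z.2 0) (z.2 1) (z.2 (1+1)) => c0 c1 c2.
have E (a b a' b' e f g : oct K) (r s : K) :
  otr (omul (oconj (omul a b + omul a' b') - r *: e - s *: f) (oconj g)) =
  otr (omul (omul a b) g) + otr (omul (omul a' b') g)
  - r * otr (omul e (oconj g)) - s * otr (omul f (oconj g)).
  by rewrite !omulDl !omulNl !omulZl !otrD !otrN !otrZ otr_mul_conj omulDl otrD.
have C := @otr_conj_mulC K; have A := @otr_mulCA K; move: E C A.
move: (@omul K) (@oconj K) (@otr K) => m cj t E C A.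
rewrite !E (C a0 c0) (C a1 c1) (C a2 c2) (A b1 a2) (A b2 a0) (A b0 a1); ring.
Qed.

(** The norm is invariant under the cyclic shift of the indices; the entries of the
adjoint are written relative to an index i. *)
Lemma anorm_cyc x i : anorm x =
  x.1 0 i * x.1 0 (i+1) * x.1 0 (i+1+1)
  - (x.1 0 i * onorm (x.2 i) + x.1 0 (i+1) * onorm (x.2 (i+1))
     + x.1 0 (i+1+1) * onorm (x.2 (i+1+1)))
  + otr (omul (omul (x.2 i) (x.2 (i+1))) (x.2 (i+1+1))).
Proof.
have A := @otr_mulCA K; rewrite /anorm prod3 (sum3i i).
(* The products are generalized, so that [ord3E] acts on the indices alone. *)
move: (@omul K) (@otr K) (@onorm K) A => m t n A.
case: (I3P i) => ->; rewrite ?ord3E; first by [].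
  by rewrite -(A (x.2 0)); ring.
by rewrite (A (x.2 (1+1))); ring.
Qed.

Lemma sharp_sharp x : sharp (sharp x) = anorm x *: x.
Proof.
rewrite !sharpE //; case: x => u a; rewrite {1}/adj_mx; congr pair.
  apply/rowP=> i; rewrite !mxE (anorm_cyc _ i) /= ?mxE ?ffunE ?ord3E.
  move: (u 0 i) (u 0 (i+1)) (u 0 (i+1+1)) (a i) (a (i+1)) (a (i+1+1)) => r s t b c d.
  rewrite -scaleNr onormD onormZ onorm_conj onormM oconjZ // omulZr otrZ otr_mul_conj.
  rewrite (otr_mulCA b).
  by move: (onorm b) (onorm c) (onorm d) (otr _) => nb nc nd p; ring.
apply/ffunP=> i; rewrite !ffunE  (anorm_cyc _ i) /= ?mxE ?ffunE ?ord3E.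
move: (u 0 i) (u 0 (i+1)) (u 0 (i+1+1)) (a i) (a (i+1)) (a (i+1+1)) => r s t b c d.
have E (p q : oct K) (v w : K) :
  oconj (omul (oconj p - v *: c) (oconj q - w *: d)) =
  oconj (omul (oconj p) (oconj q)) - w *: oconj (omul (oconj p) d)
  - v *: oconj (omul c (oconj q)) + (v * w) *: oconj (omul c d).
  rewrite -!scaleNr omulDl !omulDr !omulZl !omulZr !oconjD // !oconjZ // scalerA.
  by rewrite mulrNN -!addrA.
rewrite E omul_moufang omul_conj_cancel omul_conj_cancelr.
move: (onorm b) (onorm c) (onorm d) (otr _) (oconj _) => n1 n2 n3 q e.
clear; octv b; octv e; octE.
Qed.

End AlbertIdentities.

(** * The adjoint and the norm of the Albert algebra *)

Definition polar (V W : zmodType) (s : V -> W) x y := s (x + y) - s x - s y.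

Lemma polarK (V W : zmodType) (s : V -> W) x y :
  s (x + y) = s x + polar s x y + s y.
Proof. by rewrite /polar [s x + _]addrC [_ - s x - _]addrAC !subrK. Qed.

Section AlbertNorm.
Variable K : fieldType.
Hypothesis K2 : 2%:R != 0 :> K.
Implicit Types (x y z : albert K) (c : K).

Local Notation T := (@atrform K).
Local Notation N := (@anorm K).
Local Infix "**" := across (at level 40).

Lemma across_cyc x y z : T (x ** y) z = T (y ** z) x.
Proof.
rewrite [LHS](across_form K2) [RHS](across_form K2) !sum3 ?ord3E.
have C := @otr_conj_mulC K; have A := @otr_mulCA K; move: C A.
move: (x.2 0) (x.2 1) (x.2 (1+1)) (y.2 0) (y.2 1) (y.2 (1+1)) => a0 a1 a2 b0 b1 b2.
move: (z.2 0) (z.2 1) (z.2 (1+1)) => c0 c1 c2.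
move: (@omul K) (@oconj K) (@otr K) => m cj t C A.
rewrite -(A a2 b0) -(A a0 b1) -(A a1 b2) (A b0 a1) (A b1 a2) (A b2 a0); ring.
Qed.

Lemma sharpZ c x : sharp (c *: x) = c ^+ 2 *: sharp x.
Proof.
rewrite !(sharpE K2) /adj_mx; case: x => u a; congr pair.
  by apply/rowP => i; rewrite !mxE !ffunE onormZ; ring.
apply/ffunP => i; rewrite !ffunE !mxE.
move: (u 0 i) (a i) (a (i+1)) (a (i+1+1)) => r b d e.
by rewrite omulZl omulZr; move: (omul d e) => p; octv b; octv p; octE.
Qed.

Lemma anormD x y : N (x + y) = N x + T (sharp x) y + T (sharp y) x + N y.
Proof.
rewrite !(sharpE K2) !(atrformE K2) /anorm !prod3 !sum3 /= !mxE !ffunE ?ord3E.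
move: (x.1 0 0) (x.1 0 1) (x.1 0 (1+1)) (y.1 0 0) (y.1 0 1) (y.1 0 (1+1)).
move: (x.2 0) (x.2 1) (x.2 (1+1)) (y.2 0) (y.2 1) (y.2 (1+1)).
move=> a0 a1 a2 b0 b1 b2 x0 x1 x2 y0 y1 y2.
have E (a b d e : oct K) (r : K) : otr (omul (oconj (omul a b) - r *: d) (oconj e)) =
    otr (omul (omul a b) e) - r * otr (omul d (oconj e)).
  by rewrite omulDl -scaleNr omulZl otrD otrZ otr_mul_conj mulNr.
have Dl := @omulDl K; have Dr := @omulDr K; have D := @otrD K; have nD := @onormD K.
have C := @otr_conj_mulC K; have A := @otr_mulCA K; move: E Dl Dr D nD C A.
move: (@omul K) (@oconj K) (@otr K) (@onorm K) => m cj t n E Dl Dr D nD C A.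
rewrite !E !nD Dl !Dr !Dl !D !(C _ a0) !(C _ a1) !(C _ a2).
rewrite -(A b0 a1) (A a2 a0) -(A a0 b1) (A b2 b0).
ring.
Qed.

Lemma anormZ c x : N (c *: x) = c ^+ 3 * N x.
Proof.
rewrite /anorm !prod3 !sum3 /= !mxE !ffunE !onormZ omulZl !omulZr !omulZl !otrZ.
move: (onorm _) (onorm _) (onorm _) (otr _) => n0 n1 n2 t.
by ring.
Qed.

End AlbertNorm.

(** * Cubic norm structures *)

(** The laws of the Albert algebra from which the shape of an inner ideal follows.
The operations are variables in these computations, so that nothing unfolds to
coordinates. *)
Record cubic_norm_structure (K : fieldType) (J : lmodType K)
    (T : J -> J -> K) (mu : J -> J -> J) (sh : J -> J) (N : J -> K) : Prop := CubicNormStructure {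
  cns_TC : forall x y, T x y = T y x;
  cns_TD : forall x x' y, T (x + x') y = T x y + T x' y;
  cns_TZ : forall c x y, T (c *: x) y = c * T x y;
  cns_nd : forall x, (forall y, T x y = 0) -> x = 0;
  cns_shZ : forall c x, sh (c *: x) = c ^+ 2 *: sh x;
  cns_shD : forall x y, sh (x + y) = sh x + mu x y + sh y;
  cns_cyc : forall x y z, T (mu x y) z = T (mu y z) x;
  cns_ND : forall x y, N (x + y) = N x + T (sh x) y + T (sh y) x + N y;
  cns_NZ : forall c x, N (c *: x) = c ^+ 3 * N x;
  cns_shsh : forall x, sh (sh x) = N x *: x }.

Lemma albert_cns (K : fieldType) : 2%:R != 0 :> K ->
  cubic_norm_structure (@atrform K) (@across K) (@sharp K) (@anorm K).
Proof.
move=> K2; split.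
- exact: atrformC K2.
- exact: atrformDl K2.
- exact: atrformZl K2.
- exact: atrform_nd K2.
- exact: sharpZ K2.
- exact: polarK.
- exact: across_cyc K2.
- exact: anormD K2.
- exact: anormZ.
- exact: sharp_sharp K2.
Qed.

Section CubicNormStructure.
Variables (K : fieldType) (J : vectType K).
Variables (T : J -> J -> K) (mu : J -> J -> J) (sh : J -> J) (N : J -> K).
Hypothesis K2 : 2%:R != 0 :> K.
Hypothesis K3 : 3%:R != 0 :> K.
Hypothesis cnsJ : cubic_norm_structure T mu sh N.
Implicit Types (x y z w : J) (c : K).

Local Infix "**" := mu (at level 40, left associativity).

Definition TC := cns_TC cnsJ.
Definition TDl := cns_TD cnsJ.
Definition TZl := cns_TZ cnsJ.

Lemma TDr x y z : T x (y + z) = T x y + T x z.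
Proof. by rewrite TC TDl !(TC x). Qed.
Lemma TZr c x y : T x (c *: y) = c * T x y.
Proof. by rewrite TC TZl (TC x). Qed.
Lemma TNl x y : T (- x) y = - T x y.
Proof. by rewrite -scaleN1r TZl mulN1r. Qed.
Lemma TNr x y : T x (- y) = - T x y.
Proof. by rewrite -scaleN1r TZr mulN1r. Qed.
Lemma T0l x : T 0 x = 0.
Proof. by rewrite -(scale0r (0 : J)) TZl mul0r. Qed.
Lemma T0r x : T x 0 = 0.
Proof. by rewrite TC T0l. Qed.
Lemma trace_suml (I : Type) (s : seq I) (a : I -> K) (v : I -> J) z :
  T (\sum_(i <- s) a i *: v i) z = \sum_(i <- s) a i * T (v i) z.
Proof.
elim: s => [|i s IH]; first by rewrite !big_nil T0l.
by rewrite !big_cons TDl TZl IH.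
Qed.

Definition TE := (TDl, TDr, TZl, TZr, TNl, TNr, T0l, T0r).

(** Equations in J are proved by pairing both sides with an arbitrary element, which
turns them into equations in K. *)
Lemma cns_inj x y : (forall z, T x z = T y z) -> x = y.
Proof.
move=> H; apply/eqP; rewrite -subr_eq0; apply/eqP/(cns_nd cnsJ) => z.
by rewrite TDl TNl H subrr.
Qed.

Definition sharpD := cns_shD cnsJ.

Lemma muC x y : x ** y = y ** x.
Proof.
apply: (addrI (sh x)); apply: (addIr (sh y)).
by rewrite -sharpD addrC sharpD addrAC [RHS]addrAC [sh y + _]addrC.
Qed.

Lemma mu_cyc x y z : T (x ** y) z = T (y ** z) x. Proof. exact: cns_cyc cnsJ x y z. Qed.

Lemma mu_adj x y z : T (x ** y) z = T x (y ** z).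
Proof. by rewrite mu_cyc TC. Qed.

Lemma mDl x y z : (x + y) ** z = x ** z + y ** z.
Proof. by apply: cns_inj => w; rewrite TDl !mu_adj TDl. Qed.
Lemma mZl c x y : (c *: x) ** y = c *: (x ** y).
Proof. by apply: cns_inj => w; rewrite TZl !mu_adj TZl. Qed.
Lemma mDr x y z : x ** (y + z) = x ** y + x ** z.
Proof. by rewrite muC mDl !(muC x). Qed.
Lemma mZr c x y : x ** (c *: y) = c *: (x ** y).
Proof. by rewrite muC mZl (muC x). Qed.
Lemma mNl x y : (- x) ** y = - (x ** y).
Proof. by rewrite -scaleN1r mZl scaleN1r. Qed.
Lemma mNr x y : x ** (- y) = - (x ** y).
Proof. by rewrite -scaleN1r mZr scaleN1r. Qed.
Lemma m0l x : 0 ** x = 0.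
Proof. by rewrite -(scale0r (0 : J)) mZl !scale0r. Qed.
Lemma m0r x : x ** 0 = 0.
Proof. by rewrite muC m0l. Qed.
Definition mE := (mDl, mDr, mZl, mZr, mNl, mNr, m0l, m0r).

Lemma sharp_opp x : sh (- x) = sh x.
Proof. by rewrite -scaleN1r (cns_shZ cnsJ) sqrrN expr1n scale1r. Qed.
Lemma mu_diag x : x ** x = 2 *: sh x.
Proof.
have := sharpD x x; rewrite -mulr2n -scaler_nat (cns_shZ cnsJ) => E.
apply: (addrI (sh x)); apply: (addIr (sh x)); rewrite -E.
by rewrite -[sh x in RHS]scale1r scalerA -!scalerDl; congr (_ *: _); ring.
Qed.

Lemma trace_sharp x : T (sh x) x = 3 * N x.
Proof.
have := cns_ND cnsJ x x; rewrite -mulr2n -scaler_nat (cns_NZ cnsJ) => E.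
by apply: (mulfI K2); apply: (lincomb1 (esym E)); ring.
Qed.

Lemma scal_inj c x y : c != 0 -> c *: x = c *: y -> x = y.
Proof. by move=> c0 /(congr1 ( *:%R c^-1)); rewrite !scalerA mulVf ?scale1r. Qed.

(** Coefficient of s^2 t^2 in (s x + t y)## = N(s x + t y) (s x + t y). *)
Lemma adjoint22 x y :
  sh x ** sh y + sh (x ** y) = T (sh x) y *: y + T (sh y) x *: x.
Proof.
have H (a b : J) : sh a ** (a ** b) + (sh a ** sh b + sh (a ** b)) + (a ** b) ** sh b
   = N a *: b + T (sh a) b *: a + (T (sh a) b *: b + T (sh b) a *: a)
   + (N b *: a + T (sh b) a *: b).
  have := cns_shsh cnsJ (a + b); rewrite (cns_ND cnsJ) !sharpD !(cns_shsh cnsJ) mDl => E.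
  apply: cns_inj => z; have := congr1 (T^~ z) E; rewrite !TE => {}E; apply: (lincomb1 E); ring.
(* H x y + H x (- y) is twice the part of even degree in y. *)
have H1 := H x y; have H2 := H x (- y); apply: (scal_inj K2); apply: cns_inj => z.
have NN a : N (- a) = - N a by rewrite -scaleN1r (cns_NZ cnsJ) -[(-1) ^+ 3]signr_odd mulN1r.
have := congr1 (T^~ z) H1; have := congr1 (T^~ z) H2.
rewrite !sharp_opp NN !(TE, mE) sharp_opp => {}H2 {}H1.
apply: (lincomb2 H1 H2); ring.
Qed.

Lemma adjoint22_lin x y z :
  sh x ** (y ** z) + (x ** y) ** (x ** z) =
  T (sh x) y *: z + T (sh x) z *: y + T (y ** z) x *: x.
Proof.
have := adjoint22 x (y + z); rewrite !sharpD !(mE, sharpD) => E.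
apply: cns_inj => w; have := congr1 (T^~ w) E.
have := congr1 (T^~ w) (adjoint22 x y); have := congr1 (T^~ w) (adjoint22 x z).
rewrite !TE => E2 E1 E3; apply: (lincomb3 E3 (esym E1) (esym E2)); ring.
Qed.

(** For the arguments x, x, y both sides of [adjoint22_lin] are three times those below. *)
Lemma sharp_mu_mu x y : sh x ** (x ** y) = N x *: y + T (sh x) y *: x.
Proof.
have := adjoint22_lin x x y.
rewrite (mu_cyc x y x) (mu_cyc y x x) mu_diag mZl TZl trace_sharp => E.
apply: (scal_inj K3); apply: cns_inj => z; have := congr1 (T^~ z) E.
by rewrite !TE => {}E; apply: (lincomb1 E); ring.
Qed.

(** The transpose of [adjoint22_lin] with respect to the trace form. *)
Lemma adjoint_dual (u k j : J) :
  u ** (sh k ** j) + k ** ((u ** k) ** j) =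
  T (sh k) u *: j + T j u *: sh k + T j k *: (u ** k).
Proof.
apply: cns_inj => z; have := congr1 (T j) (adjoint22_lin k u z); rewrite !TE => E.
have A a b : T (a ** (b ** j)) z = T j (b ** (a ** z)).
  by rewrite (muC a) mu_adj (muC b j) mu_adj.
rewrite (mu_cyc u) (mu_cyc z) (muC k u) in E.
by rewrite !A; apply: (lincomb1 E); ring.
Qed.

(** * The Brown algebra of a cubic norm structure *)

(** An algebra with involution together with its four coordinates. The product
formula enters only through these equations, so that the kernel never has to
unfold a concrete product while it compares terms. *)
Record brown_frame (B : invAlg K) (bm : K -> J -> J -> K -> B)
    (cA : B -> K) (cJ cK : B -> J) (cB : B -> K) : Prop := BrownFrame {
  bf_K : forall x : B, bm (cA x) (cJ x) (cK x) (cB x) = x;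
  bf_cA : forall a j k b, cA (bm a j k b) = a;
  bf_cJ : forall a j k b, cJ (bm a j k b) = j;
  bf_cK : forall a j k b, cK (bm a j k b) = k;
  bf_cB : forall a j k b, cB (bm a j k b) = b;
  bf_D : forall a j k b a' j' k' b',
    bm a j k b + bm a' j' k' b' = bm (a + a') (j + j') (k + k') (b + b');
  bf_Z : forall c a j k b, c *: bm a j k b = bm (c * a) (c *: j) (c *: k) (c * b);
  bf_M : forall a j k b a' j' k' b', inv_mul (bm a j k b) (bm a' j' k' b') =
    bm (a * a' + T j k') (a *: j' + b' *: j + k ** k')
       (a' *: k + b *: k' + j ** j') (b * b' + T j' k);
  bf_bar : forall a j k b, inv_bar (bm a j k b) = bm b j k a;
  bf_one : inv_one B = bm 1 0 0 1 }.

Variables (B : invAlg K) (bm : K -> J -> J -> K -> B).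
Variables (cA : B -> K) (cJ cK : B -> J) (cB : B -> K).
Hypothesis frameB : brown_frame bm cA cJ cK cB.

(** A generator of the skew elements, playing the role of s_0. *)
Definition skew1 : B := bm 1 0 0 (-1).

Definition bmD := bf_D frameB.
Definition bmZ := bf_Z frameB.
Definition bmM := bf_M frameB.
Definition bm_bar := bf_bar frameB.
Definition bm_one := bf_one frameB.

Lemma bmP (x : B) : exists a j k b, x = bm a j k b.
Proof. by exists (cA x), (cJ x), (cK x), (cB x); rewrite (bf_K frameB). Qed.

Lemma bm_inj a j k b a' j' k' b' : bm a j k b = bm a' j' k' b' ->
  [/\ a = a', j = j', k = k' & b = b'].
Proof.
move=> E; split.
- by have := congr1 cA E; rewrite !(bf_cA frameB).
- by have := congr1 cJ E; rewrite !(bf_cJ frameB).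
- by have := congr1 cK E; rewrite !(bf_cK frameB).
- by have := congr1 cB E; rewrite !(bf_cB frameB).
Qed.

Lemma bmN a j k b : - bm a j k b = bm (- a) (- j) (- k) (- b).
Proof. by rewrite -scaleN1r bmZ !scaleN1r !mulN1r. Qed.

Lemma bm0 : 0 = bm 0 0 0 0.
Proof. by rewrite -(scale0r (bm 0 0 0 0)) bmZ !scale0r !mul0r. Qed.

Lemma bm_eq a j k b a' j' k' b' : a = a' -> j = j' -> k = k' -> b = b' ->
  bm a j k b = bm a' j' k' b'.
Proof. by move=> -> -> -> ->. Qed.

Definition bmE := (bmM, bm_bar, bmD, bmN, bmZ).

Lemma skew1_mul a j k b : inv_mul skew1 (bm a j k b) = bm a j (- k) (- b).
Proof.
rewrite bmM !TE !mE !scaler0 scale1r scaleN1r.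
by apply: bm_eq; rewrite ?add0r ?addr0 ?mul1r ?mulN1r.
Qed.

Lemma trace_mu_self x y : T (x ** y) x = 2 * T (sh x) y.
Proof. by rewrite muC mu_adj mu_diag TZr TC. Qed.

Lemma U_bm a j k b p q r s : U_ (bm a j k b) (bm p q r s) =
  bm (2 * a ^+ 2 * s + 2 * a * T q k + (T j k - a * b) * p + 2 * T (sh k) r)
     ((2 * T j r + 2 * b * p) *: j + (a * b - T j k) *: q + (2 * b) *: (k ** r)
      + (2 * s) *: sh k + 2 *: ((j ** q) ** k) - 2 *: (sh j ** r))
     ((2 * T k q + 2 * a * s) *: k + (a * b - T j k) *: r + (2 * a) *: (j ** q)
      + (2 * p) *: sh j + 2 *: ((k ** r) ** j) - 2 *: (sh k ** q))
     (2 * b ^+ 2 * p + 2 * b * T r j + (T j k - a * b) * s + 2 * T (sh j) q).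
Proof.
rewrite /U_ /triple !bmE !(TE, mE, mu_diag).
apply: bm_eq.
- by rewrite trace_mu_self; ring.
- by apply: cns_inj => z; rewrite !TE (muC r k); ring.
- by apply: cns_inj => z; rewrite !TE (TC q k) (muC q j); ring.
- by rewrite (TC j (_ ** _)) trace_mu_self (TC q k) (TC r j) (TC q (sh j)); ring.
Qed.

Lemma bform_bm a1 j1 k1 b1 a2 j2 k2 b2 :
  bform skew1 (bm a1 j1 k1 b1) (bm a2 j2 k2 b2) =
  a1 * b2 - b1 * a2 + T j1 k2 - T k1 j2.
Proof.
have n1 : inv_one B != 0 by rewrite bm_one; rewrite bm0; apply/eqP => /bm_inj[/eqP]; rewrite oner_eq0.
rewrite -[RHS](scalar_partZ _ n1) /bform; congr scalar_part.
rewrite bm_one !bmE !(TE, mE, mu_diag); apply: bm_eq.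
- by rewrite (TC j2); ring.
- apply: cns_inj => z; rewrite !TE (muC k2); ring.
- apply: cns_inj => z; rewrite !TE (muC j2); ring.
- by rewrite (TC j2) (TC k1); ring.
Qed.

Lemma bm_tripleE a1 j1 k1 b1 a2 j2 k2 b2 a3 j3 k3 b3 :
  bm a1 j1 k1 b1 + bm a2 j2 k2 b2 - bm a3 j3 k3 b3 =
  bm (a1 + a2 - a3) (j1 + j2 - j3) (k1 + k2 - k3) (b1 + b2 - b3).
Proof. by rewrite bmN !bmD. Qed.

Lemma bm_tformE c0 c1 c2 c3 a0 j0 k0 b0 a1 j1 k1 b1 a2 j2 k2 b2 a3 j3 k3 b3 :
  c0 *: bm a0 j0 k0 b0 - c1 *: bm a1 j1 k1 b1 - c2 *: bm a2 j2 k2 b2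
  - c3 *: bm a3 j3 k3 b3 =
  bm (c0 * a0 - c1 * a1 - c2 * a2 - c3 * a3)
     (c0 *: j0 - c1 *: j1 - c2 *: j2 - c3 *: j3)
     (c0 *: k0 - c1 *: k1 - c2 *: k2 - c3 *: k3)
     (c0 * b0 - c1 * b1 - c2 * b2 - c3 * b3).
Proof. by rewrite !bmZ !bmN !bmD. Qed.

Ltac canon k1 k2 k3 j1 j2 j3 :=
  rewrite ?(TC k1 j1, TC k1 j2, TC k1 j3, TC k2 j1, TC k2 j2, TC k2 j3, TC k3 j1, TC k3 j2, TC k3 j3);
  rewrite ?(muC k2 k1, muC k3 k1, muC k3 k2, muC j2 j1, muC j3 j1, muC j3 j2).

(** The symmetry of t, which its definition hides, is visible in this formula; so is
its invariance up to sign under the exchange of the diagonal entries. *)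
Lemma tform_bm a1 j1 k1 b1 a2 j2 k2 b2 a3 j3 k3 b3 :
  tform skew1 (bm a1 j1 k1 b1) (bm a2 j2 k2 b2) (bm a3 j3 k3 b3) =
  bm (a1 * (T j2 k3 + T j3 k2) + a2 * (T j1 k3 + T j3 k1) + a3 * (T j1 k2 + T j2 k1)
      - 2 * (a1 * a2 * b3 + a1 * b2 * a3 + b1 * a2 * a3) - 2 * T (k1 ** k2) k3)
     ((a2 * b3 + a3 * b2 - T j2 k3 - T j3 k2) *: j1
      + (a1 * b3 + a3 * b1 - T j1 k3 - T j3 k1) *: j2
      + (a1 * b2 + a2 * b1 - T j1 k2 - T j2 k1) *: j3
      - (2 * b1) *: (k2 ** k3) - (2 * b2) *: (k1 ** k3) - (2 * b3) *: (k1 ** k2)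
      + 2 *: ((j2 ** j3) ** k1) + 2 *: ((j1 ** j3) ** k2) + 2 *: ((j1 ** j2) ** k3))
     (- ((a2 * b3 + a3 * b2 - T j2 k3 - T j3 k2) *: k1
      + (a1 * b3 + a3 * b1 - T j1 k3 - T j3 k1) *: k2
      + (a1 * b2 + a2 * b1 - T j1 k2 - T j2 k1) *: k3
      - (2 * a1) *: (j2 ** j3) - (2 * a2) *: (j1 ** j3) - (2 * a3) *: (j1 ** j2)
      + 2 *: ((k2 ** k3) ** j1) + 2 *: ((k1 ** k3) ** j2) + 2 *: ((k1 ** k2) ** j3)))
     (- (b1 * (T j2 k3 + T j3 k2) + b2 * (T j1 k3 + T j3 k1) + b3 * (T j1 k2 + T j2 k1)
      - 2 * (b1 * b2 * a3 + b1 * a2 * b3 + a1 * b2 * b3) - 2 * T (j1 ** j2) j3)).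
Proof.
rewrite /tform !bform_bm /triple skew1_mul !bm_bar !bmM bm_tripleE bm_tformE !(TE, mE).
apply: bm_eq.
- canon k1 k2 k3 j1 j2 j3; rewrite (mu_cyc k2 k3 k1) (muC k1 k3) (mu_cyc k3 k1 k2); ring.
- canon k1 k2 k3 j1 j2 j3; apply: cns_inj => z; rewrite !TE; ring.
- canon k1 k2 k3 j1 j2 j3; apply: cns_inj => z; rewrite !TE; ring.
- canon k1 k2 k3 j1 j2 j3; rewrite (TC j3 (_ ** _)) (TC j2 (_ ** _)) (TC j1 (_ ** _)).
  rewrite (mu_cyc j2 j3 j1) (muC j1 j3) (mu_cyc j3 j1 j2); ring.
Qed.

(** * The trilinear product and its derivations *)

Local Notation t := (tform skew1).
Local Notation b := (bform skew1).

Lemma tform12 (x y z : B) : t x y z = t y x z.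
Proof.
have [a1 [j1 [k1 [b1 ->]]]] := bmP x; have [a2 [j2 [k2 [b2 ->]]]] := bmP y.
have [a3 [j3 [k3 [b3 ->]]]] := bmP z.
rewrite !tform_bm (muC j2 j1) (muC k2 k1); apply: bm_eq; try ring.
- by apply: cns_inj => w; rewrite !TE; ring.
- by apply: cns_inj => w; rewrite !TE; ring.
Qed.

Lemma tform23 (x y z : B) : t x y z = t x z y.
Proof.
have [a1 [j1 [k1 [b1 ->]]]] := bmP x; have [a2 [j2 [k2 [b2 ->]]]] := bmP y.
have [a3 [j3 [k3 [b3 ->]]]] := bmP z.
have S (p q r : J) : T (p ** q) r = T (p ** r) q by rewrite !mu_adj (muC q).
rewrite !tform_bm (muC j3 j2) (muC k3 k2) (S k1 k3) (S j1 j3).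
apply: bm_eq; try ring.
- by apply: cns_inj => w; rewrite !TE; ring.
- by apply: cns_inj => w; rewrite !TE; ring.
Qed.

Lemma tformD (x x' y z : B) : t (x + x') y z = t x y z + t x' y z.
Proof.
have [a1 [j1 [k1 [b1 ->]]]] := bmP x; have [a2 [j2 [k2 [b2 ->]]]] := bmP y.
have [a3 [j3 [k3 [b3 ->]]]] := bmP z; have [a4 [j4 [k4 [b4 ->]]]] := bmP x'.
rewrite bmD !tform_bm bmD !(TE, mE); apply: bm_eq; try ring.
- by apply: cns_inj => w; rewrite !TE; ring.
- by apply: cns_inj => w; rewrite !TE; ring.
Qed.

(** For the Albert algebra, a nilpotent element of the Lie algebra of Inv, which has
type E7. These elements form the abelian nilradical of a parabolic subalgebra with
semisimple part of type E6, acting on this nilradical J. *)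
Definition raising (u : J) (x : B) : B :=
  bm 0 (u ** cK x) (cA x *: u) (T (cJ x) u).

Lemma raising_bm u a j k c : raising u (bm a j k c) = bm 0 (u ** k) (a *: u) (T j u).
Proof. by rewrite /raising (bf_cA frameB) (bf_cJ frameB) (bf_cK frameB). Qed.

Lemma raising_linear u : linear (raising u).
Proof.
move=> c x y; have [a1 [j1 [k1 [b1 ->]]]] := bmP x; have [a2 [j2 [k2 [b2 ->]]]] := bmP y.
rewrite bmZ bmD !raising_bm bmZ bmD !(TE, mE) scalerDl scalerA.
apply: bm_eq => //; rewrite mulr0 addr0 //.
Qed.

(** This is the derivation rule on the diagonal; its two components in J are
[adjoint_dual] and [sharp_mu_mu]. *)
Lemma raising_cubic u (x : B) : 3 *: t (raising u x) x x = raising u (t x x x).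
Proof.
have [a [j [k [c ->]]]] := bmP x.
rewrite raising_bm !tform_bm raising_bm bmZ !(TE, mE, mu_diag); apply: bm_eq.
- by ring.
(* The cubic map t x x x has a factor 6, and [mu_diag] gives another 2. *)
- have E := congr1 (fun v => 12 *: v) (adjoint_dual u k j).
  apply: cns_inj => z; have := congr1 (T^~ z) E.
  rewrite (muC k (_ ** j)) (muC u k) trace_mu_self (muC (sh j)) !TE => {}E.
  by apply: (lincomb1 E); ring.
- have E := congr1 (fun v => - 12 *: v) (sharp_mu_mu k u).
  apply: cns_inj => z; have := congr1 (T^~ z) E.
  rewrite (muC u k) trace_mu_self trace_sharp !TE => {}E.
  by apply: (lincomb1 E); ring.
- rewrite (muC u k) trace_mu_self (mu_adj _ j j) mu_diag (mu_adj (sh j)) TZr (TC _ (sh j)).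
  by ring.
Qed.

Lemma tformZ c (x y z : B) : t (c *: x) y z = c *: t x y z.
Proof.
have [a1 [j1 [k1 [b1 ->]]]] := bmP x; have [a2 [j2 [k2 [b2 ->]]]] := bmP y.
have [a3 [j3 [k3 [b3 ->]]]] := bmP z.
rewrite bmZ !tform_bm bmZ !(TE, mE); apply: bm_eq; try ring.
- by apply: cns_inj => w; rewrite !TE; ring.
- by apply: cns_inj => w; rewrite !TE; ring.
Qed.

Lemma derivation_aut (D : 'End(B)) :
  (forall x : B, D (D x) = 0) ->
  (forall x y : B, b (D x) y + b x (D y) = 0) ->
  (forall x : B, 3 *: t (D x) x x = D (t x x x)) ->
  in_Inv skew1 (\1 + D)%VF.
Proof.
move=> DD Db Dt.
have fE (x : B) : (\1 + D)%VF x = x + D x by rewrite add_lfunE id_lfunE.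
split=> [x y|x y z].
  rewrite !fE.
  have bDl (u v w : B) : b (u + v) w = b u w + b v w.
    have [a1 [j1 [k1 [b1 ->]]]] := bmP u; have [a2 [j2 [k2 [b2 ->]]]] := bmP v.
    by have [a3 [j3 [k3 [b3 ->]]]] := bmP w; rewrite bmD !bform_bm !TE; ring.
  have bDr (u v w : B) : b w (u + v) = b w u + b w v.
    have [a1 [j1 [k1 [b1 ->]]]] := bmP u; have [a2 [j2 [k2 [b2 ->]]]] := bmP v.
    by have [a3 [j3 [k3 [b3 ->]]]] := bmP w; rewrite bmD !bform_bm !TE; ring.
  rewrite bDl !bDr; have := Db x (D y); rewrite DD.
  have -> : b x 0 = 0 by apply: (addrI (b x 0)); rewrite -bDr !addr0.
  by rewrite addr0 => ->; rewrite addr0 -addrA [_ + b (D x) y]addrC Db addr0.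
rewrite !fE; apply: (derivation_exp K2 K3 tform12 tform23 tformD) => //.
exact: tformZ.
Qed.

(** * Unipotent elements of Inv *)

Lemma raising_lfun u : {D : 'End(B) | D =1 raising u}.
Proof. exact: linfunP (raising_linear u). Qed.

(** The condition on the kernel makes inverses available in 'End(B). *)
Definition inv_aut (f : 'End(B)) := in_Inv skew1 f /\ lker f == 0%VS.

Lemma inv_aut_comp f g : inv_aut f -> inv_aut g -> inv_aut (f \o g)%VF.
Proof.
move=> [[fb ft] /lker0P fi] [[gb gt] /lker0P gi]; split.
  by split=> [x y|x y z]; rewrite !comp_lfunE ?fb ?gb // ft gt.
by apply/lker0P => x y; rewrite !comp_lfunE => /fi/gi.
Qed.

Lemma inv_aut_inv f : inv_aut f -> inv_aut (f^-1)%VF.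
Proof.
move=> [[fb ft] fi]; have K1 := lker0_lfunVK fi; split.
  split=> [x y|x y z]; first by rewrite -fb !K1.
  by move/lker0P: fi => fi; apply: (fi); rewrite -ft !K1.
by apply/lker0P => x y /(congr1 f); rewrite !K1.
Qed.

Lemma inv_aut_id : inv_aut \1%VF.
Proof.
by split; [split=> *; rewrite !id_lfunE | apply/lker0P=> x y; rewrite !id_lfunE].
Qed.

Lemma raising_aut u : sh u = 0 -> exists2 f : 'End(B), inv_aut f &
  forall a j k c, f (bm a j k c) = bm a (j + u ** k) (k + a *: u) (c + T j u).
Proof.
move=> u0; have [D DE] := raising_lfun u.
have DD (x : B) : D (D x) = 0.
  have [a [j [k [c ->]]]] := bmP x; rewrite !DE !raising_bm.
  by rewrite mZr mu_diag u0 !scaler0 scale0r trace_mu_self u0 T0l mulr0 -bm0.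
have fE a j k c : (\1 + D)%VF (bm a j k c) = bm a (j + u ** k) (k + a *: u) (c + T j u).
  by rewrite add_lfunE id_lfunE DE raising_bm bmD addr0.
exists (\1 + D)%VF => //; split.
  apply: derivation_aut => // [x y|x].
    have [a1 [j1 [k1 [b1 ->]]]] := bmP x; have [a2 [j2 [k2 [b2 ->]]]] := bmP y.
    rewrite !DE !raising_bm !bform_bm !TE (muC u k1) (mu_adj k1 u) (TC j1 u) (TC u j2).
    by ring.
  by rewrite !DE raising_cubic.
apply/lker0P => x y; rewrite !add_lfunE !id_lfunE => /eqP.
rewrite -subr_eq0 opprD addrACA -linearB /= addr_eq0 => /eqP E.
apply/eqP; rewrite -subr_eq0; apply/eqP.
by rewrite E E linearN /= DD !oppr0.
Qed.

Lemma swap_ex : {s : 'End(B) | forall a j k c, s (bm a j k c) = bm c k j a}.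
Proof.
have lf : linear (fun x : B => bm (cB x) (cK x) (cJ x) (cA x)).
  move=> l x y; have [a1 [j1 [k1 [b1 ->]]]] := bmP x; have [a2 [j2 [k2 [b2 ->]]]] := bmP y.
  by rewrite bmZ bmD !(bf_cA frameB, bf_cJ frameB, bf_cK frameB, bf_cB frameB) bmZ bmD.
by have [s sE] := linfunP lf; exists s => a j k c; rewrite sE; rewrite !(bf_cA frameB, bf_cJ frameB, bf_cK frameB, bf_cB frameB).
Qed.

(** The exchange of the diagonal entries changes the sign of b and of t, so
conjugation by it preserves Inv. *)
Lemma lowering_aut u : sh u = 0 -> exists2 f : 'End(B), inv_aut f &
  forall a j k c, f (bm a j k c) = bm (a + T k u) (j + c *: u) (k + u ** j) c.
Proof.
move=> /raising_aut[f [[fb ft] fi] fE]; have [s sE] := swap_ex.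
exists (s \o f \o s)%VF; last by move=> a j k c; rewrite !comp_lfunE sE fE sE.
have sb (x y : B) : b (s x) (s y) = - b x y.
  have [a1 [j1 [k1 [b1 ->]]]] := bmP x; have [a2 [j2 [k2 [b2 ->]]]] := bmP y.
  by rewrite !sE !bform_bm; ring.
have st (x y z : B) : t (s x) (s y) (s z) = - s (t x y z).
  have [a1 [j1 [k1 [b1 ->]]]] := bmP x; have [a2 [j2 [k2 [b2 ->]]]] := bmP y.
  have [a3 [j3 [k3 [b3 ->]]]] := bmP z.
  rewrite (sE a1 j1 k1 b1) (sE a2 j2 k2 b2) (sE a3 j3 k3 b3) !tform_bm sE bmN; apply: bm_eq.
  - by canon k1 k2 k3 j1 j2 j3; ring.
  - by canon k1 k2 k3 j1 j2 j3; apply: cns_inj => w; rewrite !TE; ring.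
  - by canon k1 k2 k3 j1 j2 j3; apply: cns_inj => w; rewrite !TE; ring.
  - by canon k1 k2 k3 j1 j2 j3; ring.
have ss (x : B) : s (s x) = x by have [a [j [k [c ->]]]] := bmP x; rewrite !sE.
split.
  split=> [x y|x y z]; rewrite !comp_lfunE.
    by rewrite sb fb sb opprK.
  by rewrite st ft st !linearN opprK.
apply/lker0P => x y; rewrite !comp_lfunE => /(congr1 s); rewrite !ss.
by move/lker0P: fi => fi /fi/(congr1 s); rewrite !ss.
Qed.

(** * Singular elements form one orbit *)

Hypothesis sing_span : forall j : J, exists2 s : seq J,
  (forall u, u \in s -> sh u = 0) & j = \sum_(u <- s) u.
Hypothesis N_neq0 : exists x, N x != 0.

Lemma sing_ind (P : J -> Prop) : P 0 -> (forall x y, P x -> P y -> P (x + y)) ->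
  (forall u, sh u = 0 -> P u) -> forall j, P j.
Proof.
move=> P0 PD Pu j; have [s su ->] := sing_span j; elim: s su => [|u s IH] su.
  by rewrite big_nil.
rewrite big_cons; apply: PD; first by apply/Pu/su/mem_head.
by apply: IH => v vs; apply: su; rewrite inE vs orbT.
Qed.

(** The maps of [raising_aut] fix the entry a and translate k by a u. As u runs over
the elements with u# = 0, which span J, k becomes arbitrary when a is not 0. *)
Lemma raising_orbit a j k c (u : J) : exists2 f, inv_aut f &
  exists j' c', f (bm a j k c) = bm a j' (k + a *: u) c'.
Proof.
elim/sing_ind: u j k c => [|u v IHu IHv|u u0] j k c.
- exists \1%VF; first exact: inv_aut_id.
  by exists j, c; rewrite id_lfunE scaler0 addr0.
- have [f fA [j1 [c1 fE]]] := IHu j k c; have [g gA [j2 [c2 gE]]] := IHv j1 (k + a *: u) c1.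
  exists (g \o f)%VF; first exact: inv_aut_comp.
  by exists j2, c2; rewrite comp_lfunE fE gE scalerDr addrA.
by have [f fA fE] := raising_aut u0; exists f => //; exists (j + u ** k), (c + T j u).
Qed.

(** Climbing the grading K, J, J, K: an element whose first nonzero entry, in the
order a, k, j, c, is not a can be moved so that this entry appears one step
earlier. *)
Lemma lowering_orbit a j k c : bm a j k c != 0 -> exists2 f, inv_aut f &
  exists a' j' k' c', f (bm a j k c) = bm a' j' k' c' /\ a' != 0.
Proof.
have step2 a0 j0 k0 c0 : k0 != 0 -> exists2 f, inv_aut f &
    exists a' j' k' c', f (bm a0 j0 k0 c0) = bm a' j' k' c' /\ a' != 0.
  move=> k0n; have [a00|a0n] := eqVneq a0 0; last first.
    by exists \1%VF; [exact: inv_aut_id|exists a0, j0, k0, c0; rewrite id_lfunE].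
  have [u u0 Tu] : exists2 u, sh u = 0 & T k0 u != 0.
    apply: contrapT => H; case/eqP: k0n; apply: (cns_nd cnsJ) => y.
    elim/sing_ind: y => [|x y|u u0]; first exact: T0r.
      by rewrite TDr => -> ->; rewrite addr0.
    by apply: contrapT => /eqP Tu; apply: H; exists u.
  have [f fA fE] := lowering_aut u0; exists f => //.
  by exists (a0 + T k0 u), (j0 + c0 *: u), (k0 + u ** j0), c0; rewrite fE a00 add0r.
have step1 a0 j0 k0 c0 : j0 != 0 -> exists2 f, inv_aut f &
    exists a' j' k' c', f (bm a0 j0 k0 c0) = bm a' j' k' c' /\ a' != 0.
  move=> j0n; have [k00|] := eqVneq k0 0; last exact: step2.
  have [u u0 mu0] : exists2 u, sh u = 0 & u ** j0 != 0.
    apply: contrapT => H; case/eqP: j0n.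
    have M x : x ** j0 = 0.
      elim/sing_ind: x => [|x y|u u0]; first exact: m0l.
        by rewrite mDl => -> ->; rewrite addr0.
      by apply: contrapT => /eqP Tu; apply: H; exists u.
    (* If x ** j0 = 0 for all x, then T (sh x) j0 = 0, and [sharp_mu_mu] gives N x j0 = 0. *)
    have [x Nx] := N_neq0; have := sharp_mu_mu x j0.
    have -> : T (sh x) j0 = 0.
      by apply: (mulfI K2); rewrite -trace_mu_self M T0l mulr0.
    rewrite M m0r scale0r addr0 => /esym/eqP; rewrite scaler_eq0 (negPf Nx).
    by move/eqP.
  have [f fA fE] := lowering_aut u0.
  have [|g gA gE] := step2 (a0 + T k0 u) (j0 + c0 *: u) (k0 + u ** j0) c0.
    by rewrite k00 add0r.
  by exists (g \o f)%VF; [exact: inv_aut_comp|rewrite comp_lfunE fE].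
move=> en; have [a0|an] := eqVneq a 0; last first.
  by exists \1%VF; [exact: inv_aut_id|exists a, j, k, c; rewrite id_lfunE].
have [k0|] := eqVneq k 0; last exact: step2.
have [j0|] := eqVneq j 0; last exact: step1.
have cn : c != 0 by apply: contraNneq en => ->; rewrite a0 j0 k0 -bm0.
have [u u0 un] : exists2 u, sh u = 0 & u != 0.
  apply: contrapT => H; have [x /eqP[]] := N_neq0.
  suff -> : x = 0 by rewrite -(scale0r (0 : J)) (cns_NZ cnsJ) expr0n mul0r.
  elim/sing_ind: x => [//|x y -> ->|u u0]; first by rewrite addr0.
  by apply: contrapT => /eqP un; apply: H; exists u.
have [f fA fE] := lowering_aut u0.
have [|g gA gE] := step1 (a + T k u) (j + c *: u) (k + u ** j) c.
  by rewrite j0 add0r scaler_eq0 negb_or cn.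
by exists (g \o f)%VF; [exact: inv_aut_comp|rewrite comp_lfunE fE].
Qed.

(** This recovers U from b and t, so that Inv respects inner ideals and singular elements. *)
Lemma tform_self (x z : B) : t x z x = 2 *: U_ x (inv_mul skew1 z) - (2 * b z x) *: x.
Proof.
have bxx : b x x = 0.
  have [a [j [k [c ->]]]] := bmP x; rewrite bform_bm (TC k); ring.
by rewrite /tform bxx scale0r subr0 -addrA -opprD -scalerDl -mulr2n mulr_natl.
Qed.

Lemma inv_aut_U f (x z : B) : inv_aut f ->
  f (U_ x (inv_mul skew1 z)) = U_ (f x) (inv_mul skew1 (f z)).
Proof.
move=> [[fb ft] _]; apply: (scalerI K2).
have := ft x z x; rewrite !tform_self fb; move: (U_ x _) (U_ (f x) _) => p q.
by rewrite linearB !linearZ /= => /addIr ->.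
Qed.

Lemma skew1K (x : B) : inv_mul skew1 (inv_mul skew1 x) = x.
Proof. by have [a [j [k [c ->]]]] := bmP x; rewrite !skew1_mul !opprK. Qed.

Lemma inv_aut_surj f : inv_aut f -> forall y : B, exists x : B, f x = y.
Proof. by move=> [_ fi] y; exists (f^-1%VF y); rewrite lker0_lfunVK. Qed.

Lemma inv_aut_inner f (W : {vspace B}) : inv_aut f -> inner_ideal W -> inner_ideal (f @: W)%VS.
Proof.
move=> fA iW _ /memv_imgP[e eW ->] x.
have [z zE] := inv_aut_surj fA (inv_mul skew1 x).
by rewrite -[x]skew1K -zE -inv_aut_U // memv_img // iW.
Qed.

Lemma inv_aut_singular f (e : B) : inv_aut f -> singular e -> singular (f e).
Proof.
move=> fA [en es]; split.
  by case: fA => _ /lker0P fi; apply: contra_neq en => fe0; apply: fi; rewrite linear0.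
move=> x; have [z zE] := inv_aut_surj fA (inv_mul skew1 x).
rewrite -[x]skew1K -zE -inv_aut_U //; have /vlineP[c ->] := es (inv_mul skew1 z).
by rewrite linearZ memvZ ?memv_line.
Qed.

Lemma sharp_zero : sh 0 = 0.
Proof. by rewrite -(scale0r (0 : J)) (cns_shZ cnsJ) expr0n /= !scale0r. Qed.

(** Once a is not 0, [raising_orbit] clears k. For e = (a, j; 0, c) the element
U_e (0, 0; 0, 1) = (2 a^2, 0; 0, - a c) must be a multiple of e, hence equal to
2 a e, and this forces j and c to vanish. *)
Lemma singular_orbit (e : B) : singular e -> exists2 f, inv_aut f &
  exists2 a, a != 0 & f e = bm a 0 0 0.
Proof.
move=> es; have [a0 [j0 [k0 [c0 eE]]]] := bmP e.
have [|f fA [a [j [k [c [fE an]]]]]] := @lowering_orbit a0 j0 k0 c0.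
  by rewrite -eE; case: es.
have [g gA [j' [c' gE]]] := raising_orbit a j k c (- a^-1 *: k).
have hA := inv_aut_comp gA fA; exists (g \o f)%VF => //; exists a => //.
rewrite scalerA mulrN divff // scaleN1r subrr in gE.
have := inv_aut_singular hA es; rewrite comp_lfunE eE fE gE => -[_ /(_ (bm 0 0 0 1))].
rewrite U_bm => /vlineP[l].
rewrite bmZ => /bm_inj[]; rewrite !(TE, mE) !(scaler0, mulr0, addr0, mulr1, subr0) => E1 E2 _ E4.
have {}E1 : l = 2 * a by apply: (mulIf an); rewrite -E1 expr2 mulrA.
have l0 : l != 0 by rewrite E1 mulf_neq0.
have -> : j' = 0.
  by apply: (scal_inj l0); rewrite -E2 scale0r sharp_zero !scaler0 addr0.
suff -> : c' = 0 by [].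
have := mulf_neq0 K3 an => /mulfI; apply; rewrite mulr0.
by rewrite E1 in E4; apply: (lincomb1 (esym E4)); ring.
Qed.

(** It is enough to check this at E, by [singular_orbit]. The point is that the factor
is linear in e. *)
Lemma singularU (e z : B) : singular e -> U_ e (inv_mul skew1 z) = (- 2 * b e z) *: e.
Proof.
move=> /singular_orbit[f fA [a an fe]].
have fZ (l : K) : f (l *: e) = l *: f e by rewrite linearZ.
have [_ /lker0P fi] := fA; apply: fi; rewrite inv_aut_U // fZ fe.
have [[fb _] _] := fA; rewrite -fb fe.
have [a1 [j1 [k1 [c1 ->]]]] := bmP (f z).
rewrite skew1_mul U_bm bform_bm bmZ !(TE, mE) sharp_zero !(TE, mE).
apply: bm_eq; first ring; last ring.
- by apply: cns_inj => w; rewrite !TE; ring.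
- by apply: cns_inj => w; rewrite !TE; ring.
Qed.

(** * Inner ideals through a fixed singular element *)

Definition bE : B := bm 1 0 0 0.

(** The linearization of U at E has degree one in the second element, so the
conditions it puts on an inner ideal containing E are linear. *)
Lemma polar_bE a j k c p q r s :
  U_ (bE + bm a j k c) (bm p q r s) - U_ bE (bm p q r s) - U_ (bm a j k c) (bm p q r s) =
  bm (4 * a * s + 2 * T q k - c * p) (c *: q)
     ((2 * s) *: k + c *: r + 2 *: (j ** q)) (- (c * s)).
Proof.
have sub3 a1 j1 k1 c1 a2 j2 k2 c2 a3 j3 k3 c3 :
    bm a1 j1 k1 c1 - bm a2 j2 k2 c2 - bm a3 j3 k3 c3 =
    bm (a1 - a2 - a3) (j1 - j2 - j3) (k1 - k2 - k3) (c1 - c2 - c3) by rewrite !bmN !bmD.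
rewrite /bE (bmD 1 0 0 0 a j k c) !add0r !U_bm sub3 !(TE, mE) sharp_zero !(TE, mE).
apply: bm_eq; first ring; last ring.
- by apply: cns_inj => w; rewrite !TE; ring.
- by apply: cns_inj => w; rewrite !TE; ring.
Qed.

Section InnerIdealE.
Variable W : {vspace B}.
Hypothesis iW : inner_ideal W.
Hypothesis WE : bE \in W.

Lemma polar_bE_in a j k c p q r s : bm a j k c \in W ->
  bm (4 * a * s + 2 * T q k - c * p) (c *: q)
     ((2 * s) *: k + c *: r + 2 *: (j ** q)) (- (c * s)) \in W.
Proof.
move=> xW; rewrite -polar_bE; apply: rpredB; last exact: iW.
by apply: rpredB; apply: iW => //; apply: rpredD.
Qed.

Lemma bE_in a : bm a 0 0 0 \in W.
Proof.
have -> : bm a 0 0 0 = a *: bE by rewrite bmZ !scaler0 mulr0 mulr1.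
exact: memvZ.
Qed.

Hypothesis Wproper : W != fullv.

(** If c is not 0, the linearization of U at E and (a, j; k, c) is onto. *)
Lemma inner_corner0 a j k c : bm a j k c \in W -> c = 0.
Proof.
move=> xW; apply: contraNeq Wproper => cn.
apply/eqP/vspaceP => y; rewrite memvf; have [A [q [R [D ->]]]] := bmP y.
(* The equations for the four entries are triangular in s, q, r, p. *)
pose s := - D / c; pose r := c^-1 *: (R - (2 * s) *: k - 2 *: (j ** (c^-1 *: q))).
have := polar_bE_in ((4 * a * s + 2 * T (c^-1 *: q) k - A) / c) (c^-1 *: q) r s xW.
congr (_ \in W); apply: bm_eq.
- by rewrite [c * _]mulrC divfK // opprB addrC subrK.
- by rewrite scalerA divff // scale1r.
- by rewrite /r scalerA divff // scale1r [_ + (R - _ - _)]addrC [R - _ - _]addrAC !subrK.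
- by rewrite /s mulrC divfK // opprK.
Qed.

Lemma inner_lowK a j k c : bm a j k c \in W -> bm 0 0 k 0 \in W.
Proof.
move=> xW; have c0 := inner_corner0 xW; rewrite c0 in xW.
have := rpredB (polar_bE_in 0 0 0 (2^-1) xW) (bE_in (4 * a * 2^-1)).
have sub2 a1 j1 k1 c1 a2 j2 k2 c2 :
  bm a1 j1 k1 c1 - bm a2 j2 k2 c2 = bm (a1 - a2) (j1 - j2) (k1 - k2) (c1 - c2) by rewrite bmN bmD.
rewrite sub2; congr (_ \in W); apply: bm_eq.
- by rewrite T0l; ring.
- by apply: cns_inj => w; rewrite !TE; ring.
- by apply: cns_inj => w; rewrite !(TE, mE) divff //; ring.
- by ring.
Qed.

Lemma inner_lowJ a j k c : bm a j k c \in W -> bm 0 j 0 0 \in W.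
Proof.
move=> xW; have := rpredB (rpredB xW (inner_lowK xW)) (bE_in a).
rewrite (inner_corner0 xW).
have sub3 a1 j1 k1 c1 a2 j2 k2 c2 a3 j3 k3 c3 :
    bm a1 j1 k1 c1 - bm a2 j2 k2 c2 - bm a3 j3 k3 c3 =
    bm (a1 - a2 - a3) (j1 - j2 - j3) (k1 - k2 - k3) (c1 - c2 - c3) by rewrite !bmN !bmD.
rewrite sub3; congr (_ \in W); apply: bm_eq; first ring; last ring.
- by apply: cns_inj => w; rewrite !TE; ring.
- by apply: cns_inj => w; rewrite !TE; ring.
Qed.

(** J1 and V are the slices of W at the entries j and k. Their relations come from the
linearization at E and from U of elements (0, j; k, 0), applied to
(0, 0; 0, 1) and (0, q; 0, 0). *)
Lemma inner_bE : exists J1 V : {vspace J}, [/\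
  forall a j k c, bm a j k c \in W <-> [/\ j \in J1, k \in V & c = 0],
  forall j q, j \in J1 -> j ** q \in V,
  forall j k, j \in J1 -> k \in V -> T j k = 0,
  forall j, j \in J1 -> sh j = 0 &
  forall k, k \in V -> sh k \in J1].
Proof.
have [iJ iJE] : {f : 'Hom(J, B) | f =1 (fun j => bm 0 j 0 0)}.
  by apply: linfunP => l j j'; rewrite bmZ bmD !mulr0 !scaler0 !addr0.
have [iK iKE] : {f : 'Hom(J, B) | f =1 (fun k => bm 0 0 k 0)}.
  by apply: linfunP => l j j'; rewrite bmZ bmD !mulr0 !scaler0 !addr0.
exists (iJ @^-1: W)%VS, (iK @^-1: W)%VS.
have mJ j : (j \in (iJ @^-1: W)%VS) = (bm 0 j 0 0 \in W) by rewrite -memv_preim iJE.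
have mV k : (k \in (iK @^-1: W)%VS) = (bm 0 0 k 0 \in W) by rewrite -memv_preim iKE.
have WP a j k c : bm a j k c \in W <->
    [/\ j \in (iJ @^-1: W)%VS, k \in (iK @^-1: W)%VS & c = 0].
  rewrite mJ mV; split=> [xW|[jW kW ->]].
    by split; [exact: inner_lowJ xW | exact: inner_lowK xW | exact: inner_corner0 xW].
  have -> : bm a j k 0 = bm a 0 0 0 + bm 0 j 0 0 + bm 0 0 k 0.
    by rewrite !bmD !addr0 !add0r.
  by rewrite !rpredD ?bE_in.
have x0 j k : j \in (iJ @^-1: W)%VS -> k \in (iK @^-1: W)%VS -> bm 0 j k 0 \in W.
  by move=> jJ kV; apply/WP.
split=> //.
- move=> j q jJ; have /(polar_bE_in 0 q 0 0)/WP[_] := x0 j 0 jJ (mem0v _).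
  rewrite !scaler0 !add0r => H _; rewrite -[j ** q]scale1r -(mulVf K2) -scalerA.
  exact: memvZ.
- move=> j k jJ kV; have /iW/(_ (bm 0 0 0 1)) := x0 j k jJ kV.
  by rewrite U_bm => /WP[_ _]; rewrite !TE expr0n /= !(mul0r, mulr0, subr0, mulr1, add0r, addr0).
- move=> j jJ; apply: (cns_nd cnsJ) => q.
  have /iW/(_ (bm 0 q 0 0)) := x0 j 0 jJ (mem0v _).
  rewrite U_bm => /WP[_ _]; rewrite !TE !(mul0r, mulr0, subr0, mulr1, add0r, addr0).
  by move/eqP; rewrite mulf_eq0 (negPf K2) => /eqP.
- move=> k kV; have /iW/(_ (bm 0 0 0 1)) := x0 0 k (mem0v _) kV.
  rewrite U_bm => /WP[H _ _]; rewrite -[sh k]scale1r -(mulVf K2) -scalerA memvZ //.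
  move: H; set v := (X in X \in _); suff -> : v = 2 *: sh k by [].
  by apply: cns_inj => w; rewrite /v !(TE, mE); ring.
Qed.

End InnerIdealE.

Lemma inner_dim (W : {vspace B}) (J1 V : {vspace J}) :
  (forall a j k c, bm a j k c \in W <-> [/\ j \in J1, k \in V & c = 0]) ->
  \dim W = (1 + \dim J1 + \dim V)%N.
Proof.
move=> WP.
have pr a j k b0 := (bf_cA frameB a j k b0, bf_cJ frameB a j k b0, bf_cK frameB a j k b0).
have [pa paE] : {f : 'Hom(B, K^o) | f =1 cA}.
  apply: linfunP => l x y; have [a1 [j1 [k1 [b1 ->]]]] := bmP x.
  by have [a2 [j2 [k2 [b2 ->]]]] := bmP y; rewrite bmZ bmD !pr.
have [pj pjE] : {f : 'Hom(B, J) | f =1 cJ}.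
  apply: linfunP => l x y; have [a1 [j1 [k1 [b1 ->]]]] := bmP x.
  by have [a2 [j2 [k2 [b2 ->]]]] := bmP y; rewrite bmZ bmD !pr.
have [pk pkE] : {f : 'Hom(B, J) | f =1 cK}.
  apply: linfunP => l x y; have [a1 [j1 [k1 [b1 ->]]]] := bmP x.
  by have [a2 [j2 [k2 [b2 ->]]]] := bmP y; rewrite bmZ bmD !pr.
have paB a j k b0 : pa (bm a j k b0) = a by rewrite paE pr.
have pjB a j k b0 : pj (bm a j k b0) = j by rewrite pjE pr.
have pkB a j k b0 : pk (bm a j k b0) = k by rewrite pkE pr.
have bE_in a j k c : (bm a j k c \in W) = [&& j \in J1, k \in V & c == 0].
  apply/idP/and3P => [/WP[? ? ->]|[? ? /eqP ?]]; first by split.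
  exact/WP.
(* Rank and nullity for the projections to the entries a and j, in succession. *)
rewrite -(limg_ker_dim pa W).
have -> : \dim (pa @: W) = 1%N.
  suff -> : (pa @: W)%VS = fullv by rewrite dimvf.
  apply/vspaceP => a; rewrite memvf; have -> : a = pa (bm a 0 0 0) by rewrite paB.
  by rewrite memv_img // bE_in !mem0v eqxx.
rewrite -(limg_ker_dim pj (W :&: lker pa)) addnC -!addnA; congr (_ + _)%N.
rewrite addnC; congr (_ + _)%N.
  congr (\dim _); apply/vspaceP => j; apply/memv_imgP/idP => [[x]|jJ].
    have [a [j' [k [c ->]]]] := bmP x.
    by rewrite memv_cap bE_in pjB => /andP[/and3P[? _ _] _] ->.
  exists (bm 0 j 0 0); last by rewrite pjB.
  by rewrite memv_cap bE_in memv_ker paB jJ mem0v eqxx /= ?eqxx.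
rewrite -(@limg_dim_eq _ _ _ pk).
  congr (\dim _); apply/vspaceP => k; apply/memv_imgP/idP => [[x]|kV].
    have [a [j [k' [c ->]]]] := bmP x.
    by rewrite !memv_cap bE_in pkB => /andP[/andP[/and3P[_ ? _] _] _] ->.
  exists (bm 0 0 k 0); last by rewrite pkB.
  by rewrite !memv_cap bE_in !memv_ker paB pjB kV mem0v /= ?eqxx.
apply/eqP; rewrite -subv0; apply/subvP => x.
have [a [j [k' [c ->]]]] := bmP x.
rewrite !memv_cap bE_in !memv_ker paB pjB pkB /=.
by move=> /andP[/andP[/andP[/and3P[_ _ /eqP->] /eqP->] /eqP->] /eqP->]; rewrite -bm0 mem0v.
Qed.

Lemma singular_low a k : sh k = 0 -> bm a 0 k 0 != 0 -> singular (bm a 0 k 0).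
Proof.
move=> k0 n0; split=> // x; have [p [q [r [s ->]]]] := bmP x.
apply/vlineP; exists (2 * a * s + 2 * T k q).
rewrite U_bm k0 sharp_zero bmZ !(TE, mE); apply: bm_eq.
- by rewrite (TC q k); ring.
- by apply: cns_inj => w; rewrite !TE; ring.
- by apply: cns_inj => w; rewrite !TE; ring.
- by ring.
Qed.

Lemma low_singular k : singular (bm 0 0 k 0) -> sh k = 0.
Proof.
move=> [_ /(_ (bm 0 0 0 1))/vlineP[l]]; rewrite U_bm bmZ !(TE, mE) => /bm_inj[_ E _ _].
apply: (scal_inj K2); apply: cns_inj => w; have := congr1 (T^~ w) E.
by rewrite !TE => {}E; apply: (lincomb1 E); ring.
Qed.

(** * Inner ideals containing a singular element *)

(** The two facts on subspaces of J that depend on the dimension of J. For the Albert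
algebra they are proved below by means of leading coordinates. *)
Hypothesis ts_dim : forall V : {vspace J},
  (forall v, v \in V -> sh v = 0) -> (\dim V <= 6)%N.
Hypothesis point_ideal : forall (J1 V : {vspace J}) d,
  (forall j q, j \in J1 -> j ** q \in V) ->
  (forall j k, j \in J1 -> k \in V -> T j k = 0) ->
  (forall k, k \in V -> sh k \in J1) -> d \in J1 -> d != 0 ->
  [/\ J1 = <[d]>%VS, \dim V = 10%N & forall k, k \in V <-> exists y, k = d ** y].

Definition low_form (W : {vspace B}) : Prop :=
  exists2 V : {vspace J}, (forall v, v \in V -> sh v = 0) &
  forall a j k c, bm a j k c \in W <-> [/\ j = 0, k \in V & c = 0].

Definition point_form (W : {vspace B}) : Prop :=
  exists2 d : J, d != 0 /\ sh d = 0 &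
  forall a j k c, bm a j k c \in W <->
    [/\ j \in <[d]>%VS, (exists y, k = d ** y) & c = 0].

(** The dichotomy is whether the slice J1 of [inner_bE] is zero. *)
Lemma split_inner_ideal (W' : {vspace B}) :
  inner_ideal W' -> W' != fullv -> (exists2 e, e \in W' & singular e) ->
  exists (f : 'End(B)) (W : {vspace B}),
  [/\ inv_aut f, W' = (f @: W)%VS, inner_ideal W &
    (low_form W /\ (\dim W <= 7)%N /\ singular_ideal W) \/
    (point_form W /\ \dim W = 12%N /\ ~ singular_ideal W)].
Proof.
move=> iW' W'n [e eW' es].
have [g gA [a an ge]] := singular_orbit es.
have fA := inv_aut_inv gA; have [fI fker] := fA; have [gI gker] := gA.
pose W := (g @: W')%VS.
have W'E : W' = ((g^-1)%VF @: W)%VS.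
  by rewrite /W -limg_comp lker0_compVf // lim1g.
have iW : inner_ideal W by exact: (inv_aut_inner gA iW').
have Wn : W != fullv.
  apply: contraNneq W'n => WE; rewrite eqEdim subvf /= -WE.
  rewrite -(@limg_dim_eq _ _ _ g^-1%VF W) -?W'E //.
  by rewrite (eqP fker) capv0.
have EW : bE \in W.
  have -> : bE = a^-1 *: g e.
    by rewrite ge bmZ mulVf // !scaler0 mulr0.
  by rewrite memvZ // memv_img.
have [J1 [V [WP JV TJV J0 VJ]]] := inner_bE iW EW Wn.
have dimW := inner_dim WP.
exists (g^-1)%VF, W; split=> //.
have [J10|Jn] := eqVneq J1 0%VS.
  have tV k : k \in V -> sh k = 0.
    by move=> /VJ; rewrite J10 memv0 => /eqP.
  left; split; [|split].
  - exists V => // b0 j k c; split=> [/WP[+ kV ->]|[-> kV ->]].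
      by rewrite J10 memv0 => /eqP ->.
    by apply/WP; rewrite mem0v.
  - by rewrite dimW J10 dimv0 addn0 add1n ltnS (ts_dim tV).
  move=> x; have [b0 [j [k [c ->]]]] := bmP x => /WP[+ kV ->].
  rewrite J10 memv0 => /eqP ->; exact: (singular_low (tV k kV)).
have [d dJ dn] : exists2 d, d \in J1 & d != 0.
  by exists (vpick J1); rewrite ?memv_pick ?vpick0.
have [J1d dimV Vd] := point_ideal JV TJV VJ dJ dn.
right; split; [|split].
- exists d; first by split => //; apply: J0.
  move=> b0 j k c; rewrite -J1d; split=> [/WP[jJ kV ->]|[jJ kV ->]].
    by split=> //; apply/Vd.
  by apply/WP; split=> //; apply/Vd.
- by rewrite dimW dimV J1d dim_vline dn.
move=> sW; have tV k : k \in V -> sh k = 0.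
  move=> kV; have [->|kn] := eqVneq k 0; first exact: sharp_zero.
  apply: low_singular; apply: sW.
    by apply/WP; rewrite mem0v.
  by apply: contra_neq kn; rewrite bm0 => /bm_inj[].
by have := ts_dim tV; rewrite dimV.
Qed.

Lemma frame_mul_linear_r (x : B) : linear (inv_mul x).
Proof.
move=> c y z.
have [a [j [k [d ->]]]] := bmP x; have [a' [j' [k' [d' ->]]]] := bmP y.
have [a2 [j2 [k2 [d2 ->]]]] := bmP z.
rewrite !bmE !(TE, mE); apply: bm_eq; try ring.
- by apply: cns_inj => w; rewrite !TE; ring.
- by apply: cns_inj => w; rewrite !TE; ring.
Qed.

Lemma frame_mul_linear_l (x : B) : linear (fun y : B => inv_mul y x).
Proof.
move=> c y z.
have [a [j [k [d ->]]]] := bmP x; have [a' [j' [k' [d' ->]]]] := bmP y.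
have [a2 [j2 [k2 [d2 ->]]]] := bmP z.
rewrite !bmE !(TE, mE); apply: bm_eq; try ring.
- by apply: cns_inj => w; rewrite !TE; ring.
- by apply: cns_inj => w; rewrite !TE; ring.
Qed.

Lemma frame_bar_linear : linear (@inv_bar K B).
Proof.
move=> c y z; have [a [j [k [d ->]]]] := bmP y.
by have [a2 [j2 [k2 [d2 ->]]]] := bmP z; rewrite !bmE.
Qed.

Lemma frame_full (U : {vspace B}) : bm 1 0 0 0 \in U -> (forall j, bm 0 j 0 0 \in U) ->
  (forall k, bm 0 0 k 0 \in U) -> bm 0 0 0 1 \in U -> U = fullv.
Proof.
move=> U1 U2 U3 U4; apply/eqP; rewrite eqEsubv subvf; apply/subvP => x _.
have [a [j [k [b0 ->]]]] := bmP x.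
have -> : bm a j k b0 = a *: bm 1 0 0 0 + bm 0 j 0 0 + bm 0 0 k 0 + b0 *: bm 0 0 0 1.
  by rewrite !bmZ !bmD !scaler0 !addr0 !add0r !mulr1 !mulr0 !addr0 add0r.
by rewrite !rpredD ?rpredZ.
Qed.

Lemma frame_linearJ : linear (fun j => bm 0 j 0 0).
Proof. by move=> c j j'; rewrite bmZ bmD mulr0 !scaler0 !addr0. Qed.

Lemma frame_linearK : linear (fun k => bm 0 0 k 0).
Proof. by move=> c j j'; rewrite bmZ bmD mulr0 !scaler0 !addr0. Qed.

(** * Transport along an isomorphism *)

Section Transport.
Variables (A : invAlg K) (theta : 'Hom(A, B)) (s : A) (I : {vspace A}).
Hypothesis iso : inv_iso theta.
Hypothesis one_l : left_id (inv_one A) (@inv_mul K A).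
Hypothesis bar_s : inv_bar s = - s.
Hypothesis s_neq0 : s != 0.

Lemma theta_inj : injective theta.
Proof. by case: iso => /bij_inj. Qed.

Lemma theta_surj (y : B) : exists x : A, theta x = y.
Proof. by case: iso => -[g _ gK] _ _; exists (g y). Qed.

Lemma thetaM (x y : A) : theta (inv_mul x y) = inv_mul (theta x) (theta y).
Proof. by case: iso. Qed.

Lemma theta_bar (x : A) : theta (inv_bar x) = inv_bar (theta x).
Proof. by case: iso. Qed.

Lemma thetaD (x y : A) : theta (x + y) = theta x + theta y.
Proof. by rewrite linearD. Qed.

Lemma thetaB (x y : A) : theta (x - y) = theta x - theta y.
Proof. by rewrite linearB. Qed.

Lemma theta0 : theta 0 = 0.
Proof. by rewrite linear0. Qed.

Lemma thetaN (x : A) : theta (- x) = - theta x.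
Proof. by rewrite linearN. Qed.

Lemma thetaZ c (x : A) : theta (c *: x) = c *: theta x.
Proof. by rewrite linearZ. Qed.

Lemma theta_triple (x y z : A) : theta (triple x y z) = triple (theta x) (theta y) (theta z).
Proof.
by rewrite /triple thetaB thetaD !thetaM !theta_bar.
Qed.

Lemma theta_one : theta (inv_one A) = inv_one B.
Proof.
have [x xE] := theta_surj (inv_one B).
have mul1 (y : B) : inv_mul y (inv_one B) = y.
  have [a [j [k [c ->]]]] := bmP y; rewrite bm_one bmM !(TE, mE); apply: bm_eq; try ring.
  - by apply: cns_inj => w; rewrite !TE; ring.
  - by apply: cns_inj => w; rewrite !TE; ring.
by rewrite -[LHS]mul1 -xE -thetaM one_l.
Qed.

Lemma one_neq0 : inv_one A != 0.
Proof.
apply/eqP => /(congr1 theta); rewrite theta_one theta0 bm_one bm0 => /bm_inj[/eqP].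
by rewrite oner_eq0.
Qed.

(** Skew elements of the split algebra are multiples of [skew1]. Changing the skew
element by a factor multiplies both b and t by it, so Inv does not depend on the
choice. *)
Lemma theta_skew : exists2 c, c != 0 & theta s = c *: skew1.
Proof.
have [a [j [k [c E]]]] := bmP (theta s).
have := congr1 theta bar_s; rewrite theta_bar thetaN E bm_bar bmN => /bm_inj[ca jj kk _].
have z2 (v : J) : v = - v -> v = 0.
  move=> vv; apply: (scal_inj K2); apply: cns_inj => w; have := congr1 (T^~ w) vv.
  by rewrite !TE => e; apply: (lincomb1 e); ring.
exists a; last by rewrite bmZ (z2 j jj) (z2 k kk) !scaler0 ca mulr1 mulrN1.
apply: contraNneq s_neq0 => a0; apply/eqP/theta_inj.
rewrite theta0 E (z2 j jj) (z2 k kk) a0; have -> : c = 0 by rewrite ca a0 oppr0.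
exact/esym/bm0.
Qed.

Lemma brown_mulZl c (x y : B) : inv_mul (c *: x) y = c *: inv_mul x y.
Proof. by have [g gE] := linfunP (frame_mul_linear_l y); rewrite -!gE linearZ. Qed.

Lemma brown_mulZr c (x y : B) : inv_mul y (c *: x) = c *: inv_mul y x.
Proof. by have [g gE] := linfunP (frame_mul_linear_r y); rewrite -!gE linearZ. Qed.

Lemma brown_barZ c (x : B) : inv_bar (c *: x) = c *: inv_bar x.
Proof. by have [g gE] := linfunP frame_bar_linear; rewrite -!gE linearZ. Qed.

Lemma brown_skewpart (x y : B) :
  inv_mul (inv_mul x (inv_bar y) - inv_mul y (inv_bar x)) skew1 = b x y *: inv_one B.
Proof.
have [a1 [j1 [k1 [c1 ->]]]] := bmP x; have [a2 [j2 [k2 [c2 ->]]]] := bmP y.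
rewrite bform_bm bm_one !bmE !(TE, mE); apply: bm_eq.
- by rewrite (TC j2) (TC k1); ring.
- by apply: cns_inj => w; rewrite !TE (muC k2); ring.
- by apply: cns_inj => w; rewrite !TE (muC j2); ring.
- by rewrite (TC j2) (TC k1); ring.
Qed.

Lemma theta_bform c (x y : A) : theta s = c *: skew1 ->
  bform s x y = c * b (theta x) (theta y).
Proof.
move=> sE; rewrite -[RHS](scalar_partZ _ one_neq0) [LHS]/bform; congr scalar_part.
apply: theta_inj; rewrite thetaM thetaB !thetaM !theta_bar sE brown_mulZr brown_skewpart.
by rewrite thetaZ theta_one scalerA.
Qed.

Lemma theta_tform c (x y z : A) : theta s = c *: skew1 ->
  theta (tform s x y z) = c *: t (theta x) (theta y) (theta z).
Proof.
move=> sE; have tri (u v w : B) : triple u (c *: v) w = c *: triple u v w.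
  by rewrite /triple brown_barZ !brown_mulZr !brown_mulZl -scalerDr -scalerBr.
rewrite /tform !thetaB !thetaZ !(theta_bform _ _ sE) theta_triple thetaM sE.
by rewrite brown_mulZl tri !scalerBr !scalerA mulrC.
Qed.

Lemma theta_singular (e : A) : singular e <-> singular (theta e).
Proof.
have n0 : (e != 0) = (theta e != 0) by rewrite -(inj_eq theta_inj) theta0.
have lineE (x : A) : (x \in <[e]>%VS) = (theta x \in <[theta e]>%VS).
  by apply/vlineP/vlineP => -[l lE]; exists l; [rewrite lE thetaZ|apply: theta_inj; rewrite thetaZ].
split=> -[en es]; split; [by rewrite -n0| |by rewrite n0|] => y.
  by have [x <-] := theta_surj y; rewrite -[U_ _ _]theta_triple -lineE; apply: es.
by rewrite lineE theta_triple; apply: es.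
Qed.

Hypothesis iI : inner_ideal I.
Hypothesis In : I != fullv.
Hypothesis Is : exists2 e, e \in I & singular e.

Lemma theta_mem (U : {vspace A}) (x : A) : (theta x \in (theta @: U)%VS) = (x \in U).
Proof.
apply/memv_imgP/idP => [[y yU /theta_inj ->] //|xU].
by exists x.
Qed.

Lemma inner_ideal_brown : exists (W : {vspace B}) (f : 'End(A)),
  [/\ inner_ideal W, in_Inv s f, I = (f @: (theta @^-1: W))%VS &
    (low_form W /\ (\dim I <= 7)%N /\ singular_ideal I) \/
    (point_form W /\ \dim I = 12%N /\ ~ singular_ideal I)].
Proof.
have [c cn sE] := theta_skew.
have thker : lker theta == 0%VS by apply/lker0P/theta_inj.
have iW' : inner_ideal (theta @: I)%VS.
  move=> _ /memv_imgP[e eI ->] y; have [x <-] := theta_surj y.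
  by rewrite -[U_ _ _]theta_triple theta_mem; apply: iI.
have W'n : (theta @: I)%VS != fullv.
  apply: contraNneq In => E; apply/eqP/vspaceP => x.
  by rewrite -theta_mem E !memvf.
have W's : exists2 e, e \in (theta @: I)%VS & singular e.
  have [e eI es] := Is; exists (theta e); first by rewrite theta_mem.
  exact/theta_singular.
have [g [W [gA W'E iW cases]]] := split_inner_ideal iW' W'n W's.
have [[gb gt] gker] := gA.
have thK : cancel (theta^-1)%VF theta.
  by move=> y; have [x <-] := theta_surj y; rewrite (lker0_lfunK thker).
pose f := (theta^-1 \o g \o theta)%VF.
have fE (x : A) : theta (f x) = g (theta x) by rewrite !comp_lfunE thK.
have dimI : \dim I = \dim W.
  rewrite -(@limg_dim_eq _ _ _ theta I) ?(eqP thker) ?capv0 // W'E.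
  by apply: limg_dim_eq; rewrite (eqP gker) capv0.
have memI (x : A) : (x \in I) = (theta x \in (g @: W)%VS) by rewrite -W'E theta_mem.
have sI : singular_ideal I <-> singular_ideal W.
  have gs (w : B) : singular (g w) <-> singular w.
    split; last exact: inv_aut_singular.
    by move/(inv_aut_singular (inv_aut_inv gA)); rewrite (lker0_lfunK gker).
  split=> sing x xW xn.
    have [y yE] := theta_surj (g x); apply/gs; rewrite -yE; apply/theta_singular/sing.
      by rewrite memI yE memv_img.
    apply: contra_neq xn => y0; move/lker0P: gker => gi; apply: gi.
    by rewrite -yE y0 theta0 linear0.
  apply/theta_singular; move: xW; rewrite memI => /memv_imgP[w wW wE].
  rewrite wE; apply/gs/sing => //; apply: contra_neq xn => w0.
  by apply: theta_inj; rewrite wE w0 theta0 linear0.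
exists W, f; split=> //.
- split=> [x y|x y z]; first by rewrite !(theta_bform _ _ sE) !fE gb.
  by apply: theta_inj; rewrite fE !(theta_tform _ _ _ sE) !fE gt linearZ.
- apply/vspaceP => x; rewrite memI; apply/memv_imgP/memv_imgP => -[w wW wE].
    have [y yE] := theta_surj w; exists y; first by rewrite -memv_preim yE.
    by apply: theta_inj; rewrite fE yE.
  by exists (theta w); [rewrite memv_preim|rewrite wE fE].
by rewrite dimI; case: cases => [[? [? ?]]|[? [? ?]]]; [left|right]; rewrite sI.
Qed.

(** [singularU], transported along theta. *)
Lemma singular_quadratic : exists L : A -> A -> K,
  (forall (z : A) (a : K) (x y : A), L z (a *: x + y) = a * L z x + L z y) /\
  forall e z : A, singular e -> U_ e z = L z e *: e.
Proof.
exists (fun z e : A => - 2 * b (theta e) (inv_mul skew1 (theta z))); split=> [z a x y|e z es].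
  rewrite thetaD thetaZ; have [a1 [j1 [k1 [c1 ->]]]] := bmP (theta x).
  have [a2 [j2 [k2 [c2 ->]]]] := bmP (theta y).
  have [a3 [j3 [k3 [c3 ->]]]] := bmP (theta z).
  by rewrite skew1_mul bmZ bmD !bform_bm !TE; ring.
apply: theta_inj; rewrite -[LHS]/(theta (triple e z e)) theta_triple thetaZ.
rewrite -[in LHS](skew1K (theta z)); apply: singularU.
exact/theta_singular.
Qed.

End Transport.

End CubicNormStructure.

(** * Leading coordinates of a subspace *)

Section Pivots.
Variables (K : fieldType) (V : vectType K) (phi : nat -> 'Hom(V, K^o)) (w : nat -> int).
Implicit Types (U : {vspace V}) (s : seq nat) (i j : nat).

Definition lead (f : nat -> K) (n : nat) (i : nat) : Prop :=
  f i != 0 /\ forall j, (j < n)%N -> w j < w i -> f j = 0.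

(** Gaussian elimination along the list s: i is kept when the i-th coordinate is not
zero on the subspace of U where the coordinates kept before it vanish. *)
Fixpoint pivots U s : seq nat :=
  if s is i :: s' then
    let U' := (U :&: lker (phi i))%VS in
    if U' == U then pivots U s' else i :: pivots U' s'
  else [::].

Lemma pivots_subseq U s : subseq (pivots U s) s.
Proof.
elim: s U => [//|i s IH] U; rewrite [pivots _ _]/=; case: ifP => _.
  exact: subseq_trans (IH U) (subseq_cons s i).
by rewrite /= eqxx.
Qed.

Lemma dim_pivots U s : (forall x, x \in U -> {in s, forall i, phi i x = 0} -> x = 0) ->
  \dim U = size (pivots U s).
Proof.
elim: s U => [|i s IH] U inj /=.
  apply/eqP; rewrite dimv_eq0 -subv0; apply/subvP => x xU.
  by rewrite (inj x xU) ?mem0v.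
have kerE x : x \in (U :&: lker (phi i))%VS -> x \in U /\ phi i x = 0.
  by rewrite memv_cap memv_ker => /andP[-> /eqP].
case: eqVneq => [EU|NU].
  apply: IH => x xU x0; apply: inj => // j; rewrite inE => /predU1P[->|]; last exact: x0.
  by rewrite -EU in xU; have [] := kerE x xU.
rewrite /= -(IH (U :&: lker (phi i))%VS) => [|x /kerE[xU xi] x0]; last first.
  by apply: inj => // j; rewrite inE => /predU1P[->|] //; exact: x0.
rewrite -(limg_ker_dim (phi i) U) -addn1; congr (_ + _)%N.
apply/eqP; rewrite eqn_leq; apply/andP; split.
  by rewrite (leq_trans (dimvS (subvf _))) // dimvf.
rewrite lt0n; apply: contraNneq NU => d0.
by rewrite eqEdim capvSl -(limg_ker_dim (phi i) U) d0 addn0 leqnn.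
Qed.

Let ltw := [rel i j | w i < w j].

(** With [lead_pivots], the pivots along a list of increasing weights are exactly the
leading coordinates of the elements of U. *)
Lemma pivots_lead U s i : sorted ltw s -> i \in pivots U s ->
  exists2 x, x \in U & phi i x != 0 /\ {in s, forall j, w j < w i -> phi j x = 0}.
Proof.
have tr : transitive ltw by move=> a b c; apply: lt_trans.
elim: s U => [//|k s IH] U /= ps.
have sk : sorted ltw s by exact: path_sorted ps.
have kmin j : j \in s -> w k < w j by move=> js; have /allP/(_ _ js) := order_path_min tr ps.
case: eqVneq => [EU|NU].
  move=> /(IH U sk)[x xU [xi x0]]; exists x => //; split=> // j; rewrite inE => /predU1P[->|]; last exact: x0.
  by move: xU; rewrite -EU memv_cap memv_ker => /andP[_ /eqP].
rewrite inE => /predU1P[->|].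
  have [x xU xk] : exists2 x, x \in U & phi k x != 0.
    have /subvPn[x xU] : ~~ (U <= U :&: lker (phi k))%VS.
      by apply: contraNN NU => sub; rewrite eqEsubv capvSl.
    by rewrite memv_cap xU memv_ker /= => xk; exists x.
  exists x => //; split=> // j; rewrite inE => /predU1P[->|/kmin kj]; first by rewrite ltxx.
  by move/(lt_trans kj); rewrite ltxx.
move=> /(IH _ sk)[x]; rewrite memv_cap memv_ker => /andP[xU /eqP xk] [xi x0].
by exists x => //; split=> // j; rewrite inE => /predU1P[->|] //; exact: x0.
Qed.

Lemma lead_pivots U s i x : sorted ltw s -> i \in s -> x \in U -> phi i x != 0 ->
  {in s, forall j, w j < w i -> phi j x = 0} -> i \in pivots U s.
Proof.
have tr : transitive ltw by move=> a b c; apply: lt_trans.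
elim: s U => [//|k s IH] U /= ps.
have sk : sorted ltw s by exact: path_sorted ps.
have kmin j : j \in s -> w k < w j by move=> js; have /allP/(_ _ js) := order_path_min tr ps.
rewrite inE => /predU1P[->|is_] xU xi x0.
  case: eqP => [EU|_]; last by rewrite mem_head.
  by case/negP: xi; move: xU; rewrite -EU memv_cap memv_ker => /andP[].
have x0s : {in s, forall j, w j < w i -> phi j x = 0}.
  by move=> j js; apply: x0; rewrite inE js orbT.
have xk : phi k x = 0 by apply: x0; rewrite ?mem_head ?kmin.
case: eqP => _; first exact: IH.
by rewrite inE IH ?orbT // memv_cap xU memv_ker xk eqxx.
Qed.

End Pivots.

(** * The 45 lines on 27 points *)

Definition labels : seq nat := iota 0 27.

(** A list entry (i, j, k, s) stands for the monomial (-1)^s x_i x_j x_k of the cubic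
norm. The labels 0, 1, 2 are the diagonal entries, and the label 3 + 8 i + r is the
r-th coefficient of the i-th octonion, that is of its two matrices read by rows. *)
Definition lines : seq (nat * nat * nat * bool) := [::
  (0, 1, 2, false); (0, 3, 6, true); (0, 4, 5, false); (0, 7, 10, false);
  (0, 8, 9, true); (1, 11, 14, true); (1, 12, 13, false); (1, 15, 18, false);
  (1, 16, 17, true); (2, 19, 22, true); (2, 20, 21, false); (2, 23, 26, false);
  (2, 24, 25, true); (3, 11, 19, false); (3, 12, 21, false); (3, 15, 26, false);
  (3, 17, 24, true); (4, 13, 19, false); (4, 14, 21, false); (4, 15, 25, true);
  (4, 17, 23, false); (5, 11, 20, false); (5, 12, 22, false); (5, 16, 26, false);
  (5, 18, 24, true); (6, 13, 20, false); (6, 14, 22, false); (6, 16, 25, true);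
  (6, 18, 23, false); (7, 12, 25, false); (7, 14, 26, false); (7, 17, 20, true);
  (7, 18, 19, false); (8, 11, 25, true); (8, 13, 26, true); (8, 17, 22, true);
  (8, 18, 21, false); (9, 12, 23, true); (9, 14, 24, true); (9, 15, 20, false);
  (9, 16, 19, true); (10, 11, 23, false); (10, 13, 24, false); (10, 15, 22, false);
  (10, 16, 21, true)].

(** The lines in all their orderings: the monomials of the polarized norm. *)
Definition olines : seq (nat * nat * nat * bool) :=
  flatten [seq let: (i, j, k, s) := l in
    [:: (i, j, k, s); (j, k, i, s); (k, i, j, s); (i, k, j, s); (k, j, i, s); (j, i, k, s)]
    | l <- lines].

(** An integer solution of the 45 linear equations of [olines_wt] with distinct values,
i.e. a generic coweight of E6. Any such solution would do. *)
Definition wt (i : nat) : int := nth 0 [:: 20; -21; 1; -15; -9; -11; -5; -2; -13; -7; -18; 19; 8; 13; 2; 15; 11; 10; 6; -4; -8; 7; 3; -1; 5; -6; 0]%Z i.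

(** The trace form pairs the coordinate i with the coordinate [star i], with sign
[star_sign i]. *)
Definition star (i : nat) : nat :=
  if (i < 3)%N then i else ((i - 3) %/ 4 * 4 + 3 + (3 - (i - 3) %% 4))%N.

Definition star_sign (i : nat) : bool :=
  if (i < 3)%N then false else
  ((i - 3) %% 4 \in [:: 1; 2])%N (+) odd ((i - 3) %/ 4)%N.

Definition collinear (i j : nat) : bool := has (fun t => t.1.1 == (i, j)) olines.

Lemma olines_uniq : uniq [seq t.1.1 | t <- olines].
Proof. by vm_compute. Qed.

Lemma olines_labels : {in olines, forall t,
  [/\ (t.1.1.1 < 27)%N, (t.1.1.2 < 27)%N & (t.1.2 < 27)%N]}.
Proof.
have /allP H : all (fun t => [&& (t.1.1.1 < 27)%N, (t.1.1.2 < 27)%N & (t.1.2 < 27)%N]) olines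
  by vm_compute.
by move=> t /H /and3P.
Qed.

Lemma olines_wt : {in olines, forall t, wt t.1.1.1 + wt t.1.1.2 + wt t.1.2 = 0}.
Proof.
have /allP H : all (fun t => wt t.1.1.1 + wt t.1.1.2 + wt t.1.2 == 0) olines by vm_compute.
by move=> t /H /eqP.
Qed.

Lemma olines_rot i j k s : ((i, j, k, s) \in olines) = ((j, k, i, s) \in olines).
Proof.
have /allP H : all (fun t : nat * nat * nat * bool => let: (i, j, k, s) := t in
  (j, k, i, s) \in olines) olines by vm_compute.
by apply/idP/idP => /H // /H.
Qed.

Lemma olines_swap i j k s : ((i, j, k, s) \in olines) = ((j, i, k, s) \in olines).
Proof.
have /allP H : all (fun t : nat * nat * nat * bool => let: (i, j, k, s) := t in
  (j, i, k, s) \in olines) olines by vm_compute.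
by apply/idP/idP => /H // /H.
Qed.

Lemma star_lt i : (i < 27)%N -> (star i < 27)%N.
Proof.
have /allP H : all (fun i => (star i < 27)%N) labels by vm_compute.
by move=> i27; apply: H; rewrite mem_iota.
Qed.

Lemma starK i : (i < 27)%N -> star (star i) = i.
Proof.
have /allP H : all (fun i => star (star i) == i) labels by vm_compute.
by move=> i27; apply/eqP/H; rewrite mem_iota.
Qed.

Lemma star_sign_star i : (i < 27)%N -> star_sign (star i) = star_sign i.
Proof.
have /allP H : all (fun i => star_sign (star i) == star_sign i) labels by vm_compute.
by move=> i27; apply/eqP/H; rewrite mem_iota.
Qed.

(** The polarity [star] preserves the signed monomials, so the cubic form has the same
coefficients in the dual coordinates. *)
Lemma olines_star : perm_eq olines
  [seq (star t.1.1.1, star t.1.1.2, star t.1.2,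
        t.2 (+) star_sign t.1.1.1 (+) star_sign t.1.1.2 (+) star_sign t.1.2) | t <- olines].
Proof. by vm_compute. Qed.

Lemma wt_sorted_ex : {s : seq nat | perm_eq s labels & sorted [rel i j | wt i < wt j] s}.
Proof.
by exists (sort [rel i j | wt i <= wt j] labels); vm_compute.
Qed.

(** The largest size of a sublist of s without collinear pairs, by branching on the
head of s; the fuel bounds the length of s. *)
Fixpoint max_free (fuel : nat) (s : seq nat) : nat :=
  if fuel is n.+1 then
    if s is i :: s' then
      maxn (max_free n s') (max_free n [seq j <- s' | ~~ collinear i j]).+1
    else 0%N
  else 0%N.

Lemma max_freeP n s r : (size s <= n)%N -> subseq r s ->
  pairwise (fun i j => ~~ collinear i j) r -> (size r <= max_free n s)%N.
Proof.
elim: n s r => [|n IH] [|i s] r //=; rewrite ?ltnS.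
- by move=> _ /eqP ->.
- by move=> _ /eqP ->.
case: r => [|k r] //= sz; case: eqP => [->|_].
  move=> sub /andP[ir pr]; rewrite leq_max; apply/orP; right; rewrite ltnS.
  apply: IH => //; last by rewrite subseq_filter ir.
  by rewrite (leq_trans _ sz) // size_filter count_size.
move=> sub pr; rewrite leq_max; apply/orP; left; exact: IH sub pr.
Qed.

(** A partial ovoid of the generalized quadrangle of order (2, 4) has at most 6 points. *)
Lemma free_size r : uniq r -> {subset r <= labels} ->
  {in r &, forall i j, i != j -> ~~ collinear i j} -> (size r <= 6)%N.
Proof.
move=> ur rl rf.
have pr : perm_eq r [seq i <- labels | i \in r].
  apply: uniq_perm => //; first by rewrite filter_uniq ?iota_uniq.
  by move=> i; rewrite mem_filter; case: (boolP (i \in r)) => //= /rl ->.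
rewrite (perm_size pr).
have -> : 6%N = max_free 27 labels by vm_compute.
apply: max_freeP => //; first exact: filter_subseq.
set r' := [seq i <- _ | _].
have ur' : uniq r' by rewrite filter_uniq ?iota_uniq.
have : {subset r' <= r} by move=> i; rewrite mem_filter => /andP[].
elim: r' ur' => //= i s IH /andP[is_ us] sr; rewrite IH ?andbT //; last first.
  by move=> j js; apply: sr; rewrite inE js orbT.
apply/allP => j js; apply: rf; rewrite ?sr ?mem_head ?inE ?js ?orbT //.
by apply: contraNneq is_ => ->.
Qed.

Definition neighbours (i : nat) : seq nat := [seq j <- labels | collinear i j].
(** A table of neighbours, so that the checks below compute each of them once. *)
Definition adjacency : seq (seq nat) := [seq neighbours i | i <- labels].

Lemma mem_neighbours i j : (i < 27)%N -> (j < 27)%N ->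
  (j \in nth [::] adjacency i) = collinear i j.
Proof.
move=> i27 j27; rewrite (nth_map 0%N) ?size_iota // nth_iota // add0n.
by rewrite mem_filter mem_iota /= add0n j27 andbT.
Qed.

Lemma in_filterP (T : eqType) (a : pred T) x s : x \in filter a s -> a x /\ x \in s.
Proof. by rewrite mem_filter => /andP. Qed.

Lemma in_undupP (T : eqType) (x : T) s : x \in undup s -> x \in s.
Proof. by rewrite mem_undup. Qed.

(** The statements of [non_collinear_link] and [non_collinear_clash] as tests on the
table A of neighbours. *)
Definition link_ok (A : seq (seq nat)) i k :=
  [|| i == k, k \in nth [::] A i | has (fun t : nat * nat * nat * bool =>
     (t.1.1.1 \in nth [::] A i) && (t.1.2 != i)) [seq t <- olines | t.1.1.2 == k]].

Definition clash_ok (A : seq (seq nat)) i k :=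
  [|| i == k, k \in nth [::] A i | let N := nth [::] A i ++ nth [::] A k in
    let Z := undup [seq t.1.2 | t : nat * nat * nat * bool <-
       [seq t : nat * nat * nat * bool <- olines | (t.1.1.1 \in N) && (t.1.1.2 \in N)]] in
    has (fun z => has (fun z' => z' \in nth [::] A z) Z) Z].

Lemma all_labels2 (P : nat -> nat -> bool) : all (fun i => all (P i) labels) labels ->
  forall i k, (i < 27)%N -> (k < 27)%N -> P i k.
Proof.
move=> /allP H i k i27 k27; have /H/allP/(_ k) : i \in labels by rewrite mem_iota.
by apply; rewrite mem_iota.
Qed.

(** Some neighbour m of i is collinear with k, and the third point of the line through
m and k is not i. In [point_ideal] this excludes leading points k of V that are
not collinear with i. *)
Lemma non_collinear_link i k : (i < 27)%N -> (k < 27)%N -> i != k -> ~~ collinear i k ->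
  exists t, [/\ t \in olines, t.1.1.2 = k, collinear i t.1.1.1 & t.1.2 != i].
Proof.
have H : all (fun i => all (link_ok adjacency i) labels) labels by vm_compute.
move=> i27 k27 ik cik; case/or3P: (all_labels2 H i27 k27) => [ik'|ki|/hasP[t]].
- by rewrite ik' in ik.
- by rewrite -(mem_neighbours i27 k27) ki in cik.
case/in_filterP=> /eqP tk tO /andP[it ti].
exists t; split=> [//|//||//]; have [t1 _ _] := olines_labels tO; by rewrite -(mem_neighbours i27 t1).
Qed.

(** Among the third points of lines that have two points collinear with i or k, there
are two collinear ones. In [point_ideal] this excludes that J1 has two leading
points. *)
Lemma non_collinear_clash i k : (i < 27)%N -> (k < 27)%N -> i != k -> ~~ collinear i k ->
  exists t1 t2, let nb m := collinear i m || collinear k m in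
  [/\ t1 \in olines /\ t2 \in olines, nb t1.1.1.1 && nb t1.1.1.2, nb t2.1.1.1 && nb t2.1.1.2 &
    collinear t1.1.2 t2.1.2].
Proof.
have H : all (fun i => all (clash_ok adjacency i) labels) labels by vm_compute.
move=> i27 k27 ik cik; case/or3P: (all_labels2 H i27 k27) => [ik'|ki|/hasP[z]].
- by rewrite ik' in ik.
- by rewrite -(mem_neighbours i27 k27) ki in cik.
move=> /in_undupP/mapP[t1 t1Z ->] /hasP[z' /in_undupP/mapP[t2 t2Z ->]].
move=> c; have [/andP[n1 n1'] o1] := in_filterP t1Z.
have [/andP[n2 n2'] o2] := in_filterP t2Z.
have [a1 b1 c1] := olines_labels o1; have [a2 b2 c2] := olines_labels o2.
have nbP m : (m < 27)%N -> m \in nth [::] adjacency i ++ nth [::] adjacency k ->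
    collinear i m || collinear k m.
  move=> m27; rewrite mem_cat => /orP[mi|mk]; apply/orP.
    by left; rewrite -(mem_neighbours i27 m27).
  by right; rewrite -(mem_neighbours k27 m27).
exists t1, t2; split; last by rewrite -(mem_neighbours c1 c2).
- by split.
- by apply/andP; split; [exact: nbP a1 n1|exact: nbP b1 n1'].
- by apply/andP; split; [exact: nbP a2 n2|exact: nbP b2 n2'].
Qed.

Lemma neighbours_size i : (i < 27)%N -> size (neighbours i) = 10%N.
Proof.
have /allP H : all (fun i => size (neighbours i) == 10%N) labels
  by vm_compute.
by move=> i27; apply/eqP/H; rewrite mem_iota.
Qed.

(** * Coordinates of the Albert algebra *)

Lemma uniq_map_inj (S U : eqType) (f : S -> U) s :
  uniq [seq f x | x <- s] -> {in s &, injective f}.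
Proof.
elim: s => //= a s IH /andP[as_ us] x y; rewrite !inE.
case/predU1P=> [->|xs] /predU1P[->|ys] // fxy; last exact: IH.
  by case/negP: as_; rewrite fxy map_f.
by case/negP: as_; rewrite -fxy map_f.
Qed.

Section LeadingTerms.
Variables (K : fieldType) (O : seq (nat * nat * nat * bool)) (w : nat -> int) (n : nat).

Definition delta (m k : nat) : K := (k == m)%:R.

Definition trilin (f g h : nat -> K) : K :=
  \sum_(t <- O) (-1) ^+ t.2 * f t.1.1.1 * g t.1.1.2 * h t.1.2.

Hypothesis O_uniq : uniq [seq t.1.1 | t <- O].
Hypothesis O_lt : {in O, forall t, [/\ (t.1.1.1 < n)%N, (t.1.1.2 < n)%N & (t.1.2 < n)%N]}.
Hypothesis O_wt : {in O, forall t, w t.1.1.1 + w t.1.1.2 + w t.1.2 = 0}.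
Hypothesis w_inj : forall i j, (i < n)%N -> (j < n)%N -> w i = w j -> i = j.

(** Weights add to zero on every line. So, among the lines that end in a point of
weight at least that of m, only the line through i, j and m can give a product of
two nonvanishing coordinates of f and g. *)
Lemma lead_mul (f g : nat -> K) i j m s : lead w f n i -> lead w g n j ->
  (i, j, m, s) \in O -> lead (fun a => - w a) (fun a => trilin f g (delta a)) n m.
Proof.
move=> [fi f0] [gj g0] tO; have [i27 j27 m27] := O_lt tO.
have wm : w m = - (w i + w j) by apply/eqP; rewrite -subr_eq0 opprK addrC (O_wt tO).
have term0 t a : t \in O -> w m <= w a -> (t != (i, j, m, s)) || (w m < w a) ->
    (-1) ^+ t.2 * f t.1.1.1 * g t.1.1.2 * delta a t.1.2 = 0.
  move=> tO' ma ne; rewrite /delta; case: eqP => [ta|]; last by rewrite mulr0.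
  have [t1 t2 _] := O_lt tO'; have := O_wt tO'; rewrite ta => /eqP.
  rewrite addr_eq0 => /eqP wt.
  have le : w t.1.1.1 + w t.1.1.2 <= w i + w j by rewrite wt lerNl -wm.
  case: (ltP (w t.1.1.1) (w i)) => [lt1|ge1]; first by rewrite f0 // !mulr0 !mul0r.
  case: (ltP (w t.1.1.2) (w j)) => [lt2|ge2]; first by rewrite (g0 _ t2) // mulr0 !mul0r.
  have e1 : w t.1.1.1 = w i.
    by apply/eqP; rewrite eq_le ge1 andbT -(lerD2r (w j)) (le_trans _ le) // lerD2l.
  have e2 : w t.1.1.2 = w j.
    by apply/eqP; rewrite eq_le ge2 andbT -(lerD2l (w i)) (le_trans _ le) // e1.
  case/orP: ne => [|ltm].
    case/eqP; apply: (uniq_map_inj O_uniq) => //=.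
    by rewrite [LHS]surjective_pairing (w_inj t1 i27 e1) (w_inj t2 j27 e2).
  by move: ltm; rewrite wm -e1 -e2 wt opprK ltxx.
split=> [|a a27]; last first.
  rewrite ltrN2 => ma; rewrite /trilin big_seq big1 // => t tO'.
  by apply: term0; rewrite ?(ltW ma) ?ma ?orbT.
have uO : uniq O by exact: map_uniq O_uniq.
rewrite /trilin (bigD1_seq _ tO uO) /= big_seq_cond big1 => [|t /andP[tO' ne]].
  by rewrite /delta eqxx mulr1 addr0 !mulf_neq0 // signr_eq0.
by apply: term0; rewrite ?lexx ?ne.
Qed.

End LeadingTerms.

Section AlbertCoordinates.
Variable K : fieldType.
Hypothesis K2 : 2%:R != 0 :> K.
Implicit Types (x y z : albert K) (f : nat -> K).
Local Notation T := (@atrform K).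

Definition coord27 x (m : nat) : K := nth 0
  [:: x.1 0 0; x.1 0 1; x.1 0 (1+1);
   (x.2 0).1 0 0; (x.2 0).1 0 1; (x.2 0).1 1 0; (x.2 0).1 1 1;
   (x.2 0).2 0 0; (x.2 0).2 0 1; (x.2 0).2 1 0; (x.2 0).2 1 1;
   (x.2 1).1 0 0; (x.2 1).1 0 1; (x.2 1).1 1 0; (x.2 1).1 1 1;
   (x.2 1).2 0 0; (x.2 1).2 0 1; (x.2 1).2 1 0; (x.2 1).2 1 1;
   (x.2 (1+1)).1 0 0; (x.2 (1+1)).1 0 1; (x.2 (1+1)).1 1 0; (x.2 (1+1)).1 1 1;
   (x.2 (1+1)).2 0 0; (x.2 (1+1)).2 0 1; (x.2 (1+1)).2 1 0; (x.2 (1+1)).2 1 1] m.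

Definition vec27 f : albert K :=
  (\row_i f i, [ffun i : 'I_3 =>
    (mx2 (f (3 + 8 * i)) (f (4 + 8 * i)) (f (5 + 8 * i)) (f (6 + 8 * i)),
     mx2 (f (7 + 8 * i)) (f (8 + 8 * i)) (f (9 + 8 * i)) (f (10 + 8 * i)))%N]).

Lemma coord27_linear m : linear (coord27^~ m : albert K -> K^o).
Proof.
move=> c x y; rewrite /coord27 /= !ffunE /= !mxE.
by do 27!case: m => [//|m]; rewrite /= !nth_nil scaler0 addr0.
Qed.

Lemma vec27K f m : (m < 27)%N -> coord27 (vec27 f) m = f m.
Proof.
rewrite /coord27 /vec27 /= !ffunE /= !mxE /=.
by do 27!case: m => [//|m].
Qed.

Lemma coord27K x : vec27 (coord27 x) = x.
Proof.
case: x => u a; congr pair.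
  by apply/rowP => i; rewrite mxE; case: (I3P i) => ->.
by apply/ffunP => i; rewrite ffunE; case: (I3P i) => ->; rewrite /coord27 /=;
  [case: (a 0)|case: (a 1)|case: (a (1+1))] => A B; congr pair; rewrite /= -mx2P.
Qed.

Lemma atrform_coord x y : T x y =
  \sum_(m <- labels) (-1) ^+ star_sign m * coord27 x m * coord27 y (star m).
Proof.
rewrite (atrformE K2) sum3.
rewrite /labels /= !big_cons big_nil /coord27 /=.
move: (x.1 0 0) (x.1 0 1) (x.1 0 (1+1)) (y.1 0 0) (y.1 0 1) (y.1 0 (1+1)).
move: (x.2 0) (x.2 1) (x.2 (1+1)) (y.2 0) (y.2 1) (y.2 (1+1)).
clear=> a0 a1 a2 b0 b1 b2 x0 x1 x2 y0 y1 y2.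
have E (a b : oct K) : otr (omul a (oconj b)) =
   a.1 0 0 * b.1 1 1 - a.1 0 1 * b.1 1 0 - a.1 1 0 * b.1 0 1 + a.1 1 1 * b.1 0 0
   - a.2 0 0 * b.2 1 1 + a.2 0 1 * b.2 1 0 + a.2 1 0 * b.2 0 1 - a.2 1 1 * b.2 0 0.
  by case: a => A B; case: b => C D; rewrite /= [in LHS](mx2P A) [in LHS](mx2P B)
     [in LHS](mx2P C) [in LHS](mx2P D); oc; ring.
rewrite !E; move: (a0.1) (a0.2) (a1.1) (a1.2) (a2.1) (a2.2) => A A' B B' C C'.
move: (b0.1) (b0.2) (b1.1) (b1.2) (b2.1) (b2.2) => D D' G G' H H'.
ring.
Qed.

Lemma otr_mul_conj_coord a0 a1 a2 a3 a4 a5 a6 a7 b0 b1 b2 b3 b4 b5 b6 b7 : 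
 otr (omul (mx2 a0 a1 a2 a3, mx2 a4 a5 a6 a7) (oconj (mx2 b0 b1 b2 b3, mx2 b4 b5 b6 b7))) =
   a0 * b3 - a1 * b2 - a2 * b1 + a3 * b0 - a4 * b7 + a5 * b6 + a6 * b5 - a7 * b4 :> K.
Proof. by oc; ring. Qed.

Lemma otr_mul3_coord a0 a1 a2 a3 a4 a5 a6 a7 b0 b1 b2 b3 b4 b5 b6 b7 c0 c1 c2 c3 c4 c5 c6 c7 : 
 otr (omul (omul (mx2 a0 a1 a2 a3, mx2 a4 a5 a6 a7) (mx2 b0 b1 b2 b3, mx2 b4 b5 b6 b7))
   (mx2 c0 c1 c2 c3, mx2 c4 c5 c6 c7)) =
   (a0 * b0 + a1 * b2 + b7 * a4 - b5 * a6) * c0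
   + (a0 * b1 + a1 * b3 + b7 * a5 - b5 * a7) * c2
   + (a2 * b0 + a3 * b2 + b4 * a6 - b6 * a4) * c1
   + (a2 * b1 + a3 * b3 + b4 * a7 - b6 * a5) * c3
   + (b4 * a0 + b5 * a2 + a4 * b3 - a5 * b2) * c7
   - (b4 * a1 + b5 * a3 + a5 * b0 - a4 * b1) * c6
   - (b6 * a0 + b7 * a2 + a6 * b3 - a7 * b2) * c5
   + (b6 * a1 + b7 * a3 + a7 * b0 - a6 * b1) * c4 :> K.
Proof. by oc; ring. Qed.

#[local] Opaque otr omul oconj onorm.

(** The coordinates are variables here, so this is a single polynomial identity. *)
Lemma across_vec27 f g h :
  T (across (vec27 f) (vec27 g)) (vec27 h) = trilin olines f g h.
Proof.
rewrite (across_form K2) sum3 ?ord3E /trilin /olines big_flatten big_map.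
transitivity (\sum_(l <- lines) (-1) ^+ l.2 *
   (f l.1.1.1 * (g l.1.1.2 * h l.1.2 + g l.1.2 * h l.1.1.2)
  + f l.1.1.2 * (g l.1.1.1 * h l.1.2 + g l.1.2 * h l.1.1.1)
  + f l.1.2 * (g l.1.1.1 * h l.1.1.2 + g l.1.1.2 * h l.1.1.1))); last first.
  apply: eq_bigr => -[[[i j] k] s] _; rewrite !big_cons big_nil /=.
  by move: ((-1) ^+ s) (f i) (f j) (f k) (g i) (g j) (g k) (h i) (h j) (h k) => *; ring.
rewrite /vec27 /= !mxE !ffunE /=.
rewrite !otr_mul_conj_coord !otr_mul3_coord.
rewrite /lines !big_cons big_nil /=.
ring.
Qed.

Lemma across_coord x y z :
  T (across x y) z = trilin olines (coord27 x) (coord27 y) (coord27 z).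
Proof. by rewrite -across_vec27 !coord27K. Qed.

#[local] Transparent otr omul oconj onorm.

(** The product [across] takes the coordinates of its factors to dual coordinates
([dual27_across]) and dual coordinates to coordinates ([coord27_across]), by the
same trilinear form. *)
Definition dual27 x (m : nat) : K := T x (vec27 (delta K m)).

Lemma dual27E x m : (m < 27)%N -> dual27 x m = (-1) ^+ star_sign m * coord27 x (star m).
Proof.
move=> m27; have s27 := star_lt m27; rewrite /dual27 atrform_coord.
rewrite (bigD1_seq (star m)) ?iota_uniq ?mem_iota //= starK // vec27K // /delta eqxx mulr1.
rewrite star_sign_star // big_seq_cond big1 ?addr0 // => a /andP[]; rewrite mem_iota /= add0n => a27 am.
rewrite vec27K ?star_lt // /delta; case: eqP => [sa|]; last by rewrite mulr0.
by case/eqP: am; rewrite -sa starK.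
Qed.

Lemma atrform_dual x y : T x y = \sum_(m <- labels) coord27 x m * dual27 y m.
Proof.
rewrite atrform_coord; apply: eq_big_seq => m; rewrite mem_iota /= add0n => m27.
by rewrite dual27E // mulrCA mulrA.
Qed.

Lemma across_dual x y z :
  T (across x y) z = trilin olines (dual27 x) (dual27 y) (dual27 z).
Proof.
rewrite across_coord /trilin (perm_big _ olines_star) big_map.
apply: eq_big_seq => t tO /=; have [t1 t2 t3] := olines_labels tO.
rewrite !dual27E // !signr_addb.
move: (_ ^+ t.2) (_ ^+ star_sign t.1.1.1) (_ ^+ star_sign t.1.1.2) (_ ^+ star_sign t.1.2).
by move: (coord27 x _) (coord27 y _) (coord27 z _) => *; ring.
Qed.

Definition basis27 (m : nat) : albert K := vec27 (delta K m).
Definition cobasis27 (m : nat) : albert K := (-1) ^+ star_sign m *: vec27 (delta K (star m)).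

Lemma coord27_cobasis x m : (m < 27)%N -> coord27 x m = T x (cobasis27 m).
Proof.
move=> m27; rewrite (atrformC K2) (atrformZl K2) (atrformC K2) -/(dual27 x (star m)).
rewrite dual27E ?star_lt // starK // star_sign_star // mulrA -signr_addb addbb.
by rewrite mul1r.
Qed.

Lemma eq_trilin (f f' g g' h h' : nat -> K) :
  (forall m, (m < 27)%N -> f m = f' m) -> (forall m, (m < 27)%N -> g m = g' m) ->
  (forall m, (m < 27)%N -> h m = h' m) -> trilin olines f g h = trilin olines f' g' h'.
Proof.
move=> ff gg hh; apply: eq_big_seq => t /olines_labels[t1 t2 t3].
by rewrite ff // gg // hh.
Qed.

Lemma dual27_across x y m : dual27 (across x y) m = trilin olines (coord27 x) (coord27 y) (delta K m).
Proof.
by rewrite /dual27 across_coord; apply: eq_trilin => // k k27; rewrite vec27K.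
Qed.

Lemma coord27_across x y m : (m < 27)%N ->
  coord27 (across x y) m = trilin olines (dual27 x) (dual27 y) (delta K m).
Proof.
move=> m27; rewrite coord27_cobasis // across_dual; apply: eq_trilin => // k k27.
rewrite /dual27 (atrformC K2) -coord27_cobasis // vec27K // /delta.
by rewrite eq_sym.
Qed.
End AlbertCoordinates.

(** * Totally singular subspaces and point ideals *)

Section AlbertSubspaces.
Variable K : fieldType.
Hypothesis K2 : 2%:R != 0 :> K.
Hypothesis K3 : 3%:R != 0 :> K.
Implicit Types (x y z : albert K) (V : {vspace albert K}).
Local Notation T := (@atrform K).
Local Notation O := (olines).
Let cnsJ := albert_cns K2.

Lemma basis27_singular m : sharp (basis27 K m) = 0.
Proof.
apply: (scal_inj K2); rewrite scaler0 -(mu_diag cnsJ); apply: (cns_nd cnsJ) => z.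
rewrite (across_coord K2) /trilin big_seq big1 // => t tO; have [t1 t2 _] := olines_labels tO.
have /allP H : all (fun t : nat * nat * nat * bool => t.1.1.1 != t.1.1.2) olines by vm_compute.
rewrite !vec27K // /delta; case: eqP => [e1|]; last by rewrite !mulr0 !mul0r.
case: eqP => [e2|]; last by rewrite !mulr0 !mul0r.
by have := H t tO; rewrite /= e1 e2 eqxx.
Qed.

Lemma basis27_expand x : x = \sum_(m <- labels) coord27 x m *: basis27 K m.
Proof.
apply: (cns_inj cnsJ) => z; rewrite (atrform_dual K2) (trace_suml cnsJ).
by apply: eq_bigr => m _; rewrite /dual27 (atrformC K2).
Qed.

Lemma albert_sing_span x : exists2 s : seq (albert K),
  (forall u, u \in s -> sharp u = 0) & x = \sum_(u <- s) u.
Proof.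
exists [seq coord27 x m *: basis27 K m | m <- labels].
  by move=> u /mapP[m _ ->]; rewrite (sharpZ K2) basis27_singular scaler0.
by rewrite big_map -basis27_expand.
Qed.

Lemma albert_norm_neq0 : exists x : albert K, anorm x != 0.
Proof.
exists (const_mx 1, 0); rewrite /anorm prod3 sum3 /= !mxE !ffunE.
have -> : onorm (0 : oct K) = 0 by rewrite -(scale0r (0 : oct K)) onormZ expr0n mul0r.
have -> : otr (omul (omul 0 0) 0) = 0 :> K by rewrite -(scale0r (0 : oct K)) omulZr otrZ mul0r.
by rewrite !(mulr0, addr0, subr0, mulr1) oner_eq0.
Qed.

Lemma wt_inj i j : (i < 27)%N -> (j < 27)%N -> wt i = wt j -> i = j.
Proof.
have U : uniq [seq wt i | i <- labels] by vm_compute.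
by move=> i27 j27 e; apply: (uniq_map_inj U) => //; rewrite mem_iota.
Qed.

Lemma olines_wtN : {in olines, forall t, - wt t.1.1.1 + - wt t.1.1.2 + - wt t.1.2 = 0}.
Proof. by move=> t tO; rewrite -!opprD (olines_wt tO) oppr0. Qed.

Lemma wtN_inj i j : (i < 27)%N -> (j < 27)%N -> - wt i = - wt j -> i = j.
Proof. by move=> i27 j27 /oppr_inj; apply: wt_inj. Qed.

(** For the coordinates dual to those of [leadJ] the weights are negated, so that
[leadJ_across] and [leadD_across] are both instances of [lead_mul]. *)
Definition leadJ x i := lead wt (coord27 x) 27 i.
Definition leadD x i := lead (fun i => - wt i) (dual27 x) 27 i.

Lemma leadJ_across x y i j m s : leadJ x i -> leadJ y j -> (i, j, m, s) \in olines ->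
  leadD (across x y) m.
Proof.
move=> xi yj tO; have [m0 mz] := lead_mul olines_uniq olines_labels olines_wt wt_inj xi yj tO.
by split=> [|k k27 km]; rewrite (dual27_across K2) //; apply: mz.
Qed.

Lemma leadD_across x y i j m s : leadD x i -> leadD y j -> (i, j, m, s) \in olines ->
  leadJ (across x y) m.
Proof.
move=> xi yj tO; have [_ _ m27] := olines_labels tO.
have [m0 mz] := lead_mul olines_uniq olines_labels olines_wtN wtN_inj xi yj tO.
by split=> [|k k27 km]; rewrite (coord27_across K2) //; apply: mz; rewrite ?opprK.
Qed.

Lemma lead_atrform x y i : (i < 27)%N -> leadJ x i -> leadD y i -> T x y != 0.
Proof.
move=> i27 [xi x0] [yi y0]; rewrite (atrform_dual K2).
rewrite (bigD1_seq i) ?iota_uniq ?mem_iota //= big_seq_cond big1 ?addr0 ?mulf_neq0 //.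
move=> a /andP[]; rewrite mem_iota /= add0n => a27 ai.
case: (ltgtP (wt a) (wt i)) => [lt|gt|/(wt_inj a27 i27)/eqP]; last by rewrite (negPf ai).
  by rewrite x0 // mul0r.
by rewrite (y0 a) ?mulr0 // ltrN2.
Qed.

Lemma leadJ_basis i : (i < 27)%N -> leadJ (basis27 K i) i.
Proof.
move=> i27; split=> [|j j27 ji]; rewrite vec27K // /delta ?eqxx ?oner_eq0 //.
by case: eqP ji => // ->; rewrite ltxx.
Qed.

Lemma leadJ_ex (V : {vspace albert K}) : {P : seq nat |
  [/\ uniq P, {subset P <= labels}, \dim V = size P,
     {in P, forall i, exists2 x, x \in V & leadJ x i} &
     forall x i, x \in V -> (i < 27)%N -> leadJ x i -> i \in P]}.
Proof.
pose phi m := sval (linfunP (coord27_linear (K := K) m)).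
have phiE m x : phi m x = coord27 x m by rewrite /phi; case: linfunP.
have [s sl ss] := wt_sorted_ex; exists (pivots phi V s).
have us : uniq s by rewrite (perm_uniq sl) iota_uniq.
have ms i : (i \in s) = (i < 27)%N by rewrite (perm_mem sl) mem_iota.
split.
- exact: subseq_uniq (pivots_subseq _ _ _) us.
- by move=> i /(mem_subseq (pivots_subseq _ _ _)); rewrite (perm_mem sl).
- apply: dim_pivots => x _ x0; rewrite -(coord27K x) -[RHS]coord27K.
  congr vec27; apply/funext => m.
  case: (ltnP m 27) => m27.
    by rewrite -!phiE x0 ?ms // linear0.
  by rewrite /coord27 !nth_default.
- move=> i /(pivots_lead ss)[x xV []]; rewrite phiE => xi x0; exists x => //.
  by split=> // j j27 ji; rewrite -phiE x0 ?ms.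
move=> x i xV i27 [xi x0]; apply: (lead_pivots ss _ xV); rewrite ?ms ?phiE //.
by move=> j; rewrite ms phiE; apply: x0.
Qed.

Lemma leadD_ex (V : {vspace albert K}) : {P : seq nat |
  [/\ uniq P, {subset P <= labels}, \dim V = size P,
     {in P, forall i, exists2 x, x \in V & leadD x i} &
     forall x i, x \in V -> (i < 27)%N -> leadD x i -> i \in P]}.
Proof.
have dl m : linear (fun x => dual27 x m : K^o).
  by move=> c x y; rewrite /dual27 (TDl cnsJ) (TZl cnsJ).
pose phi m := sval (linfunP (dl m)).
have phiE m x : phi m x = dual27 x m by rewrite /phi; case: linfunP.
have [s0 sl0 ss0] := wt_sorted_ex; pose s := rev s0.
have sl : perm_eq s labels by rewrite perm_rev.
have ss : sorted [rel i j | - wt i < - wt j] s.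
  rewrite /s rev_sorted; apply: sub_sorted ss0 => i j /=; by rewrite ltrN2.
exists (pivots phi V s).
have us : uniq s by rewrite (perm_uniq sl) iota_uniq.
have ms i : (i \in s) = (i < 27)%N by rewrite (perm_mem sl) mem_iota.
split.
- exact: subseq_uniq (pivots_subseq _ _ _) us.
- by move=> i /(mem_subseq (pivots_subseq _ _ _)); rewrite (perm_mem sl).
- apply: dim_pivots => x _ x0; apply: (cns_nd cnsJ) => z; rewrite (atrformC K2) (atrform_dual K2).
  rewrite big_seq big1 // => m; rewrite mem_iota /= add0n => m27.
  by rewrite -phiE x0 ?ms // mulr0.
- move=> i /(pivots_lead ss)[x xV [xi x0]]; exists x; first exact: xV.
  split=> [|j j27 ji]; first by rewrite -phiE.
  by rewrite -phiE; apply: x0 => //; rewrite ms.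
move=> x i xV i27 [xi x0]; apply: (lead_pivots ss _ xV).
- by rewrite ms.
- by rewrite phiE.
by move=> j js ji; rewrite phiE; apply: x0 => //; rewrite -ms.
Qed.

Lemma collinearP i j : collinear i j -> exists m s, (i, j, m, s) \in olines.
Proof. by case/hasP => -[[ij m] s] tO /eqP /= E; exists m, s; rewrite -E. Qed.

Lemma lead_neq0 x i : leadD x i -> x != 0.
Proof. by case=> xi _; apply: contraNneq xi => ->; rewrite /dual27 (T0l cnsJ). Qed.

Lemma totally_singular_across V x y : totally_singular V -> x \in V -> y \in V -> across x y = 0.
Proof. by move=> tV xV yV; rewrite /across !tV ?rpredD // !subr0. Qed.

(** Two leading points on a line would give x and y in V for which [across x y] is not
zero. *)
Lemma totally_singular_dim V : totally_singular V -> (\dim V <= 6)%N.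
Proof.
move=> tV; have [P [uP Pl -> Plead _]] := leadJ_ex V.
apply: free_size => // i j iP jP _; apply/negP => /collinearP[m [s tO]].
have [x xV xi] := Plead _ iP; have [y yV yj] := Plead _ jP.
have /lead_neq0 := leadJ_across xi yj tO.
by rewrite (totally_singular_across tV) ?eqxx.
Qed.

(** A and B below are the leading points of J1 and V. Points of A are pairwise not
collinear, since their neighbours lie in B, which is disjoint from A. *)
Lemma point_ideal (J1 V : {vspace albert K}) d :
  (forall j q, j \in J1 -> across j q \in V) ->
  (forall j k, j \in J1 -> k \in V -> T j k = 0) ->
  (forall k, k \in V -> sharp k \in J1) ->
  d \in J1 -> d != 0 ->
  [/\ J1 = <[d]>%VS, \dim V = 10%N & forall k, k \in V <-> exists y, k = across d y].
Proof.
move=> JV TJV VJ dJ dn.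
have VVJ x y : x \in V -> y \in V -> across x y \in J1.
  by move=> xV yV; rewrite /across !rpredB ?VJ ?rpredD.
have [A [uA Al dimA Alead leadA]] := leadJ_ex J1.
have [B [uB Bl dimB Blead leadB]] := leadD_ex V.
have lab i : i \in labels -> (i < 27)%N by rewrite mem_iota.
have AB i : i \in A -> i \in B -> False.
  move=> iA iB; have [x xJ xi] := Alead i iA; have [y yV yi] := Blead i iB.
  by have /eqP[] := lead_atrform (lab _ (Al _ iA)) xi yi; rewrite TJV.
have rot i j m s : (i, j, m, s) \in olines -> (i, m, j, s) \in olines.
  by rewrite olines_swap olines_rot.
have Anb i j : i \in A -> collinear i j -> j \in B.
  move=> iA /collinearP[m [s tO]]; have := rot _ _ _ _ tO => {}tO.
  have [_ /= m27 j27] := olines_labels tO; have [x xJ xi] := Alead i iA.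
  exact: leadB (JV _ (basis27 K m) xJ) j27 (leadJ_across xi (leadJ_basis m27) tO).
have BBA i j m s : (i, j, m, s) \in olines -> i \in B -> j \in B -> m \in A.
  move=> tO iB jB; have [_ _ /= m27] := olines_labels tO.
  have [x xV xi] := Blead i iB; have [y yV yj] := Blead j jB.
  exact: leadA (VVJ _ _ xV yV) m27 (leadD_across xi yj tO).
have AA i j : i \in A -> j \in A -> ~~ collinear i j.
  by move=> iA jA; apply/negP => cij; apply: (AB j jA); apply: Anb iA cij.
have A1 i j : i \in A -> j \in A -> i = j.
  move=> iA jA; apply/eqP/contraT => ij.
  have [t1 [t2 /= [[o1 o2] /andP[n1 n1'] /andP[n2 n2'] c]]] :=
    non_collinear_clash (lab _ (Al _ iA)) (lab _ (Al _ jA)) ij (AA _ _ iA jA).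
  have nB m : collinear i m || collinear j m -> m \in B.
    by case/orP; apply: Anb.
  case: t1 o1 n1 n1' c => [[[a1 b1] c1] s1] /= o1 n1 n1'.
  case: t2 o2 n2 n2' => [[[a2 b2] c2] s2] /= o2 n2 n2' c.
  have c1A := BBA _ _ _ _ o1 (nB _ n1) (nB _ n1').
  have c2A := BBA _ _ _ _ o2 (nB _ n2) (nB _ n2').
  by have := AA _ _ c1A c2A; rewrite c.
have [D [uD Dl dimD Dlead leadDd]] := leadJ_ex <[d]>%VS.
have d1 : \dim <[d]>%VS = 1%N by rewrite dim_vline dn.
have [i iD] : exists i, i \in D.
  by move: dimD; rewrite d1; case: (D) => [//|i D' _]; exists i; rewrite mem_head.
have [x /vlineP[c ->] xi] := Dlead _ iD; have i27 := lab _ (Dl _ iD).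
have iA : i \in A by apply: leadA i27 xi; rewrite memvZ.
have As : A = [:: i].
  case: (A) iA uA A1 => [//|a [|b A']] ia /= ua a1; first by move: ia; rewrite inE => /eqP ->.
  by move: ua; rewrite (a1 a b) ?inE ?eqxx ?orbT.
have J1d : J1 = <[d]>%VS.
  by apply/esym/eqP; rewrite eqEdim dimA As d1 /= andbT -memvE.
have Bnb k : k \in B -> collinear i k.
  move=> kB; apply: contraT => nc; have k27 := lab _ (Bl _ kB).
  have ik : i != k by apply/eqP => e; apply: (AB i iA); rewrite e.
  have [[[[m k'] i2] s] [/= tO e c2 i2n]] := non_collinear_link i27 k27 ik nc.
  rewrite e in tO; have := BBA _ _ _ _ tO (Anb _ _ iA c2) kB.
  by rewrite As inE (negPf i2n).
have dimV : \dim V = 10%N.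
  rewrite dimB -(neighbours_size i27); apply/perm_size/uniq_perm => //.
    by rewrite filter_uniq ?iota_uniq.
  move=> k; rewrite mem_filter; apply/idP/andP => [kB|[ik _]]; last exact: Anb iA ik.
  by split; [exact: Bnb | exact: Bl].
have [q qE] : {q : 'Hom(albert K, albert K) | q =1 across d}.
  by apply: linfunP => a y z; rewrite (mDr cnsJ) (mZr cnsJ).
have qV : (q @: fullv <= V)%VS.
  by apply/subvP => _ /memv_imgP[y _ ->]; rewrite qE JV.
have VE : V = (q @: fullv)%VS.
  apply/esym/eqP; rewrite eqEdim qV dimV.
  have [Q [uQ Ql -> Qlead leadQ]] := leadD_ex (q @: fullv).
  rewrite -(neighbours_size i27); apply: uniq_leq_size; first by rewrite filter_uniq ?iota_uniq.
  move=> j; rewrite mem_filter => /andP[/collinearP[m [s tO]] _].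
  have {}tO := rot _ _ _ _ tO; have [_ /= m27 j27] := olines_labels tO.
  apply: leadQ j27 (leadJ_across xi (leadJ_basis m27) tO).
  by rewrite (mZl cnsJ) -qE memvZ ?memv_img ?memvf.
split=> // k; rewrite VE; split=> [/memv_imgP[y _ ->]|[y ->]]; first by exists y; rewrite qE.
by rewrite -qE memv_img ?memvf.
Qed.
End AlbertSubspaces.

(** * Extension of scalars *)

Lemma linear_expand (K : fieldType) (U V : vectType K) (f : U -> V) (I : Type)
  (r : seq I) (c : I -> K) (v : I -> U) : linear f ->
  f (\sum_(i <- r) c i *: v i) = \sum_(i <- r) c i *: f (v i).
Proof.
move=> /linfunP[g gE]; rewrite -gE linear_sum; apply: eq_bigr => i _.
by rewrite linearZ /= gE.
Qed.

Section ScalarExtensionTheory.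
Variables (F K : fieldType) (iota : {rmorphism F -> K}) (A : invAlg F).
Local Notation X := (ext_alg iota A).
Local Notation n := (\dim {:A}).
Local Notation ext := (@ext_elt F K iota A).
Let e (i : 'I_n) : A := (vbasis {:A})`_i.

Lemma ext_elt_linear c (x y : A) : ext (c *: x + y) = iota c *: ext x + ext y.
Proof. by apply/rowP => i; rewrite !mxE linearP rmorphD rmorphM. Qed.

Lemma ext_eltD (x y : A) : ext (x + y) = ext x + ext y.
Proof. by rewrite -[x]scale1r ext_elt_linear rmorph1 !scale1r. Qed.

Lemma ext_elt0 : ext 0 = 0.
Proof. by apply/rowP => i; rewrite !mxE linear0 rmorph0. Qed.

Lemma ext_eltZ c (x : A) : ext (c *: x) = iota c *: ext x.
Proof. by rewrite -[c *: x]addr0 ext_elt_linear ext_elt0 addr0. Qed.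

Lemma ext_eltN (x : A) : ext (- x) = - ext x.
Proof. by rewrite -scaleN1r ext_eltZ rmorphN1 scaleN1r. Qed.

Lemma ext_elt_sum (I : Type) (r : seq I) (c : I -> F) (v : I -> A) :
  ext (\sum_(i <- r) c i *: v i) = \sum_(i <- r) iota (c i) *: ext (v i).
Proof.
elim: r => [|i r IH]; first by rewrite !big_nil ext_elt0.
by rewrite !big_cons ext_elt_linear IH.
Qed.

Lemma basis_expand (x : A) : x = \sum_i coord (vbasis {:A}) i x *: e i.
Proof. by apply: coord_vbasis; rewrite memvf. Qed.

Lemma ext_elt_inj : injective (ext : A -> 'rV[K]_n).
Proof.
move=> x y /rowP xy; rewrite [x]basis_expand [y]basis_expand.
apply: eq_bigr => i _; congr (_ *: _).
by have := xy i; rewrite !mxE => /fmorph_inj.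
Qed.

Lemma ext_elt_basis i : ext (e i) = delta_mx 0 i.
Proof.
apply/rowP => j; rewrite !mxE (coord_free _ _ (basis_free (vbasisP {:A}))).
by rewrite eqxx /= [in RHS]eq_sym; case: eqP => _; rewrite ?rmorph1 ?rmorph0.
Qed.

Lemma ext_expand (v : 'rV[K]_n) : v = \sum_i v 0 i *: ext (e i).
Proof. by rewrite {1}[v]row_sum_delta; apply: eq_bigr => i _; rewrite ext_elt_basis. Qed.

Lemma ext_mul_linear_l (y : X) : linear (fun x : X => inv_mul x y).
Proof.
move=> c x x'; rewrite /= scaler_sumr -big_split; apply: eq_bigr => i _ /=.
rewrite scaler_sumr -big_split; apply: eq_bigr => j _ /=.
by rewrite !mxE mulrDl scalerDl scalerA mulrA.
Qed.

Lemma ext_mul_linear_r (x : X) : linear (inv_mul x).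
Proof.
move=> c y y'; rewrite /= scaler_sumr -big_split; apply: eq_bigr => i _ /=.
rewrite scaler_sumr -big_split; apply: eq_bigr => j _ /=.
by rewrite !mxE mulrDr scalerDl scalerA mulrCA.
Qed.

Lemma ext_bar_linear : linear (@inv_bar K X).
Proof.
move=> c y y'; rewrite /= scaler_sumr -big_split; apply: eq_bigr => i _ /=.
by rewrite !mxE scalerDl scalerA.
Qed.

Hypothesis Ainv : is_invAlg A.

Lemma ext_mul (x y : A) : inv_mul (ext x : X) (ext y) = ext (inv_mul x y).
Proof.
have [lr ll _ _ _] := Ainv.
rewrite [x in RHS]basis_expand (linear_expand _ _ _ (ll y)) ext_elt_sum /=.
apply: eq_bigr => i _; rewrite [y in RHS]basis_expand (linear_expand _ _ _ (lr _)) ext_elt_sum.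
rewrite scaler_sumr; apply: eq_bigr => j _.
by rewrite !mxE scalerA.
Qed.

Lemma ext_bar (x : A) : inv_bar (ext x : X) = ext (inv_bar x).
Proof.
have [_ _ _ lb _] := Ainv.
rewrite [x in RHS]basis_expand (linear_expand _ _ _ lb) ext_elt_sum /=.
by apply: eq_bigr => i _; rewrite !mxE.
Qed.

Lemma ext_one_l : left_id (inv_one X) (@inv_mul K X).
Proof.
have [_ _ [one_l _] _ _] := Ainv.
move=> v; rewrite [v]ext_expand (linear_expand _ _ _ (ext_mul_linear_r _)).
by apply: eq_bigr => i _; rewrite (ext_mul (inv_one A)) one_l.
Qed.

Lemma ext_triple (x y z : A) : triple (ext x : X) (ext y) (ext z) = ext (triple x y z).
Proof. by rewrite /triple !ext_bar !ext_mul !ext_eltD ext_eltN. Qed.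

Lemma ext_dim : \dim {:X} = \dim {:A}.
Proof. by rewrite [LHS]dimvf /= dim_matrix mul1r. Qed.

End ScalarExtensionTheory.

(** A semilinear homomorphism extends to scalars of K; the extension is bijective when
its image spans and the dimensions agree. *)
Lemma ext_lift (F K : fieldType) (iota : {rmorphism F -> K}) (A : invAlg F) (B : invAlg K)
    (g : A -> B) :
  (forall c x y, g (c *: x + y) = iota c *: g x + g y) ->
  (forall x y, g (inv_mul x y) = inv_mul (g x) (g y)) ->
  (forall x, g (inv_bar x) = inv_bar (g x)) ->
  (forall x : B, linear (inv_mul x)) -> (forall y : B, linear (fun x => inv_mul x y)) ->
  linear (@inv_bar K B) ->
  (forall U : {vspace B}, (forall x, g x \in U) -> U = fullv) ->
  \dim {:B} = \dim {:A} ->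
  exists h : 'Hom(ext_alg iota A, B), inv_iso h.
Proof.
move=> gL gM gbar mr ml bl g_span dimB; pose e i := (vbasis {:A})`_i.
have gZ c x : g (c *: x) = iota c *: g x.
  have g0 : g 0 = 0 by have := gL (-1) 0 0; rewrite scaler0 addr0 rmorphN1 scaleN1r addNr.
  by rewrite -[c *: x]addr0 gL g0 addr0.
have gD x y : g (x + y) = g x + g y by rewrite -[x]scale1r gL rmorph1 !scale1r.
have [h hE] : {h : 'Hom(ext_alg iota A, B) | h =1 fun v => \sum_i v 0 i *: g (e i)}.
  apply: linfunP => c v w; rewrite scaler_sumr -big_split; apply: eq_bigr => i _ /=.
  by rewrite !mxE scalerDl scalerA.
have h_ext x : h (ext_elt iota x : ext_alg iota A) = g x.
  rewrite hE [x in RHS]basis_expand; elim/big_ind2: _ => [|a u b v -> ->|i _].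
  - by rewrite -[in RHS](scale0r (0 : A)) gZ rmorph0 scale0r.
  - by rewrite gD.
  by rewrite mxE gZ.
have hS : limg h = fullv.
  by apply: g_span => x; rewrite -h_ext memv_img ?memvf.
have hI : lker h == 0%VS.
  have := limg_ker_dim h fullv; rewrite hS capfv dimB (ext_dim iota) => /eqP.
  by rewrite -[X in _ == X]add0n eqn_add2r dimv_eq0.
exists h; split.
- exists (h^-1)%VF; first exact: lker0_lfunK.
  by move=> y; rewrite limg_lfunVK ?hS ?memvf.
- move=> v w; rewrite linear_sum [h v]hE (linear_expand _ _ _ (ml _)) /=.
  apply: eq_bigr => i _; rewrite linear_sum [h w]hE (linear_expand _ _ _ (mr _)) scaler_sumr.
  by apply: eq_bigr => j _; rewrite linearZ /= h_ext gM scalerA.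
move=> v; rewrite linear_sum [h v]hE (linear_expand _ _ _ bl).
by apply: eq_bigr => i _; rewrite linearZ /= h_ext gbar.
Qed.

Lemma inv_iso_comp (K : fieldType) (A B C : invAlg K) (g : 'Hom(B, C)) (h : 'Hom(A, B)) :
  inv_iso g -> inv_iso h -> inv_iso (g \o h)%VF.
Proof.
move=> [gb gM gbar] [hb hM hbar]; split=> [|x y|x]; last by rewrite !comp_lfunE hbar gbar.
  by apply: (eq_bij (bij_comp gb hb)) => x; rewrite comp_lfunE.
by rewrite !comp_lfunE hM gM.
Qed.

Section TripleLinear.
Variables (K : fieldType) (X : invAlg K).
Hypothesis mul_r : forall x : X, linear (inv_mul x).
Hypothesis mul_l : forall y : X, linear (fun x : X => inv_mul x y).
Hypothesis bar_l : linear (@inv_bar K X).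

Let mr c (x y y' : X) : inv_mul x (c *: y + y') = c *: inv_mul x y + inv_mul x y'.
Proof. exact: mul_r. Qed.
Let ml c (x y y' : X) : inv_mul (c *: y + y') x = c *: inv_mul y x + inv_mul y' x.
Proof. exact: (mul_l x). Qed.

(** The polarization of x |-> U_x y. It is linear in each argument, so its values on an
extended subspace are determined by those on the original one. *)
Definition sym_triple (y x x' : X) : X := triple x y x' + triple x' y x.

Lemma triple_addAC (V : lmodType K) c (p q r p' q' r' : V) :
  c *: p + p' + (c *: q + q') - (c *: r + r') = c *: (p + q - r) + (p' + q' - r').
Proof. by rewrite addrACA -scalerDr opprD addrACA -scalerBr. Qed.

Lemma triple_linear_l (y z : X) : linear (fun x : X => triple x y z).
Proof. by move=> c x x'; rewrite /triple bar_l !(ml, mr) triple_addAC. Qed.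

Lemma triple_linear_m (x z : X) : linear (fun y : X => triple x y z).
Proof. by move=> c y y'; rewrite /triple bar_l !(ml, mr) triple_addAC. Qed.

Lemma triple_linear_r (x y : X) : linear (triple x y).
Proof. by move=> c z z'; rewrite /triple !(ml, mr) triple_addAC. Qed.

Lemma sym_tripleC (y x x' : X) : sym_triple y x x' = sym_triple y x' x.
Proof. by rewrite /sym_triple addrC. Qed.

Lemma sym_triple_linear (y x' : X) : linear (fun x => sym_triple y x x').
Proof.
move=> c x z; rewrite /sym_triple (triple_linear_l y x') (triple_linear_r x' y).
by rewrite /= [c *: (triple x y x' + _)]scalerDr addrACA.
Qed.

Lemma sym_tripleE (y x x' : X) : sym_triple y x x' = U_ (x + x') y - U_ x y - U_ x' y.
Proof.
have Dl (a b c d : X) : triple (a + b) c d = triple a c d + triple b c d.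
  by have := triple_linear_l c d 1 a b; rewrite !scale1r.
have Dr (a b c d : X) : triple c d (a + b) = triple c d a + triple c d b.
  by have := triple_linear_r c d 1 a b; rewrite !scale1r.
rewrite /U_ Dl !Dr /sym_triple.
move: (triple x y x) (triple x y x') (triple x' y x) (triple x' y x') => p q r s.
by rewrite addrA [_ - s]addrAC addrK -!addrA addrC -!addrA addNr addr0.
Qed.

Lemma sym_triple_diag (y x : X) : sym_triple y x x = 2 *: U_ x y.
Proof. by rewrite /sym_triple -mulr2n scaler_nat. Qed.
End TripleLinear.

Section ScalarExtensionIdeals.
Variables (F K : fieldType) (iota : {rmorphism F -> K}) (A : invAlg F).
Local Notation X := (ext_alg iota A).
Local Notation ext := (@ext_elt F K iota A : A -> X).
Implicit Type I : {vspace A}.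
Let mr := @ext_mul_linear_r F K iota A.
Let ml := @ext_mul_linear_l F K iota A.
Let bl := @ext_bar_linear F K iota A.
Hypothesis Ainv : is_invAlg A.
Hypothesis K2 : 2%:R != 0 :> K.

Lemma ext_sub_mem I x : x \in I -> ext x \in ext_sub iota I.
Proof.
move=> /coord_vbasis ->; rewrite ext_elt_sum; apply: memv_suml => i _.
apply/memvZ/memv_span; apply/mapP; exists (vbasis I)`_i => //.
by apply/mem_nth; rewrite size_tuple.
Qed.

Lemma ext_sub_ind I (P : X -> Prop) : P 0 ->
  (forall c x y, P x -> P y -> P (c *: x + y)) ->
  (forall a, a \in I -> P (ext a)) -> forall x, x \in ext_sub iota I -> P x.
Proof.
move=> P0 PD PI x; rewrite /ext_sub.
have /= -> := @span_def _ _ [seq (ext a : X) | a <- vbasis I].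
rewrite big_map big_seq.
elim/big_ind: (_) x => [x|U V IU IV x|a aI x].
- by rewrite memv0 => /eqP ->.
- by move=> /memv_addP[u uU [v vV ->]]; rewrite -[u]scale1r; apply: PD; [apply: IU|apply: IV].
by move=> /vlineP[c ->]; rewrite -[_ *: _]addr0; apply: PD => //; apply/PI/vbasis_mem.
Qed.

Lemma ext_sub_dim I : \dim (ext_sub iota I) = \dim I.
Proof.
have le U : (\dim (ext_sub iota U) <= \dim U)%N.
  by rewrite (leq_trans (dim_span _)) // size_map size_tuple.
apply/eqP; rewrite eqn_leq le -(leq_add2r (\dim (ext_sub iota I^C))).
apply: (@leq_trans (\dim I + \dim I^C)%N); first by rewrite leq_add2l.
rewrite -dimv_disjoint_sum ?capv_compl // addv_complf -(ext_dim iota).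
apply: leq_trans (dimv_add_leqif _ _); apply/dimvS/subvP => v _.
rewrite [v](ext_expand iota _); apply: memv_suml => i _; apply: memvZ.
have : (vbasis {:A})`_i \in (I + I^C)%VS by rewrite addv_complf memvf.
by case/memv_addP => a aI [b bI ->]; rewrite ext_eltD memv_add ?ext_sub_mem.
Qed.

Lemma ext_sub_proper I : I != fullv -> ext_sub iota I != fullv.
Proof.
apply: contra_neq => E; apply/eqP; rewrite eqEdim subvf -(ext_dim iota) -E.
by rewrite ext_sub_dim leqnn.
Qed.

Lemma ext_sub_inner I : inner_ideal I -> inner_ideal (ext_sub iota I).
Proof.
move=> iI x xI y.
have [lr ll _ lb _] := Ainv.
have Q a b z : a \in I -> b \in I -> sym_triple z (ext a) (ext b) \in ext_sub iota I.
  move=> aI bI; rewrite [z](ext_expand iota _).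
  have lz : linear (fun z : X => sym_triple z (ext a) (ext b)).
    move=> c u v; rewrite /sym_triple !(triple_linear_m mr ml bl).
    by rewrite /= [c *: (triple (ext a) u (ext b) + _)]scalerDr addrACA.
  rewrite (linear_expand _ _ _ lz); apply: memv_suml => i _; apply: memvZ.
  rewrite /sym_triple !(ext_triple iota Ainv) -ext_eltD; apply: ext_sub_mem.
  rewrite -/(sym_triple (vbasis {:A})`_i a b) (sym_tripleE lr ll lb).
  by apply: rpredB; [apply: rpredB|]; apply: iI => //; apply: rpredD.
have {}Q u v z : u \in ext_sub iota I -> v \in ext_sub iota I -> sym_triple z u v \in ext_sub iota I.
  have SL := sym_triple_linear mr ml bl.
  have S0 (t w : X) : sym_triple t 0 w = 0.
    by have := SL t w (-1) 0 0; rewrite /= scaler0 addr0 scaleN1r addNr.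
  move=> + vI; move: u; apply: ext_sub_ind => [|c u u' uI u'I|a aI].
  - by rewrite S0 mem0v.
  - by rewrite SL rpredD ?memvZ.
  move: v vI; apply: ext_sub_ind => [|c u u' uI u'I|b bI].
  - by rewrite sym_tripleC S0 mem0v.
  - rewrite sym_tripleC SL; apply: rpredD; last by rewrite sym_tripleC.
    by apply: memvZ; rewrite sym_tripleC.
  exact: Q.
by have := Q x x y xI xI; rewrite sym_triple_diag => /(memvZ 2^-1); rewrite scalerA mulVf // scale1r.
Qed.

Lemma ext_singular (a : A) : singular a -> singular (ext a : X).
Proof.
move=> [an as_]; split=> [|y].
  by apply: contra_neq an => e0; apply: (@ext_elt_inj _ _ iota); rewrite ext_elt0.
rewrite [y](ext_expand iota _).
rewrite /U_ (linear_expand _ _ _ (triple_linear_m mr ml bl _ _)).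
apply: memv_suml => i _; apply: memvZ; rewrite (ext_triple iota Ainv).
by have /vlineP[c] := as_ ((vbasis {:A})`_i); rewrite /U_ => ->; rewrite ext_eltZ memvZ ?memv_line.
Qed.

Lemma singular_ext (a : A) : singular (ext a : X) -> singular a.
Proof.
move=> [an as_]; split=> [|y].
  by apply: contra_neq an => ->; rewrite ext_elt0.
have /vlineP[l] := as_ (ext y); rewrite /U_ (ext_triple iota Ainv) => lE.
have an0 : a != 0 by apply: contra_neq an => ->; rewrite ext_elt0.
have [i ai] : exists i, coord (vbasis {:A}) i a != 0.
  apply: contrapT => H; case/eqP: an0; rewrite [a]basis_expand big1 // => i _.
  case: (eqVneq (coord (vbasis {:A}) i a) 0) => [->|ai]; first by rewrite scale0r.
  by case: H; exists i.
pose m := coord (vbasis {:A}) i (triple a y a) / coord (vbasis {:A}) i a.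
apply/vlineP; exists m; apply: (@ext_elt_inj _ _ iota).
rewrite lE ext_eltZ; congr (_ *: _).
have := congr1 (fun v : 'rV_ _ => v 0 i) lE; rewrite !mxE /m => E.
by rewrite fmorph_div E mulfK // fmorph_eq0.
Qed.

(** Singularity of all elements of I is the identity sym_triple z u v = (L z u) v + (L z v) u
for u and v in I, which is bilinear and so passes to the extension. *)
Lemma ext_singular_ideal I (L : X -> X -> K) :
  (forall z a x y, L z (a *: x + y) = a * L z x + L z y) ->
  (forall e z, singular e -> U_ e z = L z e *: e) ->
  singular_ideal I <-> singular_ideal (ext_sub iota I).
Proof.
move=> Llin LU; split=> sI; last first.
  move=> a aI an; apply: singular_ext; apply: sI; first exact: ext_sub_mem.
  by apply: contra_neq an => e0; apply: (@ext_elt_inj _ _ iota); rewrite ext_elt0.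
move=> x xI xn; split=> // z; suff -> : U_ x z = L z x *: x by rewrite memvZ ?memv_line.
have SL := sym_triple_linear mr ml bl.
have L0 : L z 0 = 0 by have := Llin z (-1) 0 0; rewrite scaler0 addr0 mulN1r addNr.
have LD u v : L z (u + v) = L z u + L z v.
  by have := Llin z 1 u v; rewrite scale1r mul1r.
have S0 w : sym_triple z 0 w = 0 :> X.
  by have := SL z w (-1) 0 0; rewrite /= scaler0 addr0 scaleN1r addNr.
have UI a : a \in I -> U_ (ext a : X) z = L z (ext a) *: ext a.
  move=> aI; have [->|an] := eqVneq a 0; last by apply: LU; apply/ext_singular/sI.
  rewrite ext_elt0 scaler0; apply: (scalerI K2).
  by rewrite -sym_triple_diag S0 scaler0.
have Q a b : a \in I -> b \in I ->
    sym_triple z (ext a : X) (ext b) = L z (ext a) *: ext b + L z (ext b) *: ext a.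
  move=> aI bI; rewrite (sym_tripleE mr ml bl).
  rewrite -ext_eltD !UI ?rpredD // ext_eltD LD scalerDl !scalerDr.
  move: (L z _ *: _) (L z _ *: _) (L z _ *: _) (L z _ *: _) => p q r s.
  by rewrite addrA [_ - s]addrAC addrK -!addrA addrC -!addrA addNr addr0.
have {}Q u v : u \in ext_sub iota I -> v \in ext_sub iota I ->
    sym_triple z u v = L z u *: v + L z v *: u.
  move=> + vI; move: u; apply: ext_sub_ind => [|c u u' uE u'E|a aI].
  - by rewrite S0 L0 scale0r scaler0 addr0.
  - by rewrite SL uE u'E Llin scalerDl !scalerDr !scalerA addrACA [L z v * c]mulrC.
  move: v vI; apply: ext_sub_ind => [|c u u' uE u'E|b bI].
  - by rewrite sym_tripleC S0 L0 scale0r scaler0 addr0.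
  - rewrite sym_tripleC SL -!(sym_tripleC z (ext a)) uE u'E Llin scalerDl !scalerDr !scalerA.
    by rewrite addrACA [L z (ext a) * c]mulrC.
  exact: Q.
apply: (scalerI K2); rewrite -sym_triple_diag Q //.
by rewrite -mulr2n scaler_nat.
Qed.

End ScalarExtensionIdeals.

(** * The split Brown algebra *)

Section BrownSplit.
Variable K : fieldType.
Hypothesis K2 : 2%:R != 0 :> K.
Hypothesis K3 : 3%:R != 0 :> K.
Local Notation B := (brown_split K).
Let cnsJ := albert_cns K2.

Definition brown_elt (a : K) (j k : albert K) (b : K) : B := ((a, j), (k, b)).

Lemma brown_split_frame : brown_frame (@atrform K) (@across K) brown_elt
  (fun x : B => x.1.1) (fun x : B => x.1.2) (fun x : B => x.2.1) (fun x : B => x.2.2).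
Proof. by split=> //; case=> [[a j] [k b]]. Qed.

Lemma brown_mul_linear_r (x : B) : linear (inv_mul x).
Proof. exact: (frame_mul_linear_r cnsJ brown_split_frame). Qed.

Lemma brown_mul_linear_l (x : B) : linear (fun y : B => inv_mul y x).
Proof. exact: (frame_mul_linear_l cnsJ brown_split_frame). Qed.

Lemma brown_bar_linear : linear (@inv_bar K B).
Proof. exact: (frame_bar_linear brown_split_frame). Qed.

Lemma brown_split_full (U : {vspace B}) :
  brown_elt 1 0 0 0 \in U -> (forall m, brown_elt 0 (basis27 K m) 0 0 \in U) ->
  (forall m, brown_elt 0 0 (basis27 K m) 0 \in U) -> brown_elt 0 0 0 1 \in U -> U = fullv.
Proof.
move=> U11 U12 U21 U22; apply: (frame_full brown_split_frame) => // [j|k].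
- rewrite (basis27_expand K2 j) (linear_expand _ _ _ (frame_linearJ brown_split_frame)).
  by apply: memv_suml => m _; apply: memvZ.
- rewrite (basis27_expand K2 k) (linear_expand _ _ _ (frame_linearK brown_split_frame)).
  by apply: memv_suml => m _; apply: memvZ.
Qed.

Lemma brown_inner_ideal (A : invAlg K) (theta : 'Hom(A, B)) (s : A) (I : {vspace A}) :
  inv_iso theta -> left_id (inv_one A) (@inv_mul K A) ->
  inv_bar s = - s -> s != 0 -> inner_ideal I -> I != fullv ->
  (exists2 e, e \in I & singular e) ->
  exists (W : {vspace B}) (f : 'End(A)),
  [/\ inner_ideal W, in_Inv s f, I = (f @: (theta @^-1: W))%VS &
    (form_a W /\ (\dim I <= 7)%N /\ singular_ideal I) \/
    (form_b W /\ \dim I = 12%N /\ ~ singular_ideal I)].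
Proof.
move=> iso one_l bs s0 iI In Is.
exact: (inner_ideal_brown K2 K3 cnsJ brown_split_frame (albert_sing_span K2) (albert_norm_neq0 K)
  (totally_singular_dim K2 (K := K)) (point_ideal K2 (K := K)) iso one_l bs s0 iI In Is).
Qed.

Lemma brown_singular_quadratic (A : invAlg K) (theta : 'Hom(A, B)) :
  inv_iso theta ->
  exists L : A -> A -> K,
  (forall (z : A) (a : K) (x y : A), L z (a *: x + y) = a * L z x + L z y) /\
  forall e z : A, singular e -> U_ e z = L z e *: e.
Proof.
exact: (singular_quadratic K2 K3 cnsJ brown_split_frame (albert_sing_span K2) (albert_norm_neq0 K)).
Qed.
End BrownSplit.

(** * Base change of the split Brown algebra *)

Section BaseChangeSplit.
Variables (F K : fieldType) (iota : {rmorphism F -> K}).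
Hypothesis F2 : 2%:R != 0 :> F.
Hypothesis K2 : 2%:R != 0 :> K.
Implicit Types (x y : albert F) (a b : oct F) (c : F).
Local Notation amap := (@albert_map F K iota).

Definition oct_map a : oct K := (map_mx iota a.1, map_mx iota a.2).

Lemma mconj_map (A : 'M[F]_2) : map_mx iota (mconj A) = mconj (map_mx iota A).
Proof. by rewrite /mconj map_mxB map_scalar_mx trace_map_mx. Qed.

Lemma oct_mapM a b : oct_map (omul a b) = omul (oct_map a) (oct_map b).
Proof. by rewrite /oct_map /omul /= !map_mxD !map_mxM !mconj_map. Qed.

Lemma oct_map_conj a : oct_map (oconj a) = oconj (oct_map a).
Proof. by rewrite /oct_map /oconj /= mconj_map map_mxN. Qed.

Lemma oct_mapD a b : oct_map (a + b) = oct_map a + oct_map b.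
Proof. by rewrite /oct_map !map_mxD. Qed.

Lemma oct_mapZ c a : oct_map (c *: a) = iota c *: oct_map a.
Proof. by rewrite /oct_map !map_mxZ. Qed.

Lemma otr_map a : otr (oct_map a) = iota (otr a).
Proof. by rewrite /otr trace_map_mx. Qed.

Lemma albert_map_linear c x y : amap (c *: x + y) = iota c *: amap x + amap y.
Proof.
congr pair; first by rewrite map_mxD map_mxZ.
apply/ffunP => i; rewrite !ffunE -!/(oct_map _).
by rewrite oct_mapD oct_mapZ.
Qed.

Lemma albert_mapZ c x : amap (c *: x) = iota c *: amap x.
Proof.
have a0 : amap 0 = 0 by have := albert_map_linear (-1) 0 0; rewrite scaler0 addr0 rmorphN1 scaleN1r addNr.
by rewrite -[c *: x]addr0 albert_map_linear a0 addr0.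
Qed.

Lemma albert_mapD x y : amap (x + y) = amap x + amap y.
Proof. by rewrite -[x]scale1r albert_map_linear rmorph1 !scale1r. Qed.

Lemma atrform_map x y : atrform (amap x) (amap y) = iota (atrform x y).
Proof.
rewrite !atrformE // rmorph_sum; apply: eq_bigr => i _.
rewrite !mxE !ffunE -!/(oct_map _) -oct_map_conj -oct_mapM otr_map.
by rewrite rmorphD rmorphM.
Qed.

Lemma across_map x y : across (amap x) (amap y) = amap (across x y).
Proof.
rewrite !acrossE //; congr pair.
  apply/rowP => i; rewrite !mxE !ffunE -!/(oct_map _) -oct_map_conj -oct_mapM otr_map.
  by rewrite rmorphB rmorphD !rmorphM.
apply/ffunP => i; rewrite !ffunE !mxE -!/(oct_map _) -!oct_mapM -oct_mapD -oct_map_conj.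
by rewrite -!scaleNr -!rmorphN -!oct_mapZ -!oct_mapD.
Qed.

Lemma albert_map_basis m : amap (basis27 F m) = basis27 K m.
Proof.
congr pair; first by apply/rowP => i; rewrite !mxE rmorph_nat.
by apply/ffunP => i; rewrite !ffunE !mx2_map /delta !rmorph_nat.
Qed.

Definition brown_map (x : brown_split F) : brown_split K :=
  brown_elt (iota x.1.1) (amap x.1.2) (amap x.2.1) (iota x.2.2).

Lemma brown_map_linear c (x y : brown_split F) :
  brown_map (c *: x + y) = iota c *: brown_map x + brown_map y.
Proof.
case: x => [[a j] [k b]]; case: y => [[a' j'] [k' b']].
have E u v : iota (c * u + v) = iota c * iota u + iota v by rewrite rmorphD rmorphM.
transitivity (brown_elt (iota c * iota a + iota a') (iota c *: amap j + amap j')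
  (iota c *: amap k + amap k') (iota c * iota b + iota b')); last by [].
by rewrite -!albert_map_linear -!E.
Qed.

Lemma brown_mapM (x y : brown_split F) :
  brown_map (inv_mul x y) = inv_mul (brown_map x) (brown_map y).
Proof.
have E (r s : F) (j1 j2 u : albert F) :
    amap (r *: j1 + s *: j2 + u) = iota r *: amap j1 + iota s *: amap j2 + amap u.
  by rewrite albert_mapD albert_map_linear albert_mapZ.
case: x => [[a j] [k b]]; case: y => [[a' j'] [k' b']].
rewrite /brown_map /=; congr ((_, _), (_, _)).
- by rewrite rmorphD rmorphM atrform_map.
- by rewrite E across_map.
- by rewrite E across_map.
- by rewrite rmorphD rmorphM atrform_map.
Qed.

Lemma brown_map_bar (x : brown_split F) : brown_map (inv_bar x) = inv_bar (brown_map x).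
Proof. by case: x => [[a j] [k b]]. Qed.

(** The standard basis of the split Brown algebra is defined over F. *)
Lemma brown_map_span (U : {vspace brown_split K}) :
  (forall x : brown_split F, brown_map x \in U) -> U = fullv.
Proof.
move=> Ug.
have a0 : amap 0 = 0 by rewrite -(scale0r (0 : albert F)) albert_mapZ rmorph0 scale0r.
have UM (a : F) (j k : albert F) (b : F) : brown_elt (iota a) (amap j) (amap k) (iota b) \in U.
  exact: (Ug (brown_elt a j k b)).
apply: (brown_split_full K2) => [|m|m|].
- by have := UM 1 0 0 0; rewrite a0 rmorph0 rmorph1.
- by have := UM 0 (basis27 F m) 0 0; rewrite albert_map_basis a0 rmorph0.
- by have := UM 0 0 (basis27 F m) 0; rewrite albert_map_basis a0 rmorph0.
by have := UM 0 0 0 1; rewrite a0 rmorph0 rmorph1.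
Qed.

Lemma brown_split_base_change : exists h : 'Hom(ext_alg iota (brown_split F), brown_split K), inv_iso h.
Proof.
apply: (@ext_lift F K iota _ _ brown_map).
- exact: brown_map_linear.
- exact: brown_mapM.
- exact: brown_map_bar.
- exact: brown_mul_linear_r.
- exact: brown_mul_linear_l.
- exact: brown_bar_linear.
- exact: brown_map_span.
by rewrite !dimvf.
Qed.

End BaseChangeSplit.

(** * Inner ideals of Brown algebras *)

Theorem theorem6p13 (F Fs : fieldType) (iota : {rmorphism F -> Fs})
    (B : invAlg F) (s0 : B) (I : {vspace B}) :
  2%N \notin [pchar F] -> 3%N \notin [pchar F] ->
  separable_closure iota ->
  is_brown iota B ->
  inv_bar s0 = - s0 -> s0 != 0 ->
  inner_ideal I -> I != fullv ->
  (exists2 e, e \in I & singular e) ->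
  (forall theta : 'Hom(ext_alg iota B, brown_split Fs), inv_iso theta ->
     exists (W : {vspace brown_split Fs}) (f : 'End(ext_alg iota B)),
       [/\ inner_ideal W, form_a W \/ form_b W,
           in_Inv (A := ext_alg iota B) (ext_elt iota s0) f &
           ext_sub iota I = (f @: (theta @^-1: W))%VS]) /\
  ((\dim I <= 7)%N /\ singular_ideal I \/ \dim I = 12%N /\ ~ singular_ideal I).
Proof.
move=> F2 F3 _ [Binv [h hiso]] s0_skew s0_neq0 iI In [e eI es].
have {}F2 : 2%:R != 0 :> F by apply: contraNneq F2 => F2; rewrite inE /= F2 eqxx.
have {}F3 : 3%:R != 0 :> F by apply: contraNneq F3 => F3; rewrite inE /= F3 eqxx.
have K2 : 2%:R != 0 :> Fs by rewrite -(rmorph_nat iota) fmorph_eq0.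
have K3 : 3%:R != 0 :> Fs by rewrite -(rmorph_nat iota) fmorph_eq0.
have main (theta : 'Hom(ext_alg iota B, brown_split Fs)) (iso : inv_iso theta) :=
  @brown_inner_ideal Fs K2 K3 (ext_alg iota B) theta (ext_elt iota s0) (ext_sub iota I)
    iso (ext_one_l (iota := iota) Binv).
have s_skew : inv_bar (ext_elt iota s0 : ext_alg iota B) = - ext_elt iota s0.
  by rewrite (ext_bar iota Binv) s0_skew ext_eltN.
have s_neq0 : ext_elt iota s0 != 0.
  by apply: contra_neq s0_neq0 => s0E; apply: (@ext_elt_inj _ _ iota); rewrite s0E ext_elt0.
have e_ext : exists2 e : ext_alg iota B, e \in ext_sub iota I & singular e.
  exists (ext_elt iota e : ext_alg iota B); first exact: (ext_sub_mem iota eI).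
  exact: (ext_singular iota Binv es).
have {}main theta iso := main theta iso s_skew s_neq0 (ext_sub_inner Binv K2 iI)
  (ext_sub_proper iota In) e_ext.
split=> [theta iso|].
  have [W [f [iW fI IE forms]]] := main theta iso; exists W, f; split=> //.
  by case: forms => [[]|[]]; [left|right].
have [g giso] := brown_split_base_change iota F2 K2.
have iso := inv_iso_comp giso hiso.
have [W [f [_ _ _ dims]]] := main _ iso.
have [L [Llin LU]] := brown_singular_quadratic K2 K3 iso.
have sI := ext_singular_ideal Binv K2 I Llin LU.
by move: dims; rewrite ext_sub_dim -sI => -[[_ ?]|[_ ?]]; [left|right].
Qed.
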